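(* Let $m$ be any non-atomic, fully supported probability measure on $\mathbf{R}_+=(0,+\infty)$. Then there exist a normalizing constant $\lambda_{cr}>0$ and a non-atomic $\mathbf{\Phi}_{\lambda_{cr}}$-stationary random metric $\overline{\mathbf{m}}$, i.e. a non-atomic Radon probability measure $\overline{\mathbf{m}}$ on $\mathbf{M}$ with $\mathbf{\Phi}_{\lambda_{cr}}[\overline{\mathbf{m}}]=\overline{\mathbf{m}}$.
   Context: Figure eight-graph: $\Gamma$ is the graph with vertices $I$ (in), $M$ (middle), $O$ (out), and four oriented edges: $e_1,e_2$ from $I$ to $M$, and $e_3,e_4$ from $M$ to $O$. Let $\Gamma_0$ be a single edge from $I$ to $O$; inductively, $\Gamma_n$ (vertex set $V_n$) is obtained from $\Gamma_{n-1}$ by replacing each oriented edge $(x,y)$ by a copy of $\Gamma$, with $I$ placed at $x$ and $O$ placed at $y$. There are natural inclusions $V_n\hookrightarrow V_{n+1}$; put $V_\infty=\bigcup_n V_n$. Note that $V_\infty$ is obtained from four copies of itself (one for each edge $e_i$ of $\Gamma$) by identifying the $I$ and $O$ points of the $i$-th copy with the initial and final endpoint of $e_i$ respectively. The space $\mathbf{M}$: the set of complete metric spaces $(\mathcal{X},d)$ that contain $V_\infty$ as a dense subset (such a space is determined by the restriction of $d$ to $V_\infty\times V_\infty$); it is equipped with the topology of pointwise convergence of $d$ on $V_\infty\times V_\infty$. Glueing: for $\lambda>0$, the map $\mathcal{R}_\lambda:\mathbf{M}^4\times\mathbf{R}_+\to\mathbf{M}$ sends $((\mathcal{X}_i,d_i)_{i=1}^4;\xi)$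 to $(\mathcal{X},d)$, where $\mathcal{X}$ is obtained by glueing the spaces $\mathcal{X}_i$ in the figure-eight shape (the points $I,O$ of $\mathcal{X}_i$ are placed at the initial and final endpoints of $e_i$), and $d$ is $\lambda\xi$ times the glued metric, i.e. the distance of two points is $\lambda\xi$ times the infimum of lengths of finite chains joining them, each step of the chain being inside one $\mathcal{X}_i$ and measured by $d_i$. For the given probability measure $m$ on $\mathbf{R}_+$, the operator $\mathbf{\Phi}_\lambda$ acts on Radon probability measures $\mathbf{m}$ on $\mathbf{M}$ by $\mathbf{\Phi}_\lambda[\mathbf{m}]=(\mathcal{R}_\lambda)_*(\mathbf{m}^{\otimes 4}\otimes m)$ (push-forward). A Radon probability measure with $\mathbf{\Phi}_\lambda[\mathbf{m}]=\mathbf{m}$ is called a $\mathbf{\Phi}_\lambda$-stationary random metric. *)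

(* Defs.v *)
From HB Require Import structures.
From mathcomp Require Import all_boot all_order all_algebra.
From mathcomp Require Import all_classical all_reals all_analysis.
From mathcomp Require Import lra.

Set Implicit Arguments.
Unset Strict Implicit.
Unset Printing Implicit Defensive.

Import Order.TTheory GRing.Theory Num.Theory.
Import numFieldNormedType.Exports.

Local Open Scope classical_set_scope.
Local Open Scope ring_scope.

Inductive Gvertex := GI | GM | GO.
Inductive Gedge := E1 | E2 | E3 | E4.

Definition Gsrc (e : Gedge) : Gvertex :=
  match e with E1 | E2 => GI | E3 | E4 => GM end.
Definition Gtgt (e : Gedge) : Gvertex :=
  match e with E1 | E2 => GM | E3 | E4 => GO end.

(** The edges of [Gamma_n] are the words of length [n] over [Gedge]: the edges
    of the copy of [Gamma] that replaces the edge [w] are the words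
    [rcons w e]. That replacement creates exactly one new vertex, the middle
    point of the copy, written [VMid w]; hence [V_n] consists of [VIn], [VOut]
    and the [VMid w] with [size w < n]. *)
Inductive Vinf := VIn | VOut | VMid of seq Gedge.

Definition refine_edge (p : seq Gedge * (Vinf * Vinf)) (e : Gedge) :=
  let: (w, (x, y)) := p in
  let place v := match v with GI => x | GM => VMid w | GO => y end in
  (rcons w e, (place (Gsrc e), place (Gtgt e))).

(** Initial and final endpoints of the edge [w]. *)
Definition edge_ends (w : seq Gedge) : Vinf * Vinf :=
  (foldl refine_edge ([::], (VIn, VOut)) w).2.

Definition Vinf_of_Gvertex (v : Gvertex) : Vinf :=
  match v with GI => VIn | GM => VMid [::] | GO => VOut end.

(** The inclusion in [V_oo] of the copy of [V_oo] that sits on the edge [e]. *)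
Definition copy (e : Gedge) (x : Vinf) : Vinf :=
  match x with
  | VIn => Vinf_of_Gvertex (Gsrc e)
  | VOut => Vinf_of_Gvertex (Gtgt e)
  | VMid w => VMid (e :: w)
  end.

Lemma edge_ends_cons e w :
  edge_ends (e :: w) = (copy e (edge_ends w).1, copy e (edge_ends w).2).
Proof.
have H u x y : foldl refine_edge (e :: u, (copy e x, copy e y)) w =
    let p := foldl refine_edge (u, (x, y)) w in
    (e :: p.1, (copy e p.2.1, copy e p.2.2)).
  elim: w u x y => [//|f w IH] u x y /=.
  by case: f; [exact: (IH _ x (VMid u))|exact: (IH _ x (VMid u))
    |exact: (IH _ (VMid u) y)|exact: (IH _ (VMid u) y)].
have := H [::] VIn VOut; rewrite /edge_ends /=.
by case: e {H} => /= ->.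
Qed.

Section chains.
Context {R : realType} (X : Gedge -> Type) (d : forall e, X e -> X e -> R).
Context (P : Type) (j : {e & X e} -> P).

(** A step [(x, y)] inside the cell [X e]. *)
Definition step : Type := {e : Gedge & (X e * X e)%type}.
Definition step_src (s : step) : {e & X e} := existT X (tag s) (tagged s).1.
Definition step_tgt (s : step) : {e & X e} := existT X (tag s) (tagged s).2.
Definition step_length (s : step) : R := d (tagged s).1 (tagged s).2.

(** [P] is the glued space, and [j] maps the disjoint union of the cells
    to it. *)
Fixpoint is_chain (p q : P) (c : seq step) : Prop :=
  match c with
  | [::] => p = q
  | s :: c' => j (step_src s) = p /\ is_chain (j (step_tgt s)) q c'
  end.

Definition chain_length (c : seq step) : R := \sum_(s <- c) step_length s.

Definition chain_dist (p q : P) : R :=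
  inf [set chain_length c | c in [set c | is_chain p q c]].
End chains.

(** [a e] and [b e] are the points [I] and [O] of the cell [X e]. *)
Definition at_vertex (X : Gedge -> Type) (a b : forall e, X e)
    (p : {e & X e}) (v : Gvertex) : Prop :=
  (tagged p = a (tag p) /\ Gsrc (tag p) = v) \/
  (tagged p = b (tag p) /\ Gtgt (tag p) = v).

(** [P] is the quotient of the disjoint union of the cells by the figure-eight
    identifications. *)
Definition is_gluing (X : Gedge -> Type) (a b : forall e, X e)
    (P : Type) (j : {e & X e} -> P) : Prop :=
  (forall p, exists u, j u = p) /\
  (forall u v, j u = j v <->
    u = v \/ exists w, at_vertex a b u w /\ at_vertex a b v w).

Definition is_metric (R : realType) (T : Type) (d : T -> T -> R) : Prop :=
  [/\ forall x, d x x = 0, forall x y, d x y = 0 -> x = y,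
      forall x y, d x y = d y x & forall y x z, d x z <= d x y + d y z].

Lemma is_metric_ge0 (R : realType) (T : Type) (d : T -> T -> R) :
  is_metric d -> forall x y, 0 <= d x y.
Proof.
move=> [d0 _ dC dT] x y; have := dT y x x; rewrite d0 (dC y x); lra.
Qed.

Section chain_theory.
Context {R : realType} (X : Gedge -> Type) (d : forall e, X e -> X e -> R).
Context (P : Type) (j : {e & X e} -> P).
Hypothesis dmet : forall e, is_metric (@d e).

Local Notation chain := (is_chain j).
Local Notation len := (chain_length d).
Local Notation D := (chain_dist d j).

Lemma chain_length_ge0 c : 0 <= len c.
Proof. by apply: sumr_ge0 => s _; exact: is_metric_ge0. Qed.

Lemma chain_cat p q r c c' : chain p q c -> chain q r c' -> chain p r (c ++ c').
Proof.
elim: c p => [|s c IH] p /=; first by move=> ->.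
by move=> [sp cq] qr; split=> //; exact: IH.
Qed.

Lemma chain_length_cat c c' : len (c ++ c') = len c + len c'.
Proof. by rewrite /chain_length big_cat. Qed.

Definition step_rev (s : step X) : step X :=
  existT _ (tag s) ((tagged s).2, (tagged s).1).

Lemma chain_rev p q c : chain p q c ->
  exists2 c', chain q p c' & len c' = len c.
Proof.
elim: c p => [|s c IH] p /=; first by move=> ->; exists [::].
move=> [sp /IH[c' h' l']].
exists (c' ++ [:: step_rev s]); first exact: (chain_cat h').
rewrite chain_length_cat l' /chain_length !big_cons big_nil addr0 addrC.
by congr (_ + _); rewrite /step_length /=; have [_ _ ->] := dmet (tag s).
Qed.

Lemma chain_dist_le p q c : chain p q c -> D p q <= len c.
Proof.
move=> h; apply: ge_inf; last by exists c.
by exists 0 => _ [c' _ <-]; exact: chain_length_ge0.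
Qed.

Lemma chain_dist_cell e x y :
  D (j (existT _ e x)) (j (existT _ e y)) <= d x y.
Proof.
have := @chain_dist_le (j (existT _ e x)) (j (existT _ e y))
  [:: existT _ e (x, y)].
by rewrite /chain_length big_seq1; apply; split.
Qed.

Hypothesis conn : forall p q, exists c, chain p q c.

Lemma chain_dist_ge p q r : (forall c, chain p q c -> r <= len c) -> r <= D p q.
Proof.
move=> h; apply: lb_le_inf; last by move=> _ [c hc <-]; exact: h.
by have [c hc] := conn p q; exists (len c); exists c.
Qed.

Lemma chain_dist_ge0 p q : 0 <= D p q.
Proof. by apply: chain_dist_ge => c _; exact: chain_length_ge0. Qed.

Lemma chain_distxx p : D p p = 0.
Proof.
apply/eqP; rewrite eq_le chain_dist_ge0 andbT.
have := @chain_dist_le p p [::] erefl.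
by rewrite /chain_length big_nil.
Qed.

Lemma chain_distC p q : D p q = D q p.
Proof.
by apply/eqP; rewrite eq_le; apply/andP; split;
  apply: chain_dist_ge => c /chain_rev[c' h' <-]; exact: chain_dist_le.
Qed.

Lemma chain_dist_triangle q p r : D p r <= D p q + D q r.
Proof.
rewrite -lerBlDr; apply: chain_dist_ge => c h.
rewrite lerBlDr addrC -lerBlDr; apply: chain_dist_ge => c' h'.
by rewrite lerBlDr addrC -chain_length_cat; apply/chain_dist_le/(chain_cat h).
Qed.

(** A function on the glued space that is 1-Lipschitz on each cell is
    1-Lipschitz for the chain distance. *)
Lemma chain_dist_lip (g : {e & X e} -> R) :
  (forall u v, j u = j v -> g u = g v) ->
  (forall e (x y : X e), g (existT _ e x) - g (existT _ e y) <= d x y) ->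
  forall u v, g u - g v <= D (j u) (j v).
Proof.
move=> gj glip u v; apply: chain_dist_ge => c.
elim: c u => [|s c IH] u /=.
  by move=> /gj ->; rewrite subrr /chain_length big_nil.
move=> [/gj <- /IH]; rewrite /chain_length big_cons.
have : g (step_src s) - g (step_tgt s) <= step_length d s.
  by case: s => e [x y]; exact: glip.
by rewrite -!/(chain_length d c); lra.
Qed.

End chain_theory.

Section gluing_theory.
Context {R : realType} (X : Gedge -> Type) (d : forall e, X e -> X e -> R).
Context (a b : forall e, X e) (P : Type) (j : {e & X e} -> P).
Hypothesis dmet : forall e, is_metric (@d e).
Hypothesis jP : is_gluing a b j.

Lemma gluing_eq u v w : at_vertex a b u w -> at_vertex a b v w -> j u = j v.
Proof. by move=> uw vw; apply/jP.2; right; exists w. Qed.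

Lemma gluing_inj e (x y : X e) : j (existT _ e x) = j (existT _ e y) -> x = y.
Proof.
have H (u v : {e & X e}) : u = v -> forall h : tag u = tag v,
    eq_rect _ X (tagged u) _ h = tagged v.
  by move=> <- h; rewrite (Prop_irrelevance h erefl).
move=> /jP.2[/H/(_ erefl)//|[w []]].
by case=> -[/= -> <-] [] [/= -> //]; case: e x y.
Qed.

Lemma gluing_conn p q : exists c, is_chain j p q c.
Proof.
pose mid e := match Gsrc e with GI => b e | _ => a e end.
have midE e : at_vertex a b (existT _ e (mid e)) GM.
  by rewrite /mid; case: e; [right|right|left|left].
have [[e x] <-] := jP.1 p; have [[f y] <-] := jP.1 q.
exists [:: existT _ e (x, mid e); existT _ f (mid f, y)].
by do 2?split => //; exact: (gluing_eq (midE f) (midE e)).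
Qed.

Lemma gluing_positivity p q : chain_dist d j p q = 0 -> p = q.
Proof.
have d0 e (x : X e) : d x x = 0 by have [] := dmet e.
move=> pq0; apply: contrapT => pq.
pose far r e := forall z, j (existT _ e z) = p -> forall c,
  c = a e \/ c = b e \/ j (existT _ e c) = q -> c <> z -> r <= d z c.
have farle r r' e : r' <= r -> far r e -> far r' e.
  by move=> rr' h z zp c cP cz; apply: le_trans rr' _; exact: h.
have far1 e : exists2 r, 0 < r & far r e.
  have [[z zp]|nz] := pselect (exists z, j (existT _ e z) = p); last first.
    by exists 1 => // z zp; case: nz; exists z.
  have sep c : exists2 r, 0 < r & c <> z -> r <= d z c.
    have [->|cz] := pselect (c = z); first by exists 1.
    exists (d z c) => //; rewrite lt_neqAle is_metric_ge0// andbT.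
    apply/eqP => /esym dzc; apply: cz.
    by have [_ h _ _] := dmet e; rewrite (h _ _ dzc).
  have [ra ra0 hra] := sep (a e); have [rb rb0 hrb] := sep (b e).
  have [[y yq]|ny] := pselect (exists y, j (existT _ e y) = q).
    have [ry ry0 hry] := sep y.
    exists (Order.min ra (Order.min rb ry)); first by rewrite !lt_min ra0 rb0.
    move=> z' z'p c cP; have -> : z' = z by apply: gluing_inj; rewrite z'p.
    case: cP => [->|[->|cq]] cz; rewrite !ge_min.
    - by rewrite hra.
    - by rewrite hrb// orbT.
    - have cy : c = y by apply: gluing_inj; rewrite cq.
      by rewrite cy hry ?orbT// -cy.
  exists (Order.min ra rb); first by rewrite !lt_min ra0 rb0.
  move=> z' z'p c cP; have -> : z' = z by apply: gluing_inj; rewrite z'p.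
  case: cP => [->|[->|cq]] cz; rewrite !ge_min.
  - by rewrite hra.
  - by rewrite hrb// orbT.
  - by case: ny; exists c.
have [r r0 rfar] : exists2 r, 0 < r & forall e, far r e.
  have [r1 r10 h1] := far1 E1; have [r2 r20 h2] := far1 E2.
  have [r3 r30 h3] := far1 E3; have [r4 r40 h4] := far1 E4.
  exists (Order.min r1 (Order.min r2 (Order.min r3 r4))).
    by rewrite !lt_min r10 r20 r30 r40.
  by case; [move: h1|move: h2|move: h3|move: h4]; apply: farle;
    rewrite !ge_min lexx ?orbT.
pose g (u : {e & X e}) := match pselect (exists z, j (existT _ (tag u) z) = p)
  with left h => Order.max 0 (r - d (projT1 (cid h)) (tagged u)) | _ => 0 end.
have gE e x z : j (existT _ e z) = p ->
    g (existT _ e x) = Order.max 0 (r - d z x).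
  move=> zp; rewrite /g /=; case: pselect => [h|[]]; last by exists z.
  case: (cid h) => z' /= z'p.
  by have -> : z' = z by apply: gluing_inj; rewrite z'p.
have gp u : j u = p -> g u = r.
  case: u => e x xp; rewrite (gE _ _ _ xp) d0 subr0.
  by apply/max_idPr; exact: ltW.
have g0 e c : c = a e \/ c = b e \/ j (existT _ e c) = q ->
    j (existT _ e c) <> p -> g (existT _ e c) = 0.
  move=> cP cp; have [[z zp]|nz] := pselect (exists z, j (existT _ e z) = p).
    rewrite (gE _ _ _ zp); apply/max_idPl; rewrite subr_le0.
    by apply: rfar => // cz; apply: cp; rewrite cz.
  by rewrite /g /=; case: pselect.
have gj u v : j u = j v -> g u = g v.
  move=> uv; have /jP.2[->//|[w [uw vw]]] := uv.
  have [up|up] := pselect (j u = p); first by rewrite !gp// -uv.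
  have vp : j v <> p by rewrite -uv.
  case: u v uw vw up vp {uv} => [e x] [f y] uw vw up vp.
  by rewrite !g0//; [case: vw => -[/= -> _]|case: uw => -[/= -> _]]; tauto.
have glip e (x y : X e) : g (existT _ e x) - g (existT _ e y) <= d x y.
  have dge0 := is_metric_ge0 (dmet e); have [_ _ dC dT] := dmet e.
  have [[z zp]|nz] := pselect (exists z, j (existT _ e z) = p); last first.
    by rewrite /g /=; case: pselect => // _; rewrite subrr.
  rewrite !(gE _ _ _ zp); have h1 := dT x z y; have h2 := dge0 x y.
  by rewrite /Order.max; case: ifPn; case: ifPn; rewrite -?leNgt; lra.
have [u up] := jP.1 p; have [v vq] := jP.1 q.
have := chain_dist_lip gluing_conn gj glip u v.
rewrite up vq pq0 gp//; case: v vq => e y vq.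
rewrite g0; [lra|tauto|by rewrite vq => /esym].
Qed.

Lemma chain_dist_metric : is_metric (chain_dist d j).
Proof.
split.
- exact: (chain_distxx dmet gluing_conn).
- exact: gluing_positivity.
- exact: (chain_distC dmet gluing_conn).
- exact: (chain_dist_triangle dmet gluing_conn).
Qed.

End gluing_theory.

(** Chain distances between points of subspaces that contain the points [I]
    and [O] do not depend on whether the chains are taken in the subspaces or
    in the ambient spaces. *)
Section chain_dist_sub.
Context {R : realType} (X0 X : Gedge -> Type).
Context (d0 : forall e, X0 e -> X0 e -> R) (d : forall e, X e -> X e -> R).
Context (i : forall e, X0 e -> X e).
Context (a b : forall e, X0 e).
Context (P0 P : Type) (j0 : {e & X0 e} -> P0) (j : {e & X e} -> P).
Hypothesis d0met : forall e, is_metric (@d0 e).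
Hypothesis dmet : forall e, is_metric (@d e).
Hypothesis isom : forall e (x y : X0 e), d (i x) (i y) = d0 x y.
Hypothesis j0P : is_gluing a b j0.
Hypothesis jP : is_gluing (fun e => i (a e)) (fun e => i (b e)) j.

Let im (u : {e & X0 e}) : {e & X e} := existT _ (tag u) (i (tagged u)).

Let i_inj e : injective (@i e).
Proof.
move=> x y xy; have [+ h _ _] := d0met e; move=> h0.
by apply: h; rewrite -isom xy isom.
Qed.

Let at_im u w : at_vertex (fun e => i (a e)) (fun e => i (b e)) (im u) w <->
  at_vertex a b u w.
Proof.
rewrite /at_vertex /im /=; split.
  by move=> [[/i_inj -> ->]|[/i_inj -> ->]]; [left|right].
by move=> [[-> ->]|[-> ->]]; [left|right].
Qed.

Let im_eq u v : j0 u = j0 v -> j (im u) = j (im v).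
Proof.
move=> /j0P.2[->//|[w [uw vw]]]; apply/jP.2; right; exists w.
by rewrite !at_im.
Qed.

Lemma chain_dist_sub u v :
  chain_dist d j (j (im u)) (j (im v)) = chain_dist d0 j0 (j0 u) (j0 v).
Proof.
have conn0 := gluing_conn j0P; have conn := gluing_conn jP.
apply/eqP; rewrite eq_le; apply/andP; split.
  apply: (chain_dist_ge conn0) => c.
  elim: c u => [|s c IH] u /=.
    move=> /im_eq ->; rewrite (chain_distxx dmet conn).
    by rewrite /chain_length big_nil.
  move=> [/im_eq <- /IH h]; rewrite /chain_length big_cons.
  apply: le_trans (chain_dist_triangle dmet conn (j (im (step_tgt s))) _ _) _.
  apply: lerD h; apply: le_trans (chain_dist_cell j dmet _ _) _.
  by rewrite isom.
pose p := j0 u; pose D := chain_dist d0 j0.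
pose S (w : {e & X e}) : set R :=
  [set D p (j0 (existT _ (tag w) z)) + d (i z) (tagged w) | z in setT].
have S_lb w : has_lbound (S w).
  exists 0 => _ [z _ <-]; apply: addr_ge0; last exact: is_metric_ge0.
  exact: (chain_dist_ge0 d0met conn0).
have S0 w : S w !=set0.
  by exists (D p (j0 (existT _ (tag w) (a (tag w)))) + d (i (a (tag w))) (tagged w)), (a (tag w)).
pose g w := - inf (S w).
have gim w : g (im w) = - D p (j0 w).
  congr (- _); apply/eqP; rewrite eq_le; apply/andP; split.
    apply: ge_inf => //; exists (tagged w) => //=.
    have [-> _ _ _] := dmet (tag w); rewrite addr0; congr (D p (j0 _)).
    by case: w.
  apply: lb_le_inf => // _ [z _ <-] /=; rewrite isom.
  apply: le_trans (chain_dist_triangle d0met conn0 (j0 (existT _ (tag w) z)) _ _) _.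
  rewrite lerD2l; case: w z => e w z /=.
  exact: (chain_dist_cell j0 d0met).
have gj w w' : j w = j w' -> g w = g w'.
  have h r s : at_vertex (fun e => i (a e)) (fun e => i (b e)) r s ->
      exists2 r0, r = im r0 & at_vertex a b r0 s.
    case: r => e r [[/= -> es]|[/= -> es]].
    - by exists (existT _ e (a e)) => //; left.
    - by exists (existT _ e (b e)) => //; right.
  move=> /jP.2[->//|[t [/h[r -> rt] /h[r' -> r't]]]].
  by rewrite !gim (gluing_eq j0P rt r't).
have glip e (x y : X e) : g (existT _ e x) - g (existT _ e y) <= d x y.
  suff h : inf (S (existT _ e y)) - d x y <= inf (S (existT _ e x)).
    by rewrite /g; lra.
  apply: lb_le_inf => // _ [z _ <-] /=; rewrite lerBlDr -addrA.
  apply: le_trans (lerD (lexx _) _); last first.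
    by have [_ _ _ dT] := dmet e; exact: (dT x).
  by apply: ge_inf => //; exists z.
have := chain_dist_lip conn gj glip (im u) (im v).
have Dpp : D p p = 0 by exact: (chain_distxx d0met conn0).
by rewrite !gim -/p Dpp oppr0 sub0r opprK.
Qed.
End chain_dist_sub.

Lemma copy_gluing :
  is_gluing (fun=> VIn) (fun=> VOut)
    (fun u : {e : Gedge & Vinf} => copy (tag u) (tagged u)).
Proof.
split.
  case=> [||[|e w]].
  - by exists (existT _ E1 VIn).
  - by exists (existT _ E4 VOut).
  - by exists (existT _ E1 VOut).
  - by exists (existT _ e (VMid w)).
move=> [e x] [f y]; rewrite /at_vertex /=; split.
  case: x => [||w]; case: y => [||w'] /=.
  all: try by case: e; case: f => //= _; right; eexists; split;
    (by left) || (by right).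
  all: try by case: e.
  all: try by case: f.
  by case=> -> ->; left.
case=> [[-> H]|[w [[[-> <-]|[-> <-]] [[-> H]|[-> H]]]]] /=.
- by rewrite (_ : x = y)//.
- by rewrite H.
- by rewrite H.
- by rewrite H.
- by rewrite H.
Qed.

Definition complete_space (T : uniformType) : Prop :=
  forall F : set_system T, ProperFilter F -> cauchy F ->
    exists x : T, F --> x.

(** The restrictions to [Vinf] of the distances of the complete metric spaces
    that contain [Vinf] as a dense subset. *)
Definition complete_Vinf_metrics (R : realType) : set {ptws Vinf * Vinf -> R} :=
  [set d | exists (X : metricType R) (i : Vinf -> X),
    [/\ injective i, dense (range i), complete_space X &
        forall x y, d (x, y) = mdist (i x) (i y)]].

Section completion.
Context (R : realType) (d : Vinf -> Vinf -> R).
Hypothesis dmet : is_metric d.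

Definition completion : Type :=
  {f : Vinf -> R | forall e, 0 < e -> exists v, forall w, `|f w - d v w| <= e}.
HB.instance Definition _ := gen_eqMixin completion.
HB.instance Definition _ := gen_choiceMixin completion.

Let cE (f : completion) e : 0 < e ->
  exists v, forall w, `|sval f w - d v w| <= e.
Proof. by case: f => f h; exact: h. Qed.

Definition completion_dist (f g : completion) : R :=
  sup [set `|sval f w - sval g w| | w in setT].
Local Notation D := completion_dist.

Let dle x y w : `|d x w - d y w| <= d x y.
Proof.
have [_ _ dC dT] := dmet; rewrite ler_norml; apply/andP; split.
  by have := dT x y w; rewrite (dC y x); lra.
by have := dT y x w; lra.
Qed.

Let le_D (f g : completion) w : `|sval f w - sval g w| <= D f g.
Proof.
apply: ub_le_sup; last by exists w.
have [x fx] := cE f ltr01; have [y gy] := cE g ltr01.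
exists (1 + d x y + 1) => _ [t _ <-].
have := ler_distD (d x t) (sval f t) (sval g t).
have := ler_distD (d y t) (d x t) (sval g t).
have := fx t; have := gy t; have := dle x y t.
by rewrite (distrC (d y t)); lra.
Qed.

Let D_le (f g : completion) c :
  (forall w, `|sval f w - sval g w| <= c) -> D f g <= c.
Proof.
move=> h; apply: ge_sup; first by exists `|sval f VIn - sval g VIn|, VIn.
by move=> _ [w _ <-].
Qed.

Let Dxx f : D f f = 0.
Proof.
apply/eqP; rewrite eq_le; apply/andP; split.
  by apply: D_le => w; rewrite subrr normr0.
by apply: le_trans (le_D f f VIn).
Qed.

Let D0 f g : D f g = 0 -> f = g.
Proof.
move=> fg; have h w : sval f w = sval g w.
  by apply/eqP; rewrite -subr_eq0 -normr_le0; apply: le_trans (le_D f g w) _; rewrite fg.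
case: f g h {fg} => [f hf] [g hg] /= h; apply: eq_exist; exact/funext.
Qed.

Let DC f g : D f g = D g f.
Proof.
by apply/eqP; rewrite eq_le; apply/andP; split; apply: D_le => w;
  rewrite distrC le_D.
Qed.

Let DT g f h : D f h <= D f g + D g h.
Proof.
apply: D_le => w; rewrite -(subrKA (sval g w)).
by apply: le_trans (ler_normD _ _) _; rewrite lerD// le_D.
Qed.

HB.instance Definition _ := isMetric.Build R completion Dxx D0 DC DT.

Let emb (v : Vinf) : completion.
Proof.
exists (d v) => e e0; exists v => w.
by rewrite subrr normr0 ltW.
Defined.

Let emb_dist x y : d x y = D (emb x) (emb y).
Proof.
apply/eqP; rewrite eq_le; apply/andP; split; last by apply: D_le => w /=.
have := le_D (emb x) (emb y) y; have [d0 _ _ _] := dmet.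
by rewrite /= d0 subr0; apply: le_trans; exact: ler_norm.
Qed.

Let emb_near f e : 0 < e -> exists v, D f (emb v) <= e.
Proof. by move=> /(cE f)[v h]; exists v; apply: D_le. Qed.

Let completion_complete : complete_space completion.
Proof.
move=> F FF cF.
have cFe e : 0 < e -> exists g : completion, F [set h | D g h < e].
  by move=> e0; have /cauchyP/(_ e e0)[g] := cF; rewrite ballEmdist; exists g.
have cvgw w : cvg ((fun h : completion => sval h w) @ F).
  apply/cauchy_cvgP/cauchyP => e /cFe[g Fg]; exists (sval g w).
  apply: (@filterS _ F _ [set h | D g h < e]) Fg => h /= gh.
  by rewrite /ball /=; apply: le_lt_trans gh; exact: le_D.
pose f w := lim ((fun h : completion => sval h w) @ F).
have fg e (g : completion) : F [set h | D g h < e] ->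
    forall w, `|f w - sval g w| <= e.
  move=> Fg w; apply/ler_addgt0Pl => t t0.
  have /cvgrPdist_lt/(_ t t0) := cvgw w => Ft.
  have [h [/= h1 h2]] := filter_ex (filterI Ft Fg).
  have := ler_distD (sval h w) (f w) (sval g w).
  have := le_D g h w; rewrite (distrC (sval h w)) -/(f w) in h1 *; lra.
have fP e : 0 < e -> exists v, forall w, `|f w - d v w| <= e.
  move=> e0; have e2 : 0 < e / 2 by lra.
  have [g /fg h1] := cFe _ e2; have [v h2] := cE g e2; exists v => w.
  have := ler_distD (sval g w) (f w) (d v w).
  by have := h1 w; have := h2 w; lra.
exists (exist _ f fP) => U /nbhs_ballP[e /= e0]; rewrite ballEmdist => eU.
have e4 : 0 < e / 4 by lra.
have [g Fg] := cFe _ e4; apply: (@filterS _ F _ [set h | D g h < e / 4]) (Fg) => h /= gh.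
apply: eU => /=; apply: (@le_lt_trans _ _ (e / 4 + e / 4)); last by lra.
apply: le_trans (DT g _ _) _; rewrite lerD ?(ltW gh)//.
by apply: D_le => w; exact: fg.
Qed.

Lemma is_metric_complete_Vinf :
  complete_Vinf_metrics (fun p => d p.1 p.2).
Proof.
exists completion, emb; split => //.
- move=> x y xy; have [_ h _ _] := dmet; apply: h.
  by rewrite emb_dist xy Dxx.
- move=> O [f Of] oO.
  have : nbhs f O by apply: open_nbhs_nbhs.
  move=> /nbhs_ballP[e /= e0]; rewrite ballEmdist => eO.
  have [v fv] := emb_near f (divr_gt0 e0 (ltr0Sn R 1)).
  exists (emb v); split; last by exists v.
  apply: eO => /=; apply: le_lt_trans fv _.
  by rewrite ltr_pdivrMr// ltr_pMr// ltr1n.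
Qed.
End completion.

Lemma complete_Vinf_metrics_is_metric (R : realType)
    (d : {ptws Vinf * Vinf -> R}) :
  complete_Vinf_metrics d -> is_metric (fun x y => d (x, y)).
Proof.
move=> [X [i [iinj _ _ dE]]]; split=> [x|x y|x y|y x z].
- by rewrite dE mdistxx.
- by rewrite dE => /mdist_positivity/iinj.
- by rewrite !dE metric_sym.
- by rewrite !dE metric_triangle.
Qed.

(** [M], with the topology of pointwise convergence on [Vinf * Vinf]. *)
Definition Mspace (R : realType) : Type := set_type (@complete_Vinf_metrics R).
HB.instance Definition _ (R : realType) := Topological.on (Mspace R).

Definition Mdist (R : realType) (d : Mspace R) (x y : Vinf) : R := \val d (x, y).

Lemma Mdist_metric (R : realType) (d : Mspace R) : is_metric (Mdist d).
Proof. by apply: complete_Vinf_metrics_is_metric; exact: set_valP. Qed.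

Definition Mspace_of (R : realType) (d : Vinf -> Vinf -> R)
    (dmet : is_metric d) : Mspace R :=
  SigSub (mem_set (is_metric_complete_Vinf dmet)).

Lemma discrete_is_metric (R : realType) :
  is_metric (fun x y : Vinf => (~~ `[< x = y >])%:R : R).
Proof.
split=> [x|x y|x y|y x z].
- by rewrite (asboolT (erefl x)).
- by case: asboolP => //= _ /eqP; rewrite oner_eq0.
- by congr (~~ _)%:R; apply: asbool_equiv_eq; split=> ->.
- case: (asboolP (x = z)) => [_|xz]; first by rewrite addr_ge0.
  case: (asboolP (x = y)) => [xy|_] /=; last by rewrite lerDl.
  by case: asboolP => [yz|_] /=; [case: xz; rewrite xy|rewrite add0r].
Qed.

HB.instance Definition _ (R : realType) :=
  isPointed.Build (Mspace R) (Mspace_of (discrete_is_metric R)).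

Definition Rpos (R : realType) : Type := set_type (`]0, +oo[%classic : set R).
HB.instance Definition _ (R : realType) := Topological.on (Rpos R).

Lemma Rpos_gt0 (R : realType) (x : Rpos R) : 0 < \val x.
Proof. by have /= := set_valP x; rewrite in_itv /= andbT. Qed.

Lemma itv_oy1 (R : realType) : (1 : R) \in (`]0, +oo[%classic : set R).
Proof. by apply/mem_set; rewrite /= in_itv /= ltr01. Qed.
HB.instance Definition _ (R : realType) :=
  isPointed.Build (Rpos R) (SigSub (itv_oy1 R)).

Definition borel (T : ptopologicalType) : Type :=
  g_sigma_algebraType (@open T).
HB.instance Definition _ (T : ptopologicalType) :=
  Measurable.copy (borel T) (g_sigma_algebraType (@open T)).

Section operators.
Context {R : realType}.
Local Notation M := (borel (Mspace R)).

Definition cells (d : M * M * M * M) (e : Gedge) : Vinf -> Vinf -> R :=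
  match e with
  | E1 => Mdist d.1.1.1 | E2 => Mdist d.1.1.2
  | E3 => Mdist d.1.2   | E4 => Mdist d.2
  end.

Definition glued_dist (lambda : Rpos R)
    (p : M * M * M * M * borel (Rpos R)) (x y : Vinf) : R :=
  \val lambda * \val p.2 *
  chain_dist (cells p.1)
    (fun u : {e : Gedge & Vinf} => copy (tag u) (tagged u)) x y.

Lemma glued_dist_is_metric lambda p : is_metric (glued_dist lambda p).
Proof.
have c0 : 0 < \val lambda * \val p.2 by rewrite mulr_gt0// Rpos_gt0.
have cm e : is_metric (cells p.1 e) by case: e; exact: Mdist_metric.
have [d0 dp dC dT] := chain_dist_metric cm copy_gluing.
rewrite /glued_dist; split=> [x|x y|x y|y x z].
- by rewrite d0 mulr0.
- by move/eqP; rewrite mulf_eq0 gt_eqF//= => /eqP/dp.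
- by rewrite dC.
- by rewrite -mulrDr ler_pM2l.
Qed.

Definition Rglue (lambda : Rpos R) (p : M * M * M * M * borel (Rpos R)) : M :=
  Mspace_of (glued_dist_is_metric lambda p).

(** [Rglue] is computed with chains in [Vinf]; it agrees with the distance of
    the space glued from the complete spaces themselves. *)
Lemma Rglue_complete lambda p (X : Gedge -> metricType R)
    (i : forall e, Vinf -> X e) (P : Type) (j : {e & X e} -> P) :
  (forall e x y, mdist (i e x) (i e y) = cells p.1 e x y) ->
  is_gluing (fun e => i e VIn) (fun e => i e VOut) j ->
  forall e f x y,
    Mdist (Rglue lambda p) (copy e x) (copy f y) =
    \val lambda * \val p.2 *
    chain_dist (fun e => @mdist R (X e)) j
      (j (existT _ e (i e x))) (j (existT _ f (i f y))).
Proof.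
move=> isom jP e f x y; congr (_ * _).
have cm e' : is_metric (cells p.1 e') by case: e'; exact: Mdist_metric.
have Xm e' : is_metric (@mdist R (X e')).
  split; [exact: mdistxx|exact: mdist_positivity|exact: metric_sym|].
  by move=> *; exact: metric_triangle.
by have := chain_dist_sub cm Xm isom copy_gluing jP (existT _ e x) (existT _ f y).
Qed.

Definition Phi (m : probability (borel (Rpos R)) R) (lambda : Rpos R)
    (P : probability M R) : set M -> \bar R :=
  pushforward (P \x P \x P \x P \x m)%E (Rglue lambda).

Definition stationary (m : probability (borel (Rpos R)) R) (lambda : Rpos R)
    (P : probability M R) : Prop :=
  forall A : set M, measurable A -> Phi m lambda P A = P A.
End operators.

Definition nonatomic d (T : measurableType d) (R : realType)
    (mu : set T -> \bar R) : Prop :=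
  forall A, measurable A -> (0 < mu A)%E ->
    exists B, [/\ measurable B, B `<=` A, (0 < mu B)%E & (mu B < mu A)%E].

Definition fully_supported (T : ptopologicalType) (R : realType)
    (mu : set (borel T) -> \bar R) : Prop :=
  forall U : set T, open U -> U !=set0 -> (0 < mu U)%E.

(** Inner regularity, which is the Radon property for finite Borel measures on
    a Hausdorff space. *)
Definition radon (T : ptopologicalType) (R : realType)
    (mu : set (borel T) -> \bar R) : Prop :=
  forall A : set (borel T), measurable A ->
    mu A = ereal_sup [set mu K | K in [set K : set T | compact K /\ K `<=` A]].

(* Main.v *)
Require Import Defs.
From HB Require Import structures.
From mathcomp Require Import all_boot all_order all_algebra.
From mathcomp Require Import all_classical all_reals all_analysis.
From mathcomp Require Import measurable_realfun ring lra.

Set Implicit Arguments.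
Unset Strict Implicit.
Unset Printing Implicit Defensive.

Import Order.TTheory GRing.Theory Num.Theory.
Import numFieldNormedType.Exports.

Local Open Scope classical_set_scope.
Local Open Scope ring_scope.

(** Why the theorem is true. In a stationary random metric let [X] be the
    distance between the two ends [I] and [O]. By [chain_dist_ends] it solves,
    in law, the equation

      [X = lambda * xi * (min X1 X2 + min X3 X4)]

    with independent copies [X1], ..., [X4] of [X] and an independent [xi]. The
    proof solves this one-dimensional equation at a suitable [lambda], and then
    rebuilds the whole metric from the solution.

    The equation. A law on [[0, +oo]] is encoded by its tail [x |-> P (X > x)],
    and [glue_op] is the map that the right-hand side induces on tails. If the
    four variables are infinite with probability [p] and vanish otherwise, the
    result is infinite with probability [gmap p = 1 - (1 - p ^+ 2) ^+ 2], whose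
    fixed points are [0], [1] and a repelling one, the root [t] of
    [t ^+ 2 + t = 1]. In a window [[al, be[], with the tail forced to be [1] on
    the left and [0] on the right, the Knaster-Tarski theorem gives a largest
    stationary tail ([window_exists]). It collapses to the left end for a small
    [lambda] ([window_collapse]) and fills the window for a large one
    ([window_fill]); hence every window carries two stationary tails, at almost
    the same scale, on the two sides of the transition ([transition]). Let the
    windows grow to [[0, +oo[]. Limits of stationary tails exist and are
    stationary ([stationary_limit]), but they might be degenerate.

    The main point is that a tail cannot linger near the mass [t] over an
    unbounded range of scales ([front_width]). Otherwise, seen from the
    beginning and from the end of that range, one obtains at the same [lambda]
    a stationary front from [1] to [t] and one from [t] to [0]. Let [W] be the
    product of two independent copies of [lambda * xi]. As [t] repels at a rate
    larger than [29 / 20], the first front forces [P (W >= 1) <= (20 / 29) ^+ 2]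
    ([upper_front]) and the second one the same bound for [P (W <= 1)]
    ([lower_front]). Both numbers are smaller than [1 / 2], a contradiction
    ([no_two_drifts]). Now either the front of one of the two tails stays away
    from the ends of its windows, and its limit is a solution, or the two fronts
    stick to opposite ends; in that case the limits, taken in the frames of
    these ends, are a super-solution above a sub-solution on the whole line, and
    Knaster-Tarski gives a solution between them ([stationary_law_exists]).

    The metric. The distances between vertices of level [k.+1] of a glued space
    depend only on the distances of level [k] in the four cells
    ([chain_dist_local]); so the operator maps laws that agree on level [k] to
    laws that agree on level [k.+1] ([agree_step]). Start from the equidistant
    metric of size [X]: the equation says that its law agrees with its image on
    level [0], hence the iterates of the operator stabilize on each level
    ([approx_consistent]). A random metric with these prescribed levels is built
    on the unit interval by encoding a metric by countably many bits
    ([rmetric_law]); its law and the image of this law agree on all levels and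
    so coincide ([limit_law_stationary]). Being an image of Lebesgue measure, it
    is Radon by Lusin's theorem ([radon_push]). It is nonatomic because [xi]
    has no atoms, which leaves no atom to the distance between the ends
    ([stationary_end_dist_diffuse], [nonatomic_of_diffuse]). *)

(** * Probabilities as real numbers *)

Section real_probability.
Context d (T : measurableType d) (R : realType) (P : probability T R).
Implicit Types A B : set T.

Definition pr A : R := fine (P A).

Lemma prE A : measurable A -> P A = (pr A)%:E.
Proof.
move=> mA; rewrite /pr fineK// ge0_fin_numE//.
by apply: le_lt_trans (probability_le1 P mA) _; rewrite ltry.
Qed.

Lemma pr_ge0 A : 0 <= pr A.
Proof. exact: fine_ge0. Qed.

Lemma pr_le1 A : measurable A -> pr A <= 1.
Proof. by move=> mA; rewrite -lee_fin -prE// probability_le1. Qed.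

Lemma pr_setT : pr [set: T] = 1.
Proof. by rewrite /pr probability_setT. Qed.

Lemma pr_set0 : pr set0 = 0.
Proof. by rewrite /pr measure0. Qed.

Lemma pr_le A B : measurable A -> measurable B -> A `<=` B -> pr A <= pr B.
Proof.
by move=> mA mB AB; rewrite -lee_fin -!prE// le_measure// inE.
Qed.

Lemma pr_setC A : measurable A -> pr (~` A) = 1 - pr A.
Proof.
move=> mA; apply: EFin_inj; rewrite -prE; last exact: measurableC.
by rewrite probability_setC// prE// EFinB.
Qed.

Lemma pr_setU A B : measurable A -> measurable B -> pr (A `|` B) <= pr A + pr B.
Proof.
move=> mA mB; rewrite -lee_fin EFinD -!prE//; last exact: measurableU.
exact: measureU2.
Qed.

Lemma pr_setU_disj A B : measurable A -> measurable B -> A `&` B = set0 ->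
  pr (A `|` B) = pr A + pr B.
Proof.
move=> mA mB AB; apply: EFin_inj; rewrite EFinD -!prE//; last exact: measurableU.
by rewrite measureU.
Qed.

Lemma pr_cvg_bigcup (F : (set T)^nat) : (forall n, measurable (F n)) ->
  {homo F : m n / (m <= n)%N >-> m `<=` n} ->
  pr (F n) @[n --> \oo] --> pr (\bigcup_n F n).
Proof.
move=> mF ndF; apply: fine_cvg; rewrite -prE; last exact: bigcupT_measurable.
apply: nondecreasing_cvg_mu => //; first exact: bigcupT_measurable.
by move=> m n mn; apply/subsetPset/ndF.
Qed.

(** [A] is the increasing union of the sets of those of its points that lie in
    all the [F n] from some index on. *)
Lemma pr_fatou A (F : (set T)^nat) e : measurable A ->
  (forall n, measurable (F n)) ->
  (forall x, A x -> \forall n \near \oo, F n x) -> 0 < e ->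
  \forall n \near \oo, pr A - e < pr (F n).
Proof.
move=> mA mF AF e0.
pose G n := A `&` \bigcap_(k in [set k | (n <= k)%N]) F k.
have mG n : measurable (G n).
  by apply: measurableI => //; apply: bigcap_measurableType.
have GA : \bigcup_n G n = A.
  apply/seteqP; split=> [x [n _ []]//|x Ax].
  have [n _ nF] := AF x Ax; exists n => //; split=> // k; exact: nF.
have ndG : {homo G : m n / (m <= n)%N >-> m `<=` n}.
  move=> m n mn x [Ax h]; split=> // k /= nk; apply: h => /=.
  exact: leq_trans nk.
have := pr_cvg_bigcup mG ndG; rewrite GA => /cvgrPdist_lt/(_ e e0).
apply: filterS => n h.
have : pr (G n) <= pr (F n) by apply: pr_le => // x [_]; apply => /=.
by have := ler_norm (pr A - pr (G n)); lra.
Qed.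

End real_probability.

Section measurability_tools.
Context d (T : measurableType d) (R : realType).

Lemma measurable_set_lt (f g : T -> R) : measurable_fun setT f ->
  measurable_fun setT g -> measurable [set x | f x < g x].
Proof.
move=> mf mg.
have := measurable_fun_ltr mf mg measurableT (Y := [set true]) I.
by rewrite setTI.
Qed.

Lemma measurable_set_le (f g : T -> R) : measurable_fun setT f ->
  measurable_fun setT g -> measurable [set x | f x <= g x].
Proof.
move=> mf mg.
have -> : [set x | f x <= g x] = ~` [set x | g x < f x].
  by apply/seteqP; split=> x /=; rewrite leNgt => /negP.
exact/measurableC/measurable_set_lt.
Qed.

Lemma measurable_fun_gt (f : T -> R) :
  (forall c, measurable [set x | c < f x]) -> measurable_fun setT f.
Proof.
move=> mf _; apply: (measurability _ (RGenOInfty.measurableE R)) => //.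
move=> _ [_ [c ->] <-]; rewrite setTI.
rewrite (_ : _ @^-1` _ = [set x | c < f x]) //.
by apply/seteqP; split=> x /=; rewrite in_itv/= andbT.
Qed.

Lemma measurable_invf (f : T -> R) : (forall x, 0 < f x) ->
  measurable_fun setT f -> measurable_fun setT (fun x => (f x)^-1).
Proof.
move=> f0 mf; apply: measurable_fun_gt => c.
have -> : [set x | c < (f x)^-1] = [set x | c * f x < 1].
  by apply/seteqP; split=> x /=; rewrite -[_^-1]mul1r ltr_pdivlMr.
by apply: measurable_set_lt => //; exact: measurable_funM.
Qed.

Lemma measurable_ex_countable (I : countType) (F : I -> set T) :
  (forall i, measurable (F i)) -> measurable [set x | exists i, F i x].
Proof.
move=> mF.
have -> : [set x | exists i, F i x] = \bigcup_i F i.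
  by apply/seteqP; split=> x [i]; [exists i|exists i].
by apply: countable_bigcupT_measurable => //; exact: countableP.
Qed.

End measurability_tools.

Section uniform.
Context {R : realType}.

(** A head constant that carries the uniform law on [`[0, 1]] as a
    probability. *)
Definition unif (A : set R) : \bar R := uniform_prob (@ltr01 R) A.
Local Notation U := unif.

Let unif0 : U set0 = 0%E.
Proof. exact: measure0 (uniform_prob (@ltr01 R)). Qed.

Let unif_ge0 A : (0 <= U A)%E.
Proof. exact: measure_ge0 (uniform_prob (@ltr01 R)) A. Qed.

Let unif_sigma_additive : semi_sigma_additive U.
Proof.
exact: (@measure_semi_sigma_additive _ _ _ (uniform_prob (@ltr01 R))).
Qed.

Let unif_setT : U setT = 1%E.
Proof. exact: (@probability_setT _ _ _ (uniform_prob (@ltr01 R))). Qed.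

HB.instance Definition _ :=
  isMeasure.Build default_measure_display R R U unif0 unif_ge0 unif_sigma_additive.
HB.instance Definition _ :=
  Measure_isProbability.Build default_measure_display R R U unif_setT.

Lemma unifE (A : set R) : measurable A ->
  U A = lebesgue_measure (A `&` `[0, 1]).
Proof.
move=> mA; rewrite /unif /= /uniform_prob integral_uniform_pdf.
rewrite (eq_integral (fun=> 1%:E)); last first.
  move=> x; rewrite inE/= => -[_]; rewrite in_itv/= /uniform_pdf => ->.
  by rewrite subr0 invr1.
by rewrite integral_cst ?mul1e//; apply: measurableI.
Qed.

Lemma pr_unifE (A : set R) : measurable A ->
  pr U A = fine (lebesgue_measure (A `&` `[0, 1])).
Proof. by move=> mA; exact: (congr1 fine (unifE mA)). Qed.

Lemma pr_unif_lt c : 0 <= c <= 1 -> pr U [set u | u < c] = c.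
Proof.
move=> /andP[c0 c1].
have mc : measurable [set u : R | u < c] by apply: measurable_set_lt.
rewrite pr_unifE//.
have -> : [set u | u < c] `&` `[0, 1] = `[0, c[%classic.
  apply/seteqP; split=> x /=; rewrite !in_itv/=; first by move=> [-> /andP[->]].
  by move=> /andP[-> xc]; rewrite xc; split=> //; lra.
rewrite lebesgue_measure_itv/= lte_fin; case: ltgtP c0 => //= _ _.
by rewrite oppr0 addr0.
Qed.

Lemma pr_unif_ge c : 0 <= c <= 1 -> pr U [set u | c <= u] = 1 - c.
Proof.
move=> c01; have mc : measurable [set u : R | u < c] by apply: measurable_set_lt.
rewrite -[X in 1 - X](pr_unif_lt c01) -pr_setC//; congr (pr _ _).
by apply/seteqP; split=> x /=; rewrite leNgt => /negP.
Qed.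

Lemma pr_unif_countable (A : set R) : countable A -> measurable A -> pr U A = 0.
Proof.
move=> cA mA; rewrite pr_unifE// countable_lebesgue_measure0//.
by apply: sub_countable cA; apply: subset_card_le; exact: subIsetl.
Qed.

End uniform.

Lemma pr_prod d1 d2 (T1 : measurableType d1) (T2 : measurableType d2)
    (R : realType) (P : probability T1 R) (Q : probability T2 R) A B :
  measurable A -> measurable B -> pr (P \x Q)%E (A `*` B) = pr P A * pr Q B.
Proof.
move=> mA mB; apply: EFin_inj.
rewrite EFinM -(prE P mA) -(prE Q mB) -prE; last exact: measurableX.
exact: product_measure1E.
Qed.

Lemma ratr_between (R : realType) (x y : R) : x < y ->
  exists q : rat, x < ratr q < y.
Proof. by move=> /rat_in_itvoo[q]; rewrite in_itv; exists q. Qed.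

(** * The equation for the distance between the ends *)

(** Tails [x |-> P (X > x)] of random variables in [[0, +oo]]. Masses at [0] and
    at infinity are allowed, since they appear in limits. *)
Definition survival (R : realType) (H : R -> R) : Prop :=
  [/\ forall x y, x <= y -> H y <= H x, forall x, 0 <= H x,
      forall x, H x <= 1 & forall x, x < 0 -> H x = 1].

(** For a nonincreasing function this is right continuity. *)
Definition rcont (R : realType) (H : R -> R) : Prop :=
  forall x c, c < H x -> exists2 y, x < y & c < H y.

(** The probability that a series of two pairs of parallel edges is infinite,
    when the edges are independent and infinite with probability [p]. *)
Definition gmap (R : realType) (p : R) : R := 1 - (1 - p ^+ 2) ^+ 2.

Lemma sqr_mono (R : realType) (a b : R) : 0 <= a -> a <= b -> a ^+ 2 <= b ^+ 2.
Proof. by move=> a0 ab; rewrite lerXn2r// nnegrE (le_trans a0). Qed.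

Section gmap_theory.
Context {R : realType}.
Implicit Types p q : R.

Lemma gmap_ge0 p : 0 <= p <= 1 -> 0 <= gmap p.
Proof.
move=> /andP[p0 p1]; rewrite /gmap.
have -> : 1 - (1 - p ^+ 2) ^+ 2 = p ^+ 2 * (1 + (1 - p) * (1 + p)) by ring.
by rewrite mulr_ge0 ?sqr_ge0//; nra.
Qed.

Lemma gmap_le p q : 0 <= p -> p <= q -> q <= 1 -> gmap p <= gmap q.
Proof.
move=> p0 pq q1; rewrite /gmap lerD2l lerN2.
have h1 : p ^+ 2 <= q ^+ 2 by rewrite lerXn2r ?nnegrE// (le_trans p0).
have h2 : q ^+ 2 <= 1 by rewrite exprn_ile1// (le_trans p0).
by rewrite lerXn2r ?nnegrE; lra.
Qed.

Lemma gmap_lip p q : 0 <= p -> p <= q -> q <= 1 -> gmap q <= gmap p + 4 * (q - p).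
Proof.
move=> p0 pq q1; rewrite /gmap.
have -> : 1 - (1 - q ^+ 2) ^+ 2 =
  1 - (1 - p ^+ 2) ^+ 2 + (q - p) * ((q + p) * (2 - p ^+ 2 - q ^+ 2)) by ring.
have h : (q + p) * (2 - p ^+ 2 - q ^+ 2) <= 4 by nra.
by nra.
Qed.

Lemma gmap_fix p : gmap p = p -> [\/ p = 0, p = 1 | p ^+ 2 + p = 1].
Proof.
move=> pE.
have : p * ((p - 1) * (p ^+ 2 + p - 1)) = 0.
  have -> : p * ((p - 1) * (p ^+ 2 + p - 1)) = p - gmap p by rewrite /gmap; ring.
  by rewrite pE subrr.
move=> /eqP; rewrite !mulf_eq0 !subr_eq0 => /or3P[]/eqP h.
- by constructor 1.
- by constructor 2.
- by constructor 3.
Qed.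

End gmap_theory.

Section gluing_operator.
Context {R : realType} d (S : measurableType d) (m : probability S R).
Context (zeta : S -> R).
Hypothesis mz : measurable_fun setT zeta.
Hypothesis z0 : forall s, 0 < zeta s.
Local Notation U := (@unif R).

Definition unif2 : probability (R * R)%type R := (U \x U)%E.
Definition glue_prob : probability (S * (R * R))%type R := (m \x unif2)%E.

(** If [u] is uniform, [u < H r ^+ 2] has the probability that two independent
    variables with tail [H] both exceed [r]. Thus [above] stands for the event
    [x < l * zeta * (min X1 X2 + min X3 X4)]. As the union runs over rationals,
    it is measurable for every [H] and passes to limits of [H] along the
    rationals. *)
Definition above (H : R -> R) (l x : R) : set (S * (R * R)) :=
  [set z | exists q : rat * rat, [/\ z.2.1 < H (ratr q.1) ^+ 2,
    z.2.2 < H (ratr q.2) ^+ 2 & x < l * zeta z.1 * (ratr q.1 + ratr q.2)]].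

(** The complement of [above] up to a null set and an arbitrarily small change
    of [x], in a form that also passes to limits. *)
Definition below (H : R -> R) (l x : R) : set (S * (R * R)) :=
  [set z | exists q : rat * rat, [/\ H (ratr q.1) ^+ 2 < z.2.1,
    H (ratr q.2) ^+ 2 < z.2.2 & l * zeta z.1 * (ratr q.1 + ratr q.2) < x]].

Definition glue_op (l : R) (H : R -> R) (x : R) : R := pr glue_prob (above H l x).
Local Notation T := glue_op.

Lemma measurable_above H l x : measurable (above H l x).
Proof.
apply: measurable_ex_countable => q.
rewrite [X in measurable X](_ : _ =
  [set z | z.2.1 < H (ratr q.1) ^+ 2] `&` [set z | z.2.2 < H (ratr q.2) ^+ 2] `&`
  [set z | x < l * zeta z.1 * (ratr q.1 + ratr q.2)]); last first.
  by apply/seteqP; split=> z /= => [[]|[[]]].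
apply: measurableI; first apply: measurableI; apply: measurable_set_lt => //.
- exact: (measurableT_comp measurable_fst measurable_snd).
- exact: (measurableT_comp measurable_snd measurable_snd).
- apply: measurable_funM => //; apply: measurable_funM => //.
  exact: (measurableT_comp mz measurable_fst).
Qed.

Lemma measurable_below H l x : measurable (below H l x).
Proof.
apply: measurable_ex_countable => q.
rewrite [X in measurable X](_ : _ =
  [set z | H (ratr q.1) ^+ 2 < z.2.1] `&` [set z | H (ratr q.2) ^+ 2 < z.2.2] `&`
  [set z | l * zeta z.1 * (ratr q.1 + ratr q.2) < x]); last first.
  by apply/seteqP; split=> z /= => [[]|[[]]].
apply: measurableI; first apply: measurableI; apply: measurable_set_lt => //.
- exact: (measurableT_comp measurable_fst measurable_snd).
- exact: (measurableT_comp measurable_snd measurable_snd).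
- apply: measurable_funM => //; apply: measurable_funM => //.
  exact: (measurableT_comp mz measurable_fst).
Qed.
Local Hint Extern 0 (measurable (above _ _ _)) => exact: measurable_above : core.
Local Hint Extern 0 (measurable (below _ _ _)) => exact: measurable_below : core.

Lemma glue_op_ge0 l H x : 0 <= T l H x.
Proof. exact: pr_ge0. Qed.

Lemma glue_op_le1 l H x : T l H x <= 1.
Proof. exact: pr_le1. Qed.

Lemma glue_op_le l H H' x : (forall y, 0 <= H y) -> (forall y, H y <= H' y) ->
  T l H x <= T l H' x.
Proof.
move=> H0 HH; apply: pr_le => // z [q [h1 h2 h3]]; exists q; split=> //.
  by apply: (lt_le_trans h1); apply: sqr_mono.
by apply: (lt_le_trans h2); apply: sqr_mono.
Qed.

Lemma glue_op_anti l H x y : x <= y -> T l H y <= T l H x.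
Proof.
move=> xy; apply: pr_le => // z [q [h1 h2 h3]]; exists q; split=> //.
exact: le_lt_trans h3.
Qed.

Lemma glue_op_le_scale l l' H x : 0 < l -> l <= l' -> 0 <= x ->
  T l H x <= T l' H x.
Proof.
move=> l0 ll x0; apply: pr_le => // z [q [h1 h2 h3]]; exists q; split=> //.
have zz := z0 z.1; set s := ratr q.1 + _ in h3 *.
have s0 : 0 < s by rewrite -(pmulr_rgt0 s (mulr_gt0 l0 zz)) (le_lt_trans x0).
by apply: (lt_le_trans h3); rewrite !ler_wpM2r// ltW.
Qed.

(** The last inequality in [above] is strict, which leaves room to move the two
    rationals; so the values of [H] at its jumps do not matter. The factor [c]
    covers changes of scale at the same time. *)
Lemma glue_op_ext c l H H' x : 0 < l -> 0 < c -> (forall y, 0 <= H y) ->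
  (forall x y, y < c * x -> H x <= H' y) -> T l H x <= T l H' (c * x).
Proof.
move=> l0 c0 H0 HH; apply: pr_le => // z [[r s]] /= [h1 h2 h3].
have lz : 0 < l * zeta z.1 by rewrite mulr_gt0.
have {}h3 : c * ((l * zeta z.1)^-1 * x) < c * ratr r + c * ratr s.
  by rewrite -mulrDr ltr_pM2l// ltr_pdivrMl.
set t := c * (_ * x) in h3.
pose e := (c * ratr r + c * ratr s - t) / 2.
have e0 : 0 < e by rewrite /e; lra.
have [|r' /andP[r1 r2]] := @ratr_between R (c * ratr r - e) (c * ratr r); first by lra.
have [|s' /andP[s1 s2]] := @ratr_between R (c * ratr s - e) (c * ratr s); first by lra.
exists (r', s') => /=; split.
- by apply: (lt_le_trans h1); apply: sqr_mono => //; exact: HH.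
- by apply: (lt_le_trans h2); apply: sqr_mono => //; exact: HH.
- by rewrite -ltr_pdivrMl//= mulrCA -/t; rewrite /e in r1 s1 *; lra.
Qed.

Lemma glue_op_scale c l H x : 0 < l -> 0 < c -> survival H ->
  T l (fun y => H (c * y)) x = T l H (c * x).
Proof.
move=> l0 c0 [Ha H0 _ _]; apply/eqP; rewrite eq_le; apply/andP; split.
  by apply: glue_op_ext => // a b /ltW; exact: Ha.
rewrite -[X in _ <= T _ _ X](mulKf (lt0r_neq0 c0)).
apply: glue_op_ext; rewrite ?invr_gt0// => a b.
by rewrite ltr_pdivlMl// => /ltW; exact: Ha.
Qed.

Lemma glue_op_rcont l H : rcont (T l H).
Proof.
move=> x c cT.
pose F n := above H l (x + n.+1%:R^-1).
have UF : \bigcup_n F n = above H l x.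
  apply/seteqP; split=> z.
    move=> [n _ [q [h1 h2 h3]]]; exists q; split=> //.
    by apply: lt_trans h3; rewrite ltrDl invr_gt0.
  move=> [q [h1 h2 h3]].
  have [n hn] : exists n, n.+1%:R^-1 < l * zeta z.1 * (ratr q.1 + ratr q.2) - x.
    have h : 0 < l * zeta z.1 * (ratr q.1 + ratr q.2) - x by rewrite subr_gt0.
    by have [n _ hn] := near_infty_natSinv_lt (PosNum h); exists n; exact: (hn n (leqnn n)).
  by exists n => //; exists q; split=> //; rewrite -ltrBrDl.
have ndF : {homo F : a b / (a <= b)%N >-> a `<=` b}.
  move=> a b ab z [q [h1 h2 h3]]; exists q; split=> //.
  apply: le_lt_trans h3; rewrite lerD2l lef_pV2 ?posrE//.
  by rewrite ler_nat.
have := @pr_cvg_bigcup _ _ _ glue_prob F (fun n => measurable_above _ _ _) ndF.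
rewrite UF => /cvgrPdist_lt/(_ (T l H x - c)); rewrite subr_gt0 => /(_ cT)[n _ h].
exists (x + n.+1%:R^-1); first by rewrite ltrDl invr_gt0.
have {}h : `|T l H x - T l H (x + n.+1%:R^-1)| < T l H x - c := h n (leqnn n).
by move: (le_lt_trans (ler_norm _) h); rewrite ltrD2l ltrN2.
Qed.
End gluing_operator.

(** * Sums of two minima *)

Section sections_of_above.
Context {R : realType}.
Local Notation U := (@unif R).
Local Notation unif2 := (@unif2 R).

Definition above2 (H : R -> R) (y : R) : set (R * R) :=
  [set w | exists q : rat * rat, [/\ w.1 < H (ratr q.1) ^+ 2,
    w.2 < H (ratr q.2) ^+ 2 & y < ratr q.1 + ratr q.2]].

Lemma measurable_above2 H y : measurable (above2 H y).
Proof.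
apply: measurable_ex_countable => q.
rewrite [X in measurable X](_ : _ =
  [set z | z.1 < H (ratr q.1) ^+ 2] `&` [set z | z.2 < H (ratr q.2) ^+ 2] `&`
  [set z | y < ratr q.1 + ratr q.2]); last first.
  by apply/seteqP; split=> z /= => [[]|[[]]].
by apply: measurableI; first apply: measurableI; apply: measurable_set_lt.
Qed.

(** The tail of the sum of two independent minima. *)
Definition sum_tail (H : R -> R) (y : R) : R := pr unif2 (above2 H y).

Lemma pr_unif_co a b : 0 <= a -> a <= b -> b <= 1 ->
  pr U [set u | a <= u < b] = b - a.
Proof.
move=> a0 ab b1.
have ma : measurable [set u : R | u < a] by apply: measurable_set_lt.
have mb : measurable [set u : R | u < b] by apply: measurable_set_lt.
have mab : measurable [set u : R | a <= u < b].
  rewrite [X in measurable X](_ : _ = [set u | u < b] `\` [set u | u < a]).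
    exact: measurableD.
  apply/seteqP; split=> u /=; first by move=> /andP[au ->]; rewrite ltNge au.
  by move=> [ub /negP]; rewrite -leNgt ub => ->.
have := @pr_setU_disj _ _ _ U _ _ ma mab.
rewrite (pr_unif_lt (c := a)) ?a0 ?(le_trans ab)// => h.
have /h : [set u : R | u < a] `&` [set u | a <= u < b] = set0.
  by apply/seteqP; split=> // u [/= ua /andP[]]; rewrite leNgt ua.
rewrite (_ : _ `|` _ = [set u | u < b]); last first.
  apply/seteqP; split=> u /=.
    by move=> [ua|/andP[]//]; exact: lt_le_trans ab.
  by move=> ub; case: (ltP u a) => ua; [left|right].
by rewrite pr_unif_lt ?b1 ?(le_trans a0)// => /eqP; rewrite addrC -subr_eq => /eqP <-.
Qed.

Let m_lt a : measurable [set u : R | u < a].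
Proof. exact: measurable_set_lt. Qed.

Let m_ge a : measurable [set u : R | a <= u].
Proof. exact: measurable_set_le. Qed.

Let m_co a b : measurable [set u : R | a <= u < b].
Proof.
rewrite [X in measurable X](_ : _ = [set u | a <= u] `&` [set u | u < b]).
  exact: measurableI.
by apply/seteqP; split=> u /=; [move=> /andP|move=> [-> ->]].
Qed.

Lemma pr_P2X (A B : set R) : measurable A -> measurable B ->
  pr unif2 (A `*` B) = pr U A * pr U B.
Proof. exact: pr_prod. Qed.

(** With probability [gmap p] one of the two minima exceeds [y'], and the other
    one is at least [0] in any case. *)
Lemma sum_tail_ge H y y' p : survival H -> 0 <= p -> y < y' -> p <= H y' ->
  gmap p <= sum_tail H y.
Proof.
move=> [Ha H0 H1 Hn] p0 yy pH.
have p1 : p <= 1 by exact: le_trans pH (H1 _).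
have p2 : p ^+ 2 <= 1 by rewrite exprn_ile1.
have p20 : 0 <= p ^+ 2 by exact: sqr_ge0.
pose A := [set u : R | u < p ^+ 2] `*` [set u : R | u < 1].
pose B := [set u : R | p ^+ 2 <= u < 1] `*` [set u : R | u < p ^+ 2].
have mA : measurable A by exact: measurableX.
have mB : measurable B by exact: measurableX.
have -> : gmap p = pr unif2 (A `|` B).
  rewrite pr_setU_disj//; last first.
    apply/seteqP; split=> // -[u v] [[/= up _] [/= /andP[]]].
    by rewrite leNgt up.
  rewrite !pr_P2X// pr_unif_co// !pr_unif_lt ?p20 ?p2 ?ler01 ?lexx//.
  by rewrite /gmap; ring.
apply: pr_le; [exact: measurableU|exact: measurable_above2|].
(* [s] must be negative, where [H] is known to be [1]; the room for it comes
   from [y < y'] *)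
have [r /andP[r1 r2]] := ratr_between yy.
have [|s /andP[s1 s2]] := @ratr_between R (y - ratr r) 0; first by rewrite subr_lt0.
have Kr : p ^+ 2 <= H (ratr r) ^+ 2.
  by apply: sqr_mono => //; apply: (le_trans pH); exact/Ha/ltW.
move=> [u v] [[/= up v1]|[/= /andP[_ u1] vp]].
- exists (r, s); split => /=; [exact: lt_le_trans Kr| |by lra].
  by rewrite Hn// expr1n.
- exists (s, r); split => /=; [|exact: lt_le_trans Kr|by lra].
  by rewrite Hn// expr1n.
Qed.

Lemma sum_tail_ge_rcont H y : survival H -> rcont H ->
  gmap (H y) <= sum_tail H y.
Proof.
move=> sH rH; have [Ha H0 H1 Hn] := sH.
apply/ler_addgt0Pr => e e0.
have [Hy|Hy] := leP (H y) (e / 4).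
  apply: le_trans (gmap_lip (lexx 0) (H0 y) (H1 y)) _.
  have -> : gmap 0 = 0 :> R by rewrite /gmap; ring.
  by have := pr_ge0 unif2 (above2 H y); rewrite /sum_tail; lra.
have [|y' yy' cy'] := rH y (H y - e / 4); first by lra.
have := @sum_tail_ge H y y' (H y - e / 4) sH _ yy' (ltW cy').
have := @gmap_lip _ (H y - e / 4) (H y) _ _ (H1 y).
by lra.
Qed.

(** If the sum exceeds [y], one of the minima exceeds [y / 2]. *)
Lemma sum_tail_le H y : survival H -> sum_tail H y <= gmap (H (y / 2)).
Proof.
move=> [Ha H0 H1 Hn]; set p := H _.
have p2 : p ^+ 2 <= 1 by rewrite exprn_ile1// /p.
have p20 : 0 <= p ^+ 2 by exact: sqr_ge0.
pose A := [set u : R | p ^+ 2 <= u] `*` [set u : R | p ^+ 2 <= u].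
have mA : measurable A by exact: measurableX.
have -> : gmap p = pr unif2 (~` A).
  by rewrite pr_setC// pr_P2X// !pr_unif_ge ?p20//; rewrite /gmap; ring.
apply: pr_le; [exact: measurable_above2|exact: measurableC|].
move=> [u v] [[r s] /= [ur vs yrs]] [/= pu pv].
have h (x : R) (w : R) : p ^+ 2 <= w -> w < H x ^+ 2 -> x < y / 2.
  move=> pw wx; rewrite ltNge; apply/negP => /Ha yx.
  by have := le_lt_trans pw wx; rewrite ltNge sqr_mono.
have := h _ _ pu ur; have := h _ _ pv vs; lra.
Qed.

(** When [H] has total mass [1 - p] at the origin, the sum is small if one
    summand vanishes and the other is small; keeping this joint event exactly
    is what makes the bound sharp to first order. *)
Lemma sum_tail_le_atom H p y : survival H -> 0 <= p <= 1 ->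
  (forall x, 0 < x -> H x <= p) -> 0 < y ->
  sum_tail H y <= 1 - (1 - p ^+ 2) * (1 + p ^+ 2 - 2 * H y ^+ 2).
Proof.
move=> [Ha H0 H1 Hn] /andP[p0 p1] Hp y0.
have p2 : p ^+ 2 <= 1 by rewrite exprn_ile1.
have p20 : 0 <= p ^+ 2 by exact: sqr_ge0.
have k0 : 0 <= H y ^+ 2 by exact: sqr_ge0.
have kp : H y ^+ 2 <= p ^+ 2 by apply: sqr_mono => //; exact: Hp.
pose A := [set u : R | H y ^+ 2 <= u] `*` [set u : R | p ^+ 2 <= u].
pose B := [set u : R | p ^+ 2 <= u] `*` [set u : R | H y ^+ 2 <= u < p ^+ 2].
have mA : measurable A by exact: measurableX.
have mB : measurable B by exact: measurableX.
have -> : 1 - (1 - p ^+ 2) * (1 + p ^+ 2 - 2 * H y ^+ 2) = pr unif2 (~` (A `|` B)).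
  rewrite pr_setC; last exact: measurableU.
  rewrite pr_setU_disj//; last first.
    apply/seteqP; split=> // -[u v] [[/= _ up] [/= _ /andP[_]]].
    by rewrite ltNge up.
  rewrite !pr_P2X// pr_unif_co// !pr_unif_ge ?p20 ?k0 ?(le_trans kp)//.
  by ring.
apply: pr_le; [exact: measurable_above2|exact/measurableC/measurableU|].
move=> [u v] [[r s] /= [ur vs yrs]].
have h1 (x w : R) : H y ^+ 2 <= w -> w < H x ^+ 2 -> x < y.
  move=> pw wx; rewrite ltNge; apply/negP => /Ha yx.
  by have := le_lt_trans pw wx; rewrite ltNge sqr_mono.
have h2 (x w : R) : p ^+ 2 <= w -> w < H x ^+ 2 -> x <= 0.
  move=> pw wx; rewrite leNgt; apply/negP => /Hp yx.
  by have := le_lt_trans pw wx; rewrite ltNge sqr_mono.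
case=> [[/= a b]|[/= a /andP[b _]]].
- by have := h1 _ _ a ur; have := h2 _ _ b vs; lra.
- by have := h2 _ _ a ur; have := h1 _ _ b vs; lra.
Qed.

End sections_of_above.

(** * Almost complementary events *)

Section operator_sections.
Context {R : realType} d (S : measurableType d) (m : probability S R).
Context (zeta : S -> R).
Hypothesis mz : measurable_fun setT zeta.
Hypothesis z0 : forall s, 0 < zeta s.
Local Notation U := (@unif R).
Local Notation unif2 := (@unif2 R).
Local Notation glue_prob := (glue_prob m).
Local Notation T := (glue_op m zeta).
Local Notation above := (above zeta).
Local Notation below := (below zeta).

Lemma xsection_above H l x s : 0 < l ->
  xsection (above H l x) s = above2 H (x / (l * zeta s)).
Proof.
move=> l0; have lz : 0 < l * zeta s by rewrite mulr_gt0.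
apply/seteqP; split=> w; rewrite /xsection /= ?inE /=.
  by move=> [q [h1 h2 h3]]; exists q; split=> //; rewrite ltr_pdivrMr// mulrC.
by move=> [q [h1 h2 h3]]; exists q; split=> //; rewrite mulrC -ltr_pdivrMr.
Qed.

Lemma measurable_sum_tail H l x : 0 < l ->
  measurable_fun setT (fun s => (sum_tail H (x / (l * zeta s)))%:E).
Proof.
move=> l0; have := measurable_fun_xsection unif2 (measurable_above mz H l x).
apply: eq_measurable_fun => s _ /=; rewrite xsection_above// prE//.
exact: measurable_above2.
Qed.

Lemma glue_opE H l x : 0 < l ->
  (T l H x)%:E = (\int[m]_s (sum_tail H (x / (l * zeta s)))%:E)%E.
Proof.
move=> l0; rewrite -(prE glue_prob); last exact: measurable_above.
apply: eq_integral => s _ /=; rewrite xsection_above// prE//.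
exact: measurable_above2.
Qed.

Lemma glue_op_ge_int H l x (f : S -> \bar R) : 0 < l ->
  measurable_fun setT f -> (forall s, 0 <= f s)%E ->
  (forall s, f s <= (sum_tail H (x / (l * zeta s)))%:E)%E ->
  (\int[m]_s f s <= (T l H x)%:E)%E.
Proof.
move=> l0 mf f0 h; rewrite glue_opE//; apply: ge0_le_integral => //.
exact: measurable_sum_tail.
Qed.

Lemma above_below l H x z : 0 < l -> survival H -> above H l x z -> ~ below H l x z.
Proof.
move=> l0 [Ha H0 _ _] [[r s]] /= [h1 h2 h3] [[r' s']] /= [h1' h2' h3'].
have h (a b : R) u : H a ^+ 2 < u -> u < H b ^+ 2 -> b < a.
  move=> ua ub; rewrite ltNge; apply/negP => /Ha ab.
  by have := lt_trans ua ub; rewrite ltNge sqr_mono.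
have := lt_trans h3' h3; rewrite ltr_pM2l ?mulr_gt0//.
have := h _ _ _ h1' h1; have := h _ _ _ h2' h2; lra.
Qed.

Lemma glue_op_le_below l H x : 0 < l -> survival H ->
  T l H x <= 1 - pr glue_prob (below H l x).
Proof.
move=> l0 sH; rewrite -pr_setC; last exact: measurable_below.
apply: pr_le; [exact: measurable_above|by apply: measurableC; apply: measurable_below|].
by move=> z; exact: above_below.
Qed.

(** Where a tail, sampled on a grid that starts at [- del], drops below [u]. *)
Let grid (K : R -> R) (u del : R) : 0 < del -> (forall y, y < 0 -> u < K y) ->
  (forall i : nat, u < K (del * (i%:R - 1))) \/
  exists i : nat, u < K (del * (i%:R - 1)) /\ ~ u < K (del * i%:R).
Proof.
move=> d0 hneg.
have [h|/existsNP[i hi]] := pselect (forall i : nat, u < K (del * (i%:R - 1))); first by left.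
right; have exi : exists i : nat, ~~ (u < K (del * (i%:R - 1))) by exists i; apply/negP.
case: (ex_minnP exi) => -[|k]; last first.
  move=> /negP hk hmin; exists k; split; last by move: hk; rewrite -natr1 addrK.
  by apply/negPn/negP => /hmin; rewrite ltnn.
by move=> + _; rewrite sub0r mulrN1 hneg// oppr_lt0.
Qed.

(** Locate [z.2.1] and [z.2.2] on a grid of mesh [q]: each lies between the
    values of [H ^+ 2] at the two ends of a cell. The left ends of the two cells
    bear witness to [above], the right ends to [below], and the sums over left
    and right ends differ by [2 * q], which is less than the gap between [x] and
    [y] allows. *)
Lemma above_or_below l H x y z : 0 < l -> survival H -> x < y ->
  z.2.1 < 1 -> z.2.2 < 1 ->
  (forall q : rat, z.2.1 != H (ratr q) ^+ 2) ->
  (forall q : rat, z.2.2 != H (ratr q) ^+ 2) ->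
  above H l x z \/ below H l y z.
Proof.
move=> l0 [Ha H0 H1 Hn] xy; case: z => s [u v] /= u1 v1 uq vq.
set L := l * zeta s; have L0 : 0 < L by rewrite mulr_gt0.
have [|q /andP[q0 qd]] := @ratr_between R 0 ((y - x) / (2 * L)).
  by rewrite divr_gt0 ?mulr_gt0// subr_gt0.
have {}qd : 2 * L * ratr q < y - x by rewrite mulrC -ltr_pdivlMr// mulr_gt0.
pose r (i : nat) : rat := q * (i%:R - 1); pose r' (i : nat) : rat := q * i%:R.
have rE i : ratr q * (i%:R - 1) = ratr (r i) :> R.
  by rewrite /r rmorphM rmorphB /= ratr_nat rmorph1.
have rE' i : ratr q * i%:R = ratr (r' i) :> R by rewrite /r' rmorphM /= ratr_nat.
have big c : exists i : nat, c < ratr (r i) :> R.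
  exists (Num.truncn (c / ratr q)).+2; rewrite -rE -ltr_pdivrMl// mulrC.
  by rewrite -natr1 addrK truncnS_gt.
have neg w : w < 1 -> forall y, y < 0 -> w < H y ^+ 2.
  by move=> w1 t t0; rewrite Hn// expr1n.
have [hu|[i [ui /negP]]] := grid (K := fun t => H t ^+ 2) q0 (neg _ u1).
  left; have [i hi] := big (L^-1 * x - ratr (r 0%N)); exists (r i, r 0%N) => /=.
  split; [by rewrite -rE|by rewrite -rE; apply: neg => //; rewrite sub0r mulrN1 oppr_lt0|].
  by rewrite -/L -ltr_pdivrMl//; lra.
rewrite -leNgt le_eqVlt eq_sym rE' (negbTE (uq _)) /= => ui'.
have [hv|[j [vj /negP]]] := grid (K := fun t => H t ^+ 2) q0 (neg _ v1).
  left; have [k hk] := big (L^-1 * x - ratr (r 0%N)); exists (r 0%N, r k) => /=.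
  split; [by rewrite -rE; apply: neg => //; rewrite sub0r mulrN1 oppr_lt0|by rewrite -rE|].
  by rewrite -/L -ltr_pdivrMl//; lra.
rewrite -leNgt le_eqVlt eq_sym rE' (negbTE (vq _)) /= => vj'.
have [h|h] := ltP (L * (ratr (r' i) + ratr (r' j))) y.
  by right; exists (r' i, r' j).
left; exists (r i, r j); split => /=; rewrite -?rE//.
move: h; rewrite -!rE'.
have -> : L * (ratr q * (i%:R - 1) + ratr q * (j%:R - 1)) =
   L * (ratr q * i%:R + ratr q * j%:R) - 2 * L * ratr q by ring.
rewrite -/L; lra.
Qed.

End operator_sections.

Section complement.
Context {R : realType} d (S : measurableType d) (m : probability S R).
Context (zeta : S -> R).
Hypothesis mz : measurable_fun setT zeta.
Hypothesis z0 : forall s, 0 < zeta s.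
Local Notation U := (@unif R).
Local Notation unif2 := (@unif2 R).
Local Notation glue_prob := (glue_prob m).
Local Notation T := (glue_op m zeta).
Local Notation above := (above zeta).
Local Notation below := (below zeta).

(** The exceptional points of [above_or_below] form a null set. *)
Lemma glue_op_ge_below H l x y : 0 < l -> survival H -> x < y ->
  1 - pr glue_prob (below H l y) <= T l H x.
Proof.
move=> l0 sH xy.
pose Q := [set u : R | exists q : rat, u = H (ratr q) ^+ 2].
pose A := [set u : R | 1 <= u] `|` Q.
have mQ : measurable Q by apply: measurable_ex_countable => q; exact: measurable_set1.
have m1 : measurable [set u : R | 1 <= u] by exact: measurable_set_le.
have mA : measurable A by exact: measurableU.
have A0 : pr U A = 0.
  apply/eqP; rewrite eq_le pr_ge0 andbT; apply: (le_trans (pr_setU _ _ _)) => //.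
  rewrite pr_unif_ge ?ler01 ?lexx// pr_unif_countable// ?subrr ?addr0//.
  have -> : Q = range (fun q : rat => H (ratr q) ^+ 2).
    by apply/seteqP; split=> u [q]; [move=> ->; exists q|move=> _ <-; exists q].
  by apply: sub_countable (card_image_le _ _) _; exact: countableP.
pose N1 : set (S * (R * R)) := setT `*` (A `*` setT).
pose N2 : set (S * (R * R)) := setT `*` (setT `*` A).
have mN1 : measurable N1 by apply: measurableX => //; exact: measurableX.
have mN2 : measurable N2 by apply: measurableX => //; exact: measurableX.
have P1 : pr glue_prob N1 = 0.
  rewrite /glue_prob pr_prod//; last exact: measurableX.
  by rewrite pr_P2X// A0 mul0r mulr0.
have P2' : pr glue_prob N2 = 0.
  rewrite /glue_prob pr_prod//; last exact: measurableX.
  by rewrite pr_P2X// A0 !mulr0.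
have ma : measurable (above H l x) by exact: measurable_above.
have mb : measurable (below H l y) by exact: measurable_below.
have cover : [set: S * (R * R)] `<=` (above H l x `|` below H l y) `|` (N1 `|` N2).
  move=> z _; have [h|/not_orP[n1 n2]] := pselect ((N1 `|` N2) z); first by right.
  left; have {}n1 : ~ A z.2.1 by move=> h; apply: n1.
  have {}n2 : ~ A z.2.2 by move=> h; apply: n2.
  have lt1 u : ~ A u -> u < 1 by move=> h; rewrite ltNge; apply/negP => u1; apply: h; left.
  have neq u : ~ A u -> forall q : rat, u != H (ratr q) ^+ 2.
    by move=> h q; apply/eqP => uq; apply: h; right; exists q.
  by apply: (above_or_below z0 l0 sH xy); [exact: lt1|exact: lt1|exact: neq|exact: neq].
have h1 := @pr_le _ _ _ glue_prob _ _ measurableT (measurableU _ _ (measurableU _ _ ma mb) (measurableU _ _ mN1 mN2)) cover.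
rewrite pr_setT in h1.
have h2 := pr_setU glue_prob (measurableU _ _ ma mb) (measurableU _ _ mN1 mN2).
have h3 := pr_setU glue_prob ma mb.
have h4 := pr_setU glue_prob mN1 mN2.
rewrite P1 P2' addr0 in h4.
rewrite lerBlDr; apply: (le_trans h1); apply: (le_trans h2).
by rewrite -[leRHS]addr0 lerD.
Qed.

End complement.

(** Tychonoff's theorem for the product of copies of [`[0, 1]]; countability of
    the index set turns a cluster point into the limit of a subsequence. *)
Lemma helly (R : realType) (f : nat -> rat -> R) :
  (forall n q, 0 <= f n q <= 1) ->
  exists (phi : nat -> nat) (h : rat -> R), (forall n, (n <= phi n)%N) /\
    forall q, f (phi n) q @[n --> \oo] --> h q.
Proof.
move=> f01.
have := @tychonoff rat (fun _ => R) (fun _ => `[0, 1]%classic)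
  (fun _ => @segment_compact R 0 1).
move=> /(_ (f @ \oo) _) []; first by exists 0%N => // n _ q /=; rewrite in_itv /=.
move=> h [h01 hcl].
have sel (n : nat) : exists k, (n <= k)%N /\
    forall q : rat, (pickle q <= n)%N -> `|h q - f k q| < n.+1%:R^-1.
  pose C (i : nat) (g : rat -> R) : Prop :=
    if unpickle i is Some q then `|h q - g q| < n.+1%:R^-1 else true.
  pose V := [set g | forall i : 'I_n.+1, C i g].
  have nV : nbhs h V.
    apply: (@filter_forall _ 'I_n.+1 (fun i => C i) (nbhs h)) => i; rewrite /C.
    case: (unpickle i) => [q|]; last exact: nearW.
    have e0 : 0 < n.+1%:R^-1 :> R by rewrite invr_gt0.
    exact: (@proj_continuous rat (fun _ => R) q h _ (nbhsx_ballx (h q) _ e0)).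
  have FA : (f @ \oo) (f @` [set k | (n <= k)%N]).
    by exists n => // k nk; exists k.
  have [g [[k nk <-] Vk]] := hcl _ _ FA nV.
  exists k; split=> // q qn; have : C (pickle q) (f k) := Vk (Ordinal (qn : (pickle q < n.+1)%N)).
  by rewrite /C pickleK.
have [phi hphi] := choice sel.
exists phi, h; split=> [n|q]; first by case: (hphi n).
apply/cvgrPdist_lt => e e0; have [N _ hN] := near_infty_natSinv_lt (PosNum e0).
exists (maxn N (pickle q)) => // n /=; rewrite geq_max => /andP[Nn qn].
have [_ /(_ q qn) h1] := hphi n; apply: (lt_trans h1).
exact: (hN n Nn).
Qed.

(** * Limits of stationary laws *)

Section limits.
Context {R : realType}.
Implicit Types u : nat -> R.

Lemma near_sub (phi : nat -> nat) (P : nat -> Prop) :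
  (forall n, (n <= phi n)%N) -> (\forall n \near \oo, P n) ->
  \forall n \near \oo, P (phi n).
Proof.
by move=> hphi [N _ h]; exists N => // n /= Nn; apply: h; exact: leq_trans (hphi n).
Qed.

Lemma cvg_sub (phi : nat -> nat) u (l : R) : (forall n, (n <= phi n)%N) ->
  u n @[n --> \oo] --> l -> u (phi n) @[n --> \oo] --> l.
Proof. by move=> hphi ul A /ul; exact: (@near_sub phi (fun n => A (u n))). Qed.

End limits.

Section limit_of_survival.
Context {R : realType} d (S : measurableType d) (m : probability S R).
Context (zeta : S -> R).
Hypothesis mz : measurable_fun setT zeta.
Hypothesis z0 : forall s, 0 < zeta s.
Local Notation glue_prob := (glue_prob m).
Local Notation T := (glue_op m zeta).
Local Notation above := (above zeta).
Local Notation below := (below zeta).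

Section fatou.
Variables (ln : nat -> R) (Hn : nat -> R -> R) (l : R) (H : R -> R).
Hypothesis lnl : ln n @[n --> \oo] --> l.
Hypothesis HnH : forall q : rat, Hn n (ratr q) @[n --> \oo] --> H (ratr q).

Let sq_cvg q : Hn n (ratr q) ^+ 2 @[n --> \oo] --> H (ratr q) ^+ 2.
Proof. by have := cvgM (HnH (q := q)) (HnH (q := q)); apply. Qed.

Let len_cvg (z t : R) : ln n * z * t @[n --> \oo] --> l * z * t.
Proof. exact: (cvgMr_tmp (cvgMr_tmp lnl)). Qed.

Lemma glue_op_liminf x e : 0 < e ->
  \forall n \near \oo, T l H x - e < T (ln n) (Hn n) x.
Proof.
apply: pr_fatou; [exact: measurable_above|by move=> n; exact: measurable_above|].
move=> z [q [h1 h2 h3]].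
have n1 := cvgr_gt _ (@sq_cvg q.1) _ h1.
have n2 := cvgr_gt _ (@sq_cvg q.2) _ h2.
have n3 := cvgr_gt _ (@len_cvg (zeta z.1) (ratr q.1 + ratr q.2)) _ h3.
near=> n; exists q; split.
- by near: n; exact: n1.
- by near: n; exact: n2.
- by near: n; exact: n3.
Unshelve. all: by end_near. Qed.

Lemma below_liminf x e : 0 < e ->
  \forall n \near \oo, pr glue_prob (below H l x) - e < pr glue_prob (below (Hn n) (ln n) x).
Proof.
apply: pr_fatou; [exact: measurable_below|by move=> n; exact: measurable_below|].
move=> z [q [h1 h2 h3]].
have n1 := cvgr_lt _ (@sq_cvg q.1) _ h1.
have n2 := cvgr_lt _ (@sq_cvg q.2) _ h2.
have n3 := cvgr_lt _ (@len_cvg (zeta z.1) (ratr q.1 + ratr q.2)) _ h3.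
near=> n; exists q; split.
- by near: n; exact: n1.
- by near: n; exact: n2.
- by near: n; exact: n3.
Unshelve. all: by end_near. Qed.

End fatou.

(** Fatou's lemma for [above] gives one inequality in the limit, Fatou's lemma
    for [below] the other one. The limit along the rationals is extended to a
    right continuous tail [G]; it differs from [H] only at jumps, which
    [glue_op] does not see. *)
Lemma stationary_limit (ln : nat -> R) (Hn : nat -> R -> R) (l : R) : 0 < l ->
  (forall n, 0 < ln n) -> ln n @[n --> \oo] --> l ->
  (forall n, survival (Hn n)) ->
  exists G, [/\ survival G, rcont G,
   (forall x c, (forall y, x < y -> \forall n \near \oo, Hn n y <= c) -> G x <= c),
   (forall x y c, x < y -> (\forall n \near \oo, c <= Hn n y) -> c <= G x) &
   (forall x e, 0 < e ->
     (forall y, x < y < x + e -> \forall n \near \oo, Hn n y = T (ln n) (Hn n) y) ->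
     G x = T l G x)].
Proof.
move=> l0 ln0 lnl sH.
have [phi [h [hphi hcvg]]] := @helly R (fun n q => Hn n (ratr q))
  (fun n q => ltac:(by have [_ a b _] := sH n; rewrite a b)).
have h0 q : 0 <= h q.
  by apply: cvgr_to_ge (hcvg q) _; apply: nearW => n; have [_ a _ _] := sH (phi n).
have h1 q : h q <= 1.
  by apply: cvgr_to_le (hcvg q) _; apply: nearW => n; have [_ _ a _] := sH (phi n).
have ha q q' : ratr q <= ratr q' :> R -> h q' <= h q.
  move=> qq; rewrite -subr_ge0.
  have hc : Hn (phi n) (ratr q) - Hn (phi n) (ratr q') @[n --> \oo] --> h q - h q'.
    exact: cvgB (hcvg q) (hcvg q').
  apply: cvgr_to_ge hc _; apply: nearW => n.
  by have [a _ _ _] := sH (phi n); rewrite subr_ge0 a.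
have hneg q : ratr q < 0 :> R -> h q = 1.
  move=> q0; apply/eqP; rewrite eq_le h1 /=.
  apply: cvgr_to_ge (hcvg q) _; apply: nearW => n.
  by have [_ _ _ ->] := sH (phi n).
pose A (x : R) := [set h q | q in [set q : rat | x <= ratr q]].
pose B (x : R) := [set h q | q in [set q : rat | x < ratr q]].
have ubA x : has_ubound (A x) by exists 1 => _ [q _ <-].
have ubB x : has_ubound (B x) by exists 1 => _ [q _ <-].
have B0 x : (B x) !=set0.
  have [|q /andP[q1 _]] := @ratr_between R x (x + 1); first by rewrite ltrDl.
  by exists (h q), q.
have BA x : B x `<=` A x by move=> _ [q /ltW xq <-]; exists q.
have A0 x : (A x) !=set0 by have [t /BA] := B0 x; exists t.
pose H x := sup (A x); pose G x := sup (B x).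
have Hq q : H (ratr q) = h q.
  apply/eqP; rewrite eq_le; apply/andP; split.
    by apply: ge_sup => // _ [q' qq <-]; exact: ha.
  by apply: ub_le_sup => //; exists q => /=.
have geH x q : x <= ratr q -> h q <= H x.
  by move=> xq; apply: ub_le_sup => //; exists q.
have geG x q : x < ratr q -> h q <= G x.
  by move=> xq; apply: ub_le_sup => //; exists q.
have leH x c : (forall q, x <= ratr q -> h q <= c) -> H x <= c.
  by move=> k; apply: ge_sup => // _ [q qq <-]; exact: k.
have leG x c : (forall q, x < ratr q -> h q <= c) -> G x <= c.
  by move=> k; apply: ge_sup => // _ [q qq <-]; exact: k.
have sHH : survival H.
  split=> [x y xy|x|x|x x0].
  - by apply: leH => q yq; apply: geH; exact: le_trans yq.
  - by have [t [q qq _]] := A0 x; apply: le_trans (geH _ _ qq).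
  - by apply: leH.
  - have [q /andP[q1 q2]] := ratr_between x0.
    apply/eqP; rewrite eq_le leH//= -(hneg q q2); apply: geH; exact: ltW.
have sG : survival G.
  split=> [x y xy|x|x|x x0].
  - by apply: leG => q yq; apply: geG; exact: le_lt_trans yq.
  - by have [t [q qq _]] := B0 x; apply: le_trans (geG _ _ qq).
  - by apply: leG.
  - have [q /andP[q1 q2]] := ratr_between x0.
    by apply/eqP; rewrite eq_le leG//= -(hneg q q2); apply: geG.
clearbody G H.
have HnH q : Hn (phi n) (ratr q) @[n --> \oo] --> H (ratr q) by rewrite Hq.
have lnphi := cvg_sub hphi lnl.
have TGH x : T l G x = T l H x.
  have [_ H0 _ _] := sHH; have [_ G0 _ _] := sG.
  have GH (a b : R) : b < 1 * a -> G a <= H b.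
    rewrite mul1r => ba; apply: leG => q aq; apply: geH.
    by apply/ltW/(lt_trans ba).
  have HG (a b : R) : b < 1 * a -> H a <= G b.
    rewrite mul1r => ba; apply: leH => q aq; apply: geG.
    exact: lt_le_trans aq.
  have e1 := glue_op_ext m mz z0 x l0 ltr01 G0 GH.
  have e2 := glue_op_ext m mz z0 x l0 ltr01 H0 HG.
  move: e1 e2; rewrite (mul1r x) => e1 e2.
  by apply/eqP; rewrite eq_le; apply/andP; split; [exact: e1|exact: e2].
have low q : (\forall n \near \oo, Hn n (ratr q) = T (ln n) (Hn n) (ratr q)) ->
    T l H (ratr q) <= h q.
  move=> /(near_sub hphi) fixq; apply/ler_addgt0Pr => e e0; rewrite -lerBlDr.
  apply: cvgr_to_ge (hcvg q) _.
  have k := @glue_op_liminf (ln \o phi) (Hn \o phi) l H lnphi HnH (ratr q) e e0.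
  near=> n; have -> : Hn (phi n) (ratr q) = T (ln (phi n)) (Hn (phi n)) (ratr q).
    by near: n; exact: fixq.
  by apply: ltW; near: n; exact: k.
have up x q : (\forall n \near \oo, Hn n (ratr q) = T (ln n) (Hn n) (ratr q)) ->
    x < ratr q -> h q <= T l H x.
  move=> /(near_sub hphi) fixq xq.
  apply: le_trans (glue_op_ge_below m mz z0 l0 sHH xq).
  apply/ler_addgt0Pr => e e0.
  apply: cvgr_to_le (hcvg q) _.
  have k := @below_liminf (ln \o phi) (Hn \o phi) l H lnphi HnH (ratr q) e e0.
  near=> n; have -> : Hn (phi n) (ratr q) = T (ln (phi n)) (Hn (phi n)) (ratr q).
    by near: n; exact: fixq.
  apply: (le_trans (glue_op_le_below m mz z0 (ratr q) (ln0 (phi n)) (sH (phi n)))).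
  have : pr glue_prob (below H l (ratr q)) - e < pr glue_prob (below (Hn (phi n)) (ln (phi n)) (ratr q)).
    by near: n; exact: k.
  set a := pr _ _; set b := pr _ _; clearbody a b; lra.
have rG : rcont G.
  move=> x c cG; have [y [xy cy]] : exists y : rat, x < ratr y /\ c < h y.
    apply: contrapT => /forallNP k; move: cG; rewrite ltNge => /negP; apply.
    apply: leG => q xq; rewrite leNgt; apply/negP => cq; exact: (k q).
  have [q /andP[xq qy]] := ratr_between xy.
  by exists (ratr q) => //; apply: (lt_le_trans cy); exact: geG.
exists G; split => //.
- move=> x c xc; apply: leG => q xq; apply: cvgr_to_le (hcvg q) _.
  exact: near_sub hphi (xc _ xq).
- move=> x y c xy yc; have [q /andP[xq qy]] := ratr_between xy.
  apply: le_trans (geG _ _ xq); apply: cvgr_to_ge (hcvg q) _.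
  apply: filterS (near_sub hphi yc) => n h2; apply: (le_trans h2).
  by have [a _ _ _] := sH (phi n); apply: a; exact: ltW.
- move=> x e e0 fixx; rewrite TGH; apply/eqP; rewrite eq_le; apply/andP; split.
    apply: leG => q xq.
    have [|q' /andP[q1 q2]] := @ratr_between R x (Order.min (ratr q) (x + e)).
      by rewrite lt_min xq ltrDl.
    move: q2; rewrite lt_min => /andP[q2 q3].
    apply: (le_trans (ha q' q (ltW q2))); apply: up => //.
    by apply: fixx; rewrite q1 q3.
  rewrite leNgt; apply/negP => /(glue_op_rcont mz)[y xy].
  have [|q /andP[q1 q2]] := @ratr_between R x (Order.min y (x + e)).
    by rewrite lt_min xy ltrDl.
  move: q2; rewrite lt_min => /andP[q2 q3]; apply/negP; rewrite -leNgt.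
  apply: le_trans (geG x q q1).
  apply: (le_trans (glue_op_anti m mz l H (ltW q2))).
  by apply: low; apply: fixx; rewrite q1 q3.
Unshelve. all: by end_near. Qed.

End limit_of_survival.

(** * Fronts at the unstable mass *)

Section integral_bounds.
Context {R : realType} d (S : measurableType d) (m : probability S R).
Context (zeta : S -> R).
Hypothesis mz : measurable_fun setT zeta.
Hypothesis z0 : forall s, 0 < zeta s.
Local Notation T := (glue_op m zeta).

Lemma glue_op_ge_add H l x c (w : S -> \bar R) : 0 < l -> 0 <= c ->
  measurable_fun setT w -> (forall s, 0 <= w s)%E ->
  (forall s, c%:E + w s <= (sum_tail H (x / (l * zeta s)))%:E)%E ->
  (c%:E + \int[m]_s w s <= (T l H x)%:E)%E.
Proof.
move=> l0 c0 mw w0 h.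
have -> : (c%:E + \int[m]_s w s = \int[m]_s (c%:E + w s))%E.
  rewrite ge0_integralD// integral_cst//; congr (_ + _)%E.
  by rewrite -[LHS]mule1; congr (_ * _)%E; rewrite -(@probability_setT _ _ _ m).
apply: glue_op_ge_int => //; first exact: emeasurable_funD.
by move=> s; rewrite adde_ge0// lee_fin.
Qed.

Lemma glue_op_le_add H l x c (w : S -> \bar R) : 0 < l ->
  measurable_fun setT w -> (forall s, 0 <= w s)%E ->
  (forall s, (sum_tail H (x / (l * zeta s)))%:E + w s <= c%:E)%E ->
  ((T l H x)%:E + \int[m]_s w s <= c%:E)%E.
Proof.
move=> l0 mw w0 h; rewrite glue_opE//.
have st0 s : (0 <= (sum_tail H (x / (l * zeta s)))%:E)%E by rewrite lee_fin pr_ge0.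
have mst := measurable_sum_tail mz z0 H x l0.
rewrite -ge0_integralD//.
apply: (@le_trans _ _ (\int[m]_s c%:E)%E).
  apply: ge0_le_integral => //; first by move=> s _; rewrite adde_ge0.
  exact: emeasurable_funD.
rewrite integral_cst// [X in (X <= _)%E](_ : _ = c%:E)// -[RHS]mule1.
by congr (_ * _)%E; rewrite -(@probability_setT _ _ _ m).
Qed.

Let int_indic c A : 0 <= c -> measurable A ->
  (\int[m]_s (c * \1_A s)%:E = (c * pr m A)%:E)%E.
Proof.
move=> c0 mA; rewrite (eq_integral (fun s => c%:E * (\1_A s)%:E)%E); last by [].
rewrite ge0_integralZl//; last exact/measurable_EFinP.
by rewrite integral_indic// setIT EFinM -(prE m mA).
Qed.

Let m_indic c (A : set S) : measurable A -> measurable_fun setT (fun s => (c * \1_A s)%:E : \bar R).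
Proof. by move=> mA; apply/measurable_EFinP; apply: measurable_funM. Qed.

Lemma glue_op_ge_event H l x c e A : 0 < l -> measurable A -> 0 <= c -> 0 <= e ->
  (forall s, c <= sum_tail H (x / (l * zeta s))) ->
  (forall s, A s -> c + e <= sum_tail H (x / (l * zeta s))) ->
  c + e * pr m A <= T l H x.
Proof.
move=> l0 mA c0 e0 h1 h2; rewrite -lee_fin EFinD -int_indic//.
apply: glue_op_ge_add => //.
- exact: m_indic.
- by move=> s; rewrite lee_fin mulr_ge0.
- move=> s; rewrite -EFinD lee_fin indicE.
  case: (boolP (s \in A)); rewrite ?inE ?mulr1; first exact: h2.
  by rewrite mulr0 addr0.
Qed.

Lemma glue_op_le_event H l x c e A : 0 < l -> measurable A -> 0 <= e ->
  (forall s, sum_tail H (x / (l * zeta s)) <= c) ->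
  (forall s, A s -> sum_tail H (x / (l * zeta s)) <= c - e) ->
  T l H x <= c - e * pr m A.
Proof.
move=> l0 mA e0 h1 h2; rewrite lerBrDr -lee_fin EFinD -int_indic//.
apply: glue_op_le_add => //.
- exact: m_indic.
- by move=> s; rewrite lee_fin mulr_ge0.
- move=> s; rewrite -EFinD lee_fin indicE.
  case: (boolP (s \in A)); rewrite ?inE ?mulr1; first by rewrite -lerBrDr; exact: h2.
  by rewrite mulr0 addr0.
Qed.

End integral_bounds.

Section two_steps.
Context {R : realType} d (S : measurableType d) (m : probability S R).
Context (zeta : S -> R).
Hypothesis mz : measurable_fun setT zeta.
Hypothesis z0 : forall s, 0 < zeta s.

(** Iterating the hypothesis, [h x] dominates [q ^+ 2] times the average of [h]
    after two steps [x |-> x / zeta] of the walk; on the paths that end at or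
    below [x], where [h] is at least [h x], this leaves [q ^+ 2] times their
    probability. The sets [C n] discard the paths that leave [[x0, +oo[], a loss
    that vanishes as the starting point goes to infinity. The average of [h]
    enters through measurable minorants [w]. *)
Lemma two_step_bound (h : R -> R) (q x0 : R) : 0 < q -> 0 < x0 ->
  (forall x, 0 < x -> 0 < h x) -> (forall x y, 0 < x -> x <= y -> h y <= h x) ->
  (forall x (w : S -> \bar R), x0 <= x -> measurable_fun setT w ->
    (forall s, 0 <= w s)%E ->
    (forall s, x0 <= x / zeta s -> (w s <= (h (x / zeta s))%:E)%E) ->
    (forall s, x / zeta s < x0 -> w s = 0%E) ->
    (q%:E * \int[m]_s w s <= (h x)%:E)%E) ->
  q ^+ 2 * pr (m \x m)%E [set z | 1 <= zeta z.1 * zeta z.2] <= 1.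
Proof.
move=> q0 x00 h0 ha hw.
have mz1 : measurable_fun setT (fun z : S * S => zeta z.1).
  exact: (measurableT_comp mz measurable_fst).
have mz2 : measurable_fun setT (fun z : S * S => zeta z.2).
  exact: (measurableT_comp mz measurable_snd).
have mz12 : measurable_fun setT (fun z : S * S => zeta z.1 * zeta z.2).
  exact: measurable_funM.
pose X (n : nat) : R := x0 + n%:R.
have X0 n : 0 < X n by rewrite /X ltr_wpDr.
pose C n : set (S * S) := [set z | x0 * zeta z.1 <= X n] `&`
  [set z | x0 * (zeta z.1 * zeta z.2) <= X n] `&` [set z | 1 <= zeta z.1 * zeta z.2].
have mC n : measurable (C n).
  apply: measurableI; last exact: measurable_set_le.
  by apply: measurableI; apply: measurable_set_le => //; exact: measurable_funM.
have CE : \bigcup_n C n = [set z | 1 <= zeta z.1 * zeta z.2].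
  apply/seteqP; split=> z; first by move=> [n _ []].
  move=> z1; exists (Num.truncn (Order.max (x0 * zeta z.1) (x0 * (zeta z.1 * zeta z.2)))).+1 => //.
  have := truncnS_gt (Order.max (x0 * zeta z.1) (x0 * (zeta z.1 * zeta z.2))).
  rewrite gt_max => /andP[/ltW k1 /ltW k2].
  by split=> //; split=> /=; rewrite /X; apply: ler_wpDl => //; exact: ltW.
have ndC : {homo C : a b / (a <= b)%N >-> a `<=` b}.
  move=> a b ab z [[k1 k2] k3]; have XX : X a <= X b by rewrite lerD2l ler_nat.
  by split=> //; split; [exact: le_trans XX|exact: le_trans XX].
rewrite leNgt; apply/negP => big.
have [n hn] : exists n, 1 < q ^+ 2 * pr (m \x m)%E (C n).
  have := @pr_cvg_bigcup _ _ _ (m \x m)%E _ mC ndC; rewrite CE.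
  move=> /(cvgMl_tmp (a := q ^+ 2))/cvgr_gt/(_ _ big)[n _ hn].
  by exists n; exact: (hn n (leqnn n)).
pose x := X n.
have xx0 : x0 <= x by rewrite /x /X lerDl.
pose w s := (h x * pr m (xsection (C n) s))%:E : \bar R.
have mw : measurable_fun setT (fun s => q%:E * w s)%E.
  apply: measurable_funeM; rewrite /w.
  under eq_fun do rewrite EFinM.
  apply: measurable_funeM; have := measurable_fun_xsection m (mC n).
  apply: eq_measurable_fun => s _ /=; rewrite prE//; exact: measurable_xsection.
have pos s : 0 < zeta s by exact: z0.
have := hw x (fun s => q%:E * w s)%E xx0 mw.
have -> : (q%:E * \int[m]_s (q%:E * w s) = (q ^+ 2 * pr (m \x m)%E (C n) * h x)%:E)%E.
  have mw' : measurable_fun setT (fun s => (pr m (xsection (C n) s))%:E).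
    have := measurable_fun_xsection m (mC n).
    apply: eq_measurable_fun => s _ /=; rewrite prE//; exact: measurable_xsection.
  have -> : (\int[m]_s (q%:E * w s) = (q * h x)%:E * \int[m]_s (pr m (xsection (C n) s))%:E)%E.
    rewrite -ge0_integralZl//.
    - by apply: eq_integral => s _; rewrite /w -!EFinM mulrA.
    - by move=> s _; rewrite lee_fin pr_ge0.
    - by rewrite lee_fin mulr_ge0 ?ltW ?h0// (lt_le_trans x00).
  have -> : (\int[m]_s (pr m (xsection (C n) s))%:E = (pr (m \x m)%E (C n))%:E)%E.
    rewrite -(prE (m \x m)%E (mC n)); apply: eq_integral => s _ /=.
    by rewrite -prE//; exact: measurable_xsection.
  by rewrite -!EFinM; congr EFin; ring.
have hx : 0 < h x by rewrite h0// (lt_le_trans x00).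
have wE s : (q%:E * w s = (q * (h x * pr m (xsection (C n) s)))%:E)%E by rewrite /w -EFinM.
move=> k; have {k} : ((q ^+ 2 * pr (m \x m)%E (C n) * h x)%:E <= (h x)%:E)%E.
  apply: k => s.
  - by rewrite wE lee_fin; apply: mulr_ge0; [exact: ltW|apply: mulr_ge0; [exact: ltW|exact: pr_ge0]].
  - move=> xs.
    have -> : (q%:E * w s = q%:E * \int[m]_t (h x * \1_(xsection (C n) s) t)%:E)%E.
      congr (_ * _)%E; rewrite (eq_integral (fun t => (h x)%:E * (\1_(xsection (C n) s) t)%:E)%E); last by [].
      have mxs : measurable (xsection (C n) s) by exact: measurable_xsection.
      rewrite ge0_integralZl//; [|exact/measurable_EFinP|by rewrite lee_fin ltW].
      by rewrite integral_indic// setIT /w EFinM -prE.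
    apply: hw => //.
    + apply/measurable_EFinP; apply: measurable_funM => //.
      apply: measurable_indic; exact: measurable_xsection.
    + by move=> t; rewrite lee_fin; apply: mulr_ge0; [exact: ltW|rewrite indicE].
    + move=> t xst; rewrite lee_fin indicE; case: (boolP (t \in _)).
        rewrite /xsection inE /= inE => -[[k1 k2] /= k3]; rewrite mulr1.
        apply: ha; first by rewrite !divr_gt0// (lt_le_trans x00).
        by rewrite -mulrA -invfM ler_pdivrMr ?mulr_gt0// ler_peMr// (le_trans _ xx0)// ltW.
      by rewrite mulr0 ltW// h0// !divr_gt0// (lt_le_trans x00).
    + move=> t xst; rewrite indicE; case: (boolP (t \in _)); last by rewrite mulr0.
      rewrite /xsection inE /= inE => -[[k1 k2] /= k3]; move: xst.
      by rewrite -mulrA -invfM ltr_pdivrMr ?mulr_gt0// ltNge k2.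
  - move=> xs; rewrite wE (_ : xsection (C n) s = set0) ?pr_set0 ?mulr0//.
    apply/seteqP; split=> // t; rewrite /xsection /= inE => -[[/= k1 _] _].
    by move: xs; rewrite ltr_pdivrMr// ltNge k1.
rewrite lee_fin -[X in _ <= X]mul1r ler_pM2r//.
by rewrite leNgt hn.
Qed.

End two_steps.

Section unstable_mass.
Context {R : realType}.
Implicit Types t p : R.

Lemma golden_bounds t : 0 <= t -> t ^+ 2 + t = 1 -> 617 / 1000 < t < 619 / 1000.
Proof. by move=> t0 h; apply/andP; split; nra. Qed.

Lemma gmap_ge_above t p : 0 <= t -> t ^+ 2 + t = 1 -> t <= p -> p <= 1 ->
  p <= gmap p.
Proof.
move=> t0 h tp p1; rewrite -subr_ge0.
have -> : gmap p - p = p * ((1 - p) * (p ^+ 2 + p - 1)) by rewrite /gmap; ring.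
by rewrite mulr_ge0 ?mulr_ge0//; nra.
Qed.

(** The slope of [gmap] at its unstable fixed point is [4 - 4 * t > 3 / 2]. All
    that matters about [29 / 20] is that it is smaller than this slope, which
    leaves room for the nonlinear terms, and that its square exceeds [2]. *)
Lemma gmap_slope_above t p : 0 <= t -> t ^+ 2 + t = 1 -> t <= p ->
  p <= t + 1 / 50 -> t + 29 / 20 * (p - t) <= gmap p.
Proof.
move=> t0 h tp pt; have /andP[t1 t2] := golden_bounds t0 h.
pose k := p - t; have -> : p = t + k by rewrite /k; ring.
have k0 : 0 <= k by rewrite /k; lra.
have k1 : k <= 1 / 50 by rewrite /k; lra.
have -> : gmap (t + k) = t + k * (4 - 4 * t - (4 - 6 * t) * k - 4 * t * k ^+ 2 - k ^+ 3)
    - (t ^+ 2 + t - 1) * (t ^+ 2 - t + 4 * k * (t - 1) + 6 * k ^+ 2).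
  by rewrite /gmap; ring.
rewrite h subrr mul0r subr0 lerD2l (_ : t + k - t = k); last by ring.
rewrite mulrC ler_wpM2l//.
have k2 : k ^+ 2 <= 1 / 2500 by nra.
have k3 : k ^+ 3 <= 1 / 2500 by rewrite exprS; nra.
nra.
Qed.

(** Since [4 * t ^+ 2 = 4 - 4 * t], the bound of [sum_tail_le_atom] has at [t]
    the same slope as [gmap]. *)
Lemma atom_bound t p : t ^+ 2 + t = 1 ->
  1 - (1 - t ^+ 2) * (1 + t ^+ 2 - 2 * p ^+ 2) =
  t - (t - p) * (4 * t ^+ 2 - 2 * t * (t - p)).
Proof.
move=> h; rewrite [RHS](_ : _ = 1 - (1 - t ^+ 2) * (1 + t ^+ 2 - 2 * p ^+ 2) -
  (t ^+ 2 + t - 1) * (t - 1 + 1 + t ^+ 2 - 2 * p ^+ 2)); last by ring.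
by rewrite h subrr mul0r subr0.
Qed.

End unstable_mass.

Section monostable_fronts.
Context {R : realType} d (S : measurableType d) (m : probability S R).
Context (zeta : S -> R).
Hypothesis mz : measurable_fun setT zeta.
Hypothesis z0 : forall s, 0 < zeta s.
Hypothesis z_small : forall e, 0 < e -> 0 < pr m [set s | zeta s < e].
Hypothesis z_large : forall e, 0 < pr m [set s | e < zeta s].
Local Notation T := (glue_op m zeta).
Variables (l t : R).
Hypothesis l0 : 0 < l.
Hypothesis t0 : 0 <= t.
Hypothesis tE : t ^+ 2 + t = 1.

(** Near infinity [G - t] dominates [29 / 20] times its average over one step of
    the walk with steps [l * zeta], because [gmap] expands at [t]; so
    [two_step_bound] applies. The front enters only through the positivity of
    [G - t], which spreads from [x1] to all scales. *)
Lemma upper_front G x1 : survival G -> rcont G -> (forall x, t <= G x) ->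
  0 < x1 -> t < G x1 -> (forall e, 0 < e -> exists x, G x <= t + e) ->
  (forall x, 1 < x -> G x = T l G x) ->
  (29 / 20) ^+ 2 * pr (m \x m)%E [set z | 1 <= (l * zeta z.1) * (l * zeta z.2)] <= 1.
Proof.
move=> sG rG tG x10 tx1 Gt fixG; have [Ga G0 G1 Gn] := sG.
have st_ge y : G y <= sum_tail G y.
  apply: le_trans (sum_tail_ge_rcont y sG rG); exact: gmap_ge_above t0 tE (tG y) (G1 y).
have mlz : measurable_fun setT (fun s => l * zeta s) by exact: measurable_funM.
have lz0 s : 0 < l * zeta s by rewrite mulr_gt0.
have posG x : t < G x.
  apply: (@lt_le_trans _ _ (G (Order.max x 2))); last by rewrite Ga// le_max lexx.
  set y := Order.max x 2; have y1 : 1 < y by rewrite lt_max ltr1n orbT.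
  rewrite fixG//; pose A := [set s | y / x1 / l < zeta s].
  have mA : measurable A by exact: measurable_set_lt.
  apply: (@lt_le_trans _ _ (t + (G x1 - t) * pr m A)).
    by rewrite ltrDl mulr_gt0// ?subr_gt0// z_large.
  apply: glue_op_ge_event => //; first by rewrite subr_ge0 ltW.
    by move=> s; exact: le_trans (tG _) (st_ge _).
  move=> s As; rewrite addrC subrK; apply: le_trans (st_ge _); apply: Ga.
  rewrite ler_pdivrMr// mulrC -ler_pdivrMr//.
  by move: As; rewrite /A /= ltr_pdivrMr// (mulrC (zeta s)) => /ltW.
have [x2 Gx2] := Gt (1 / 50) ltac:(by rewrite divr_gt0).
pose x0 := Order.max x2 2.
have x01 : 1 < x0 by rewrite lt_max ltr1n orbT.
apply: (@two_step_bound _ _ _ m _ mlz lz0 (fun x => G x - t) (29 / 20) x0) => //.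
- by rewrite (lt_trans _ x01).
- by move=> x _; rewrite subr_gt0.
- by move=> x y _ xy; rewrite lerD2r Ga.
move=> x w xx0 mw w0 w1 w2.
rewrite EFinB leeBrDl//.
have -> : ((29 / 20)%:E * \int[m]_s w s = \int[m]_s ((29 / 20)%:E * w s))%E.
  by rewrite ge0_integralZl// lee_fin.
rewrite fixG; last exact: lt_le_trans xx0.
apply: glue_op_ge_add => //.
- exact: measurable_funeM.
- by move=> s; rewrite mule_ge0// lee_fin.
move=> s; have [k|k] := leP x0 (x / (l * zeta s)); last first.
  by rewrite w2// mule0 adde0 lee_fin; exact: le_trans (tG _) (st_ge _).
apply: (@le_trans _ _ (t%:E + (29 / 20)%:E * (G (x / (l * zeta s)) - t)%:E)%E).
  by rewrite leeD2l// lee_wpmul2l ?lee_fin// w1.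
rewrite -EFinM -EFinD lee_fin; apply: le_trans (sum_tail_ge_rcont _ sG rG).
apply: gmap_slope_above => //; apply: le_trans Gx2; apply: Ga.
by apply: le_trans k; rewrite le_max lexx.
Qed.

(** The mirror image of [upper_front], for [t - G] near the origin. The variable
    [x^-1] brings the origin to infinity, whence the inverse steps. A lower bound
    on [t - G] needs an upper bound on the sum, and that of [sum_tail_le] loses
    a factor [2] in the argument; [sum_tail_le_atom] uses instead that there is
    an atom at the origin. *)
Lemma lower_front G x1 : survival G -> (forall x, 0 < x -> G x <= t) ->
  0 < x1 -> G x1 < t -> (forall e, 0 < e -> exists2 x, 0 < x & t - e <= G x) ->
  (forall x, 0 < x < 1 -> G x = T l G x) ->
  (29 / 20) ^+ 2 * pr (m \x m)%E
    [set z | 1 <= (l * zeta z.1)^-1 * (l * zeta z.2)^-1] <= 1.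
Proof.
move=> sG Gt x10 tx1 tG fixG; have [Ga G0 G1 Gn] := sG.
have /andP[t1 t2] := golden_bounds t0 tE.
have t01 : 0 <= t <= 1 by lra.
have lz0 s : 0 < l * zeta s by rewrite mulr_gt0.
have st_le y : 0 < y ->
    sum_tail G y <= t - (t - G y) * (4 * t ^+ 2 - 2 * t * (t - G y)).
  by move=> y0; rewrite -atom_bound//; exact: sum_tail_le_atom.
have slope k : 0 <= k <= t -> 0 <= 4 * t ^+ 2 - 2 * t * k by move=> /andP[k0 k1]; nra.
have Gt' y : 0 < y -> 0 <= t - G y <= t.
  by move=> y0; have := Gt y y0; have := G0 y; lra.
have st_t y : 0 < y -> sum_tail G y <= t.
  move=> y0; apply: le_trans (st_le y y0) _; rewrite gerBl mulr_ge0 ?slope ?Gt'//.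
  by have /andP[] := Gt' y y0.
have milz : measurable_fun setT (fun s => (l * zeta s)^-1).
  by apply: measurable_invf => //; exact: measurable_funM.
have ilz0 s : 0 < (l * zeta s)^-1 by rewrite invr_gt0.
have posG x : 0 < x -> G x < t.
  move=> x0; apply: (@le_lt_trans _ _ (G (Order.min x (1/2)))).
    by rewrite Ga// ge_min lexx.
  set y := Order.min x (1/2).
  have y0 : 0 < y by rewrite lt_min x0 divr_gt0.
  have y1 : y < 1 by rewrite gt_min; apply/orP; right; lra.
  rewrite fixG ?y0//; pose A := [set s | zeta s < y / x1 / l].
  have mA : measurable A by exact: measurable_set_lt.
  pose e := (t - G x1) * (4 * t ^+ 2 - 2 * t * (t - G x1)).
  have e0 : 0 < e.
    by rewrite mulr_gt0 ?subr_gt0//; have := Gt' x1 x10; have := G0 x1; nra.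
  apply: (@le_lt_trans _ _ (t - e * pr m A)); last first.
    by rewrite gtrBl mulr_gt0// z_small// !divr_gt0.
  apply: glue_op_le_event => //; first exact: ltW.
    by move=> s; apply: st_t; rewrite divr_gt0.
  move=> s As; set yz := y / _.
  have yz1 : x1 <= yz.
    rewrite /yz ler_pdivlMr// mulrC -ler_pdivlMr//.
    by move: As; rewrite /A /= ltr_pdivlMr// (mulrC (zeta s)) => /ltW.
  have yz0 : 0 < yz by exact: lt_le_trans yz1.
  apply: le_trans (st_le _ yz0) _; rewrite lerD2l lerN2 /e.
  have := Ga _ _ yz1; have := G0 yz; have := Gt' x1 x10.
  set a := G x1; set b := G yz; clearbody a b.
  move=> /andP[h1 h2] h3 h4.
  have : 0 <= (a - b) * (4 * t ^+ 2 - 2 * t * (2 * t - a - b)) by rewrite mulr_ge0//; nra.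
  have -> : (a - b) * (4 * t ^+ 2 - 2 * t * (2 * t - a - b)) =
    (t - b) * (4 * t ^+ 2 - 2 * t * (t - b)) - (t - a) * (4 * t ^+ 2 - 2 * t * (t - a)) by ring.
  by rewrite subr_ge0.
have [x2 x20 Gx2] := tG (1 / 50) ltac:(by rewrite divr_gt0).
pose x0 := Order.max (x2^-1) 2.
have x01 : 1 < x0 by rewrite lt_max ltr1n orbT.
have x00 : 0 < x0 by exact: lt_trans x01.
apply: (@two_step_bound _ _ _ m _ milz ilz0 (fun x => t - G x^-1) (29 / 20) x0) => //.
- by move=> x xp; rewrite subr_gt0 posG// invr_gt0.
- by move=> x y xp xy; rewrite lerD2l lerN2 Ga// lef_pV2// posrE// (lt_le_trans xp).
move=> x w xx0 mw w0 w1 w2; have xp : 0 < x by exact: lt_le_trans xx0.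
rewrite EFinB leeBrDl//.
have -> : ((29 / 20)%:E * \int[m]_s w s = \int[m]_s ((29 / 20)%:E * w s))%E.
  by rewrite ge0_integralZl// lee_fin.
rewrite fixG; last first.
  by rewrite invr_gt0 xp invf_lt1//; exact: lt_le_trans xx0.
apply: glue_op_le_add => //.
- exact: measurable_funeM.
- by move=> s; rewrite mule_ge0// lee_fin.
move=> s; have yE : (x / (l * zeta s)^-1)^-1 = x^-1 / (l * zeta s) by rewrite invfM invrK.
have y0 : 0 < x^-1 / (l * zeta s) by rewrite divr_gt0// invr_gt0.
have [k|k] := leP x0 (x / (l * zeta s)^-1); last first.
  by rewrite w2// mule0 adde0 lee_fin st_t.
have kk := w1 s k; rewrite yE in kk.
apply: (@le_trans _ _ ((sum_tail G (x^-1 / (l * zeta s)))%:E +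
   (29 / 20)%:E * (t - G (x^-1 / (l * zeta s)))%:E)%E).
  by rewrite leeD2l// lee_wpmul2l ?lee_fin.
have yx2 : x^-1 / (l * zeta s) <= x2.
  rewrite -yE -[x2]invrK lef_pV2 ?posrE ?invr_gt0 ?divr_gt0//.
  by apply: le_trans k; rewrite le_max lexx.
rewrite -EFinM -EFinD lee_fin.
have := st_le _ y0; have := Ga _ _ yx2; have := Gt' _ y0.
set a := G _; set b := sum_tail _ _; clearbody a b; move=> /andP[h1 h2] h3 h4.
have h5 : t - a <= 1 / 50 by lra.
have : 29 / 20 * (t - a) <= (t - a) * (4 * t ^+ 2 - 2 * t * (t - a)).
  by rewrite mulrC ler_wpM2l//; nra.
lra.
Qed.

End monostable_fronts.

(** * Stationary laws in windows *)

Opaque glue_op sum_tail pr.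

(** The pointwise supremum of the post-fixed points between [lo] and [hi]. *)
Lemma tarski_between (R : realType) (Phi : (R -> R) -> R -> R) (lo hi : R -> R) :
  (forall x, lo x <= hi x) ->
  (forall J J', (forall x, lo x <= J x) -> (forall x, J x <= J' x) ->
    (forall x, J' x <= hi x) -> forall x, Phi J x <= Phi J' x) ->
  (forall x, lo x <= Phi lo x) -> (forall x, Phi hi x <= hi x) ->
  exists H, [/\ forall x, lo x <= H x, forall x, H x <= hi x,
    forall x, H x = Phi H x &
    forall J, (forall x, lo x <= J x) -> (forall x, J x <= hi x) ->
      (forall x, J x <= Phi J x) -> forall x, J x <= H x].
Proof.
move=> lohi mono loP hiP.
pose post J := [/\ forall x, lo x <= J x, forall x, J x <= hi x &
  forall x, J x <= Phi J x].
have post_lo : post lo by split.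
pose H x := sup [set J x | J in post].
have JH J : post J -> forall x, J x <= H x.
  move=> pJ x; apply: ub_le_sup; last by exists J.
  by exists (hi x) => _ [K [_ K2 _] <-].
have Hle x c : (forall J, post J -> J x <= c) -> H x <= c.
  by move=> h; apply: ge_sup => [|_ [J pJ <-]]; [exists (lo x), lo|exact: h].
have loH x : lo x <= H x by exact: JH.
have Hhi x : H x <= hi x by apply: Hle => J [_ ].
have HP x : H x <= Phi H x.
  apply: Hle => J pJ; have [J1 J2 J3] := pJ; apply: (le_trans (J3 x)).
  by apply: mono => // y; exact: JH.
have pPH : post (Phi H).
  have a x : lo x <= Phi H x by apply: (le_trans (loP x)); exact: mono.
  have b x : Phi H x <= hi x by apply: le_trans (hiP x); exact: mono.
  by split=> // x; exact: mono.
exists H; split=> // [x|J J1 J2 J3 x]; last exact: JH.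
by apply/eqP; rewrite eq_le HP (JH _ pPH).
Qed.

Section windows.
Context {R : realType} d (S : measurableType d) (m : probability S R).
Context (zeta : S -> R).
Hypothesis mz : measurable_fun setT zeta.
Hypothesis z0 : forall s, 0 < zeta s.
Local Notation T := (glue_op m zeta).

Lemma glue_op_neg l H x : 0 < l -> survival H -> x < 0 -> T l H x = 1.
Proof.
move=> l0 sH x0; apply/eqP; rewrite eq_le (glue_op_le1 m mz).
have sH' := sH; have [_ _ _ Hn] := sH.
have key s : 1 <= sum_tail H (x / (l * zeta s)).
  have -> : 1 = gmap 1 :> R by rewrite /gmap; ring.
  have : x / (l * zeta s) < 0 by rewrite pmulr_llt0// invr_gt0 mulr_gt0.
  set t := x / _; clearbody t => tn.
  by apply: (@sum_tail_ge _ _ _ (t / 2)) => //; [lra|rewrite Hn//; lra].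
have -> : 1 = 1 + 0 * pr m setT by rewrite mul0r addr0.
by apply: glue_op_ge_event => // s *; rewrite ?addr0.
Qed.

(** The masses that would leave the window [[al, be[] are moved to its ends. *)
Definition window_op (al be l : R) (H : R -> R) (x : R) : R :=
  if x < al then 1 else if x < be then T l H x else 0.

Definition window_fixed al be l H := forall x, H x = window_op al be l H x.

Lemma window_survival al be l H : 0 < al -> window_fixed al be l H -> survival H.
Proof.
move=> al0 fH.
have h0 x : 0 <= H x by rewrite fH /window_op; case: ifP => // _; case: ifP => // _; exact: glue_op_ge0.
have h1 x : H x <= 1 by rewrite fH /window_op; case: ifP => // _; case: ifP => // _; exact: (glue_op_le1 m mz).
split=> // [x y xy|x x0]; last by rewrite fH /window_op (lt_trans x0 al0).
rewrite fH [H x]fH /window_op; case: (ltP x al) => xa.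
  by case: ifP => // _; case: ifP => // _; exact: (glue_op_le1 m mz).
rewrite ltNge (le_trans xa xy) /=.
case: (ltP x be) => xb; last by rewrite ltNge (le_trans xb xy).
by case: ifP => _; [exact: (glue_op_anti m mz)|exact: glue_op_ge0].
Qed.

Lemma window_exists al be l : 0 < al -> al <= be -> 0 < l ->
  exists H, window_fixed al be l H /\
    forall J, (forall x, x < al -> J x = 1) -> (forall x, 0 <= J x) ->
      (forall x, J x <= 1) -> (forall x, be <= x -> J x = 0) ->
      (forall x, J x <= window_op al be l J x) -> forall x, J x <= H x.
Proof.
move=> al0 ab l0.
pose lo x : R := if x < al then 1 else 0.
pose hi x : R := if x < be then 1 else 0.
have lo0 x : 0 <= lo x by rewrite /lo; case: ifP.
have lohi x : lo x <= hi x.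
  by rewrite /lo /hi; case: (ltP x al) => xa; [rewrite (lt_le_trans xa ab)|case: ifP].
have mono J J' : (forall x, lo x <= J x) -> (forall x, J x <= J' x) ->
    (forall x, J' x <= hi x) -> forall x, window_op al be l J x <= window_op al be l J' x.
  move=> loJ JJ _ x; rewrite /window_op.
  case: (x < al); first exact: lexx.
  case: (x < be); last exact: lexx.
  by apply: (glue_op_le m mz) => // y; exact: (le_trans (lo0 y) (loJ y)).
have [] := @tarski_between _ (window_op al be l) lo hi lohi mono.
- move=> x; rewrite /lo /window_op; case: ifP => // _.
  by case: ifP => // _; exact: glue_op_ge0.
- move=> x; rewrite /hi /window_op; case: (ltP x al) => xa.
    by rewrite (lt_le_trans xa ab).
  by case: ifP => // _; exact: (glue_op_le1 m mz).
move=> H [H1 H2 H3 H4]; exists H; split=> // J J1 J0 JM J2 J3; apply: H4 => // x.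
  by rewrite /lo; case: ifP => [xa|//]; rewrite J1.
by rewrite /hi; case: (ltP x be) => // xb; rewrite J2.
Qed.

Lemma window_quantile al be l H c : 0 < al -> al <= be ->
  window_fixed al be l H -> 0 < c <= 1 ->
  exists z, [/\ al <= z, z <= be, forall x, x < z -> c <= H x &
    forall x, z < x -> H x < c].
Proof.
move=> al0 ab fH /andP[c0 c1].
have [Ha H0 H1 Hn] := window_survival al0 fH.
pose Z := [set x | c <= H x].
have Zal x : x < al -> Z x by move=> xa; rewrite /Z /= fH /window_op xa.
have Zbe x : Z x -> x < be.
  rewrite /Z /= fH /window_op => h; rewrite ltNge; apply/negP => bx.
  by move: h; rewrite !ltNge (le_trans ab bx) bx /= leNgt c0.
have Z0 : Z !=set0 by exists 0; exact: Zal.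
have Zb : has_ubound Z by exists be => x /Zbe/ltW.
exists (sup Z); split.
- rewrite leNgt; apply/negP => sa; have [x xs xa] : exists2 x, sup Z < x & x < al.
    by exists ((sup Z + al) / 2); lra.
  by have := ub_le_sup Zb (Zal x xa); rewrite leNgt xs.
- by apply: ge_sup => // x /Zbe/ltW.
- move=> x xz; have [y Zy xy] := @sup_gt _ Z x Z0 xz.
  by apply: (le_trans Zy); apply/Ha/ltW.
- move=> x zx; rewrite ltNge; apply/negP => cx.
  by have := ub_le_sup Zb (cx : Z x); rewrite leNgt zx.
Qed.

(** As [x] tends to infinity in the equation, the arguments of the tails on the
    right tend to infinity as well; so the limit is a fixed point of [gmap]. *)
Lemma mass_at_infty l G : 0 < l -> survival G ->
  (forall x, 1 < x -> G x = T l G x) ->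
  exists t, [/\ forall x, t <= G x, forall e, 0 < e -> exists x, G x <= t + e &
    gmap t = t].
Proof.
move=> l0 sG fixG; have [Ga G0 G1 Gn] := sG.
pose t := inf (range G).
have hlb : has_lbound (range G) by exists 0 => _ [x _ <-].
have ne : range G !=set0 by exists (G 0), 0.
have tG x : t <= G x by apply: ge_inf => //; exists x.
have Gt e : 0 < e -> exists x, G x < t + e.
  move=> e0; have [_ [x _ <-] h] := @inf_lt _ (range G) (t + e) ne ltac:(by rewrite ltrDl).
  by exists x.
have t0 : 0 <= t by apply: lb_le_inf => // _ [x _ <-].
have t1 : t <= 1 by exact: le_trans (tG 0) (G1 0).
have gt : gmap t <= t.
  apply: lb_le_inf => // _ [x _ <-].
  apply: le_trans (Ga x (Order.max x 2) _); last by rewrite le_max lexx.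
  rewrite fixG; last by rewrite lt_max ltr1n orbT.
  have -> : gmap t = gmap t + 0 * pr m setT by rewrite mul0r addr0.
  have st y : gmap t <= sum_tail G y.
    by apply: (@sum_tail_ge _ _ _ (y + 1)) => //; rewrite ltrDl.
  by apply: glue_op_ge_event => // [|s _]; rewrite ?addr0// gmap_ge0// t0.
exists t; split=> // [e /Gt[x /ltW]|]; first by exists x.
apply/eqP; rewrite eq_le gt /=; apply/ler_addgt0Pr => e e0.
pose f := Order.min (e / 8) 1.
have f0 : 0 < f by rewrite lt_min ltr01 andbT divr_gt0.
have fe : f <= e / 8 by rewrite ge_min lexx.
have f1 : f <= 1 by rewrite ge_min lexx orbT.
have [y0 Gy0] := Gt f f0; pose y := Order.max y0 1.
have Gy : G y <= t + f by apply: le_trans (ltW Gy0); rewrite Ga// le_max lexx.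
have y1 : 1 <= y by rewrite le_max lexx orbT.
pose A (n : nat) := [set s | l * zeta s < n.+1%:R].
have mA n : measurable (A n).
  by apply: measurable_set_lt => //; exact: measurable_funM.
have [n hn] : exists n, 1 - f < pr m (A n).
  have UA : \bigcup_n A n = setT.
    by apply/seteqP; split=> // s _; exists (Num.truncn (l * zeta s)) => //; exact: truncnS_gt.
  have ndA : {homo A : a b / (a <= b)%N >-> a `<=` b}.
    by move=> a b ab s /= h; apply: (lt_le_trans h); rewrite ler_nat.
  have := @pr_cvg_bigcup _ _ _ m A mA ndA; rewrite UA pr_setT.
  by move=> /cvgr_gt/(_ (1 - f) ltac:(by rewrite gtrBl))[n _ h]; exists n; exact: (h n (leqnn n)).
pose x := 2 * y * n.+1%:R.
have x1 : 1 < x.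
  have : 1 <= n.+1%:R :> R by rewrite ler1n.
  by rewrite /x; nra.
apply: (le_trans (tG x)); rewrite fixG//.
have g1 : gmap (G y) <= 1.
  by rewrite /gmap gerBl sqr_ge0.
have gy0 : 0 <= gmap (G y) by rewrite gmap_ge0// G0 G1.
apply: (@le_trans _ _ (1 - (1 - gmap (G y)) * pr m (A n))).
  apply: glue_op_le_event => //; first by rewrite subr_ge0.
    by move=> s; exact: (pr_le1 _ (measurable_above2 _ _)).
  move=> s As; have -> : 1 - (1 - gmap (G y)) = gmap (G y) by ring.
  apply: le_trans (sum_tail_le _ sG) _; apply: gmap_le => //; apply: Ga.
  rewrite ler_pdivlMr// ler_pdivlMr ?mulr_gt0// /x (mulrC y 2).
  apply: ler_wpM2l; last exact: ltW As.
  by rewrite mulr_ge0// (le_trans _ y1).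
have g2 := gmap_lip t0 (tG y) (G1 y).
set a := pr m (A n) in hn *; have a1 : a <= 1 by exact: (pr_le1 _ (mA n)).
set g := gmap (G y) in g1 gy0 g2 *; set g' := gmap t in g2 *.
have : (1 - g) * (1 - a) <= f by nra.
by lra.
Qed.

(** The same argument at the origin. *)
Lemma mass_at_zero l G : 0 < l -> survival G ->
  (forall x, 0 < x < 1 -> G x = T l G x) ->
  exists t, [/\ forall x, 0 < x -> G x <= t,
    forall e, 0 < e -> exists2 x, 0 < x & t - e <= G x & gmap t = t].
Proof.
move=> l0 sG fixG; have [Ga G0 G1 Gn] := sG.
pose V := [set G x | x in [set x | 0 < x]].
pose t := sup V.
have hub : has_ubound V by exists 1 => _ [x _ <-].
have ne : V !=set0 by exists (G 1), 1; rewrite //=.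
have Gt x : 0 < x -> G x <= t by move=> x0; apply: ub_le_sup => //; exists x.
have tG e : 0 < e -> exists2 x, 0 < x & t - e < G x.
  move=> e0; have [_ [x x0 <-] h] := @sup_gt _ V (t - e) ne ltac:(by rewrite gtrBl).
  by exists x.
have t0 : 0 <= t by exact: le_trans (G0 1) (Gt 1 ltr01).
have t1 : t <= 1 by apply: ge_sup => // _ [x _ <-].
have lz0 s : 0 < l * zeta s by rewrite mulr_gt0.
have gt : t <= gmap t.
  apply: ge_sup => // _ [x /= x0 <-].
  have y0 : 0 < Order.min x (1 / 2) by rewrite lt_min x0 divr_gt0.
  apply: (@le_trans _ _ (G (Order.min x (1 / 2)))); first by rewrite Ga// ge_min lexx.
  rewrite fixG; last by rewrite y0 gt_min; apply/orP; right; lra.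
  have -> : gmap t = gmap t - 0 * pr m setT by rewrite mul0r subr0.
  have st y : 0 < y -> sum_tail G y <= gmap t.
    move=> yp; apply: le_trans (sum_tail_le _ sG) _.
    by apply: gmap_le => //; apply: Gt; rewrite divr_gt0.
  by apply: glue_op_le_event => // s *; rewrite ?subr0; apply: st; rewrite divr_gt0.
exists t; split=> // [e /tG[x x0 /ltW]|]; first by exists x.
apply/eqP; rewrite eq_le gt andbT; apply/ler_addgt0Pr => e e0.
pose f := Order.min (e / 8) 1.
have f0 : 0 < f by rewrite lt_min ltr01 andbT divr_gt0.
have fe : f <= e / 8 by rewrite ge_min lexx.
have f1 : f <= 1 by rewrite ge_min lexx orbT.
have [y y0 /ltW Gy] := tG f f0.
pose A (n : nat) := [set s | 1 < l * zeta s * n.+1%:R].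
have mA n : measurable (A n).
  by apply: measurable_set_lt => //; apply: measurable_funM => //; exact: measurable_funM.
have [n hn] : exists n, 1 - f < pr m (A n).
  have UA : \bigcup_n A n = setT.
    apply/seteqP; split=> // s _; exists (Num.truncn (l * zeta s)^-1) => //.
    by rewrite /A /= mulrC -ltr_pdivrMr// mul1r truncnS_gt.
  have ndA : {homo A : a b / (a <= b)%N >-> a `<=` b}.
    by move=> a b ab s /= h; apply: (lt_le_trans h); rewrite ler_pM2l// ler_nat.
  have := @pr_cvg_bigcup _ _ _ m A mA ndA; rewrite UA pr_setT.
  by move=> /cvgr_gt/(_ (1 - f) ltac:(by rewrite gtrBl))[n _ h]; exists n; exact: (h n (leqnn n)).
pose x := Order.min (y / n.+1%:R) (1 / 2).
have x0 : 0 < x by rewrite lt_min !divr_gt0.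
have x1 : x < 1 by rewrite gt_min; apply/orP; right; lra.
have h : 0 + gmap (G y) * pr m (A n) <= G x.
  rewrite (fixG x) ?x0//; apply: glue_op_ge_event => //.
  - by rewrite gmap_ge0// G0 G1.
  - by move=> s; exact: pr_ge0.
  - move=> s As; rewrite add0r; apply: (@sum_tail_ge _ _ _ y) => //.
    rewrite ltr_pdivrMr//; apply: (@le_lt_trans _ _ (y / n.+1%:R)).
      by rewrite ge_min lexx.
    rewrite ltr_pdivrMr// -mulrA -[X in X < _]mulr1 ltr_pM2l//.
have h2 := Gt x x0.
have g2 := gmap_lip (G0 y) (Gt y y0) t1.
have g1 : gmap (G y) <= 1 by rewrite /gmap gerBl sqr_ge0.
have gy0 : 0 <= gmap (G y) by rewrite gmap_ge0// G0 G1.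
rewrite add0r in h.
set a := pr m (A n) in hn h *; have a1 : a <= 1 by exact: (pr_le1 _ (mA n)).
set g := gmap (G y) in g1 gy0 g2 h *; set g' := gmap t in g2 *.
have : g * (1 - a) <= f by nra.
by lra.
Qed.

End windows.

(** * The width of the front *)

Lemma bounded_subseq (R : realType) (u : nat -> R) (a b : R) :
  (forall n, a <= u n <= b) ->
  exists (phi : nat -> nat) (l : R), [/\ forall n, (n <= phi n)%N,
    u (phi n) @[n --> \oo] --> l & a <= l].
Proof.
move=> uab; have ab : a <= b by have /andP[] := uab 0%N; exact: le_trans.
have c0 : 0 < b - a + 1 by lra.
have [|phi [h [hphi hc]]] := @helly R (fun n _ => (u n - a) / (b - a + 1)).
  move=> n _; have /andP[h1 h2] := uab n.
  by rewrite divr_ge0 ?subr_ge0 ?(ltW c0)//= ler_pdivrMr// mul1r; lra.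
have hu : u (phi n) @[n --> \oo] --> h 0 * (b - a + 1) + a.
  have -> : (fun n => u (phi n)) =
      (fun n => (u (phi n) - a) / (b - a + 1) * (b - a + 1) + a).
    by apply/funext => n; rewrite divfK ?gt_eqF// subrK.
  by apply: cvgD; [exact: cvgMr_tmp|exact: cvg_cst].
exists phi, (h 0 * (b - a + 1) + a); split=> //.
by apply: cvgr_to_ge hu _; apply: nearW => n; have /andP[] := uab (phi n).
Qed.

Lemma near_gt_nat (R : realType) (c : R) : \forall n \near \oo, c < n%:R.
Proof.
exists (Num.truncn c).+1 => // n /= cn; apply: lt_le_trans (truncnS_gt c) _.
by rewrite ler_nat.
Qed.

Section front_width.
Context {R : realType} d (S : measurableType d) (m : probability S R).
Context (zeta : S -> R).
Hypothesis mz : measurable_fun setT zeta.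
Hypothesis z0 : forall s, 0 < zeta s.
Hypothesis z_small : forall e, 0 < e -> 0 < pr m [set s | zeta s < e].
Hypothesis z_large : forall e, 0 < pr m [set s | e < zeta s].
Local Notation T := (glue_op m zeta).
Local Notation window_fixed := (window_fixed m zeta).

Lemma survival_scale (c : R) H : 0 < c -> survival H -> survival (fun x => H (c * x)).
Proof.
move=> c0 [Ha H0 H1 Hn]; split=> // [x y xy|x x0]; first by rewrite Ha// ler_pM2l.
by rewrite Hn// pmulr_rlt0.
Qed.

Lemma window_scale al be l H z x : 0 < al -> 0 < l -> 0 < z ->
  window_fixed al be l H -> al <= z * x -> z * x < be ->
  H (z * x) = T l (fun x => H (z * x)) x.
Proof.
move=> al0 l0 zp fH h1 h2.
rewrite (glue_op_scale m mz z0)//; last exact: (window_survival mz al0 fH).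
by rewrite {1}fH /window_op ltNge h1 /= h2.
Qed.

(** The two events cover everything, and [(29 / 20) ^+ 2 > 2]. *)
Lemma no_two_drifts (l : R) : 0 < l ->
  (29 / 20) ^+ 2 * pr (m \x m)%E [set z | 1 <= (l * zeta z.1) * (l * zeta z.2)] <= 1 ->
  (29 / 20) ^+ 2 * pr (m \x m)%E
    [set z | 1 <= (l * zeta z.1)^-1 * (l * zeta z.2)^-1] <= 1 -> False.
Proof.
move=> l0.
have lz0 s : 0 < l * zeta s by rewrite mulr_gt0.
have mlz : measurable_fun setT (fun s => l * zeta s) by exact: measurable_funM.
have milz : measurable_fun setT (fun s => (l * zeta s)^-1) by exact: measurable_invf.
set E1 := [set z | _]; set E2 := [set z : S * S | 1 <= (_)^-1 * _].
have m1 : measurable E1.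
  apply: measurable_set_le => //; apply: measurable_funM.
    exact: (measurableT_comp mlz measurable_fst).
  exact: (measurableT_comp mlz measurable_snd).
have m2 : measurable E2.
  apply: measurable_set_le => //; apply: measurable_funM.
    exact: (measurableT_comp milz measurable_fst).
  exact: (measurableT_comp milz measurable_snd).
have cover : setT `<=` E1 `|` E2.
  move=> z _; rewrite /E1 /E2 /=; case: (leP 1 (l * zeta z.1 * (l * zeta z.2))) => h; first by left.
  by right; rewrite -invfM invf_ge1 ?mulr_gt0// ltW.
have h1 := @pr_le _ _ _ (m \x m)%E _ _ measurableT (measurableU _ _ m1 m2) cover.
have h2 := pr_setU (m \x m)%E m1 m2.
rewrite pr_setT in h1.
set a := pr _ E1 in h2 *; set b := pr _ E2 in h2 *.
by have := le_trans h1 h2; clearbody a b; lra.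
Qed.

(** Otherwise there are stationary tails that stay between [1 / 2] and [7 / 10],
    two values on both sides of the unstable mass, over arbitrarily long ranges of
    scales. Seen from the beginning of the range they converge to a front [A]
    that ends at the unstable mass, seen from its end to a front [B] that starts
    there, and [no_two_drifts] excludes that both exist. *)
Lemma front_width (lmin lmax : R) : 0 < lmin ->
  exists C, forall al be l H x y, 0 < al -> al <= be -> lmin <= l <= lmax ->
    window_fixed al be l H -> H x < 7 / 10 -> 1 / 2 < H y -> y <= C * x.
Proof.
move=> lm0; apply: contrapT => /forallNP noC.
have bad (n : nat) : exists D : (R * R * R) * (R -> R) * (R * R),
    let: (al, be, l, H, (z, w)) := D in
    [/\ 0 < al, lmin <= l <= lmax, window_fixed al be l H,
      [/\ al <= z, w <= be & n%:R * z < w] &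
      [/\ forall x, x < z -> 7 / 10 <= H x, forall x, z < x -> H x < 7 / 10,
        forall x, x < w -> 1 / 2 <= H x & forall x, w < x -> H x < 1 / 2]].
  have := noC n%:R; move=> /existsNP[al] /existsNP[be] /existsNP[l] /existsNP[H].
  move=> /existsNP[x] /existsNP[y] /not_implyP[al0 /not_implyP[ab]].
  move=> /not_implyP[ll /not_implyP[fH /not_implyP[Hx /not_implyP[Hy /negP]]]].
  rewrite -ltNge => xy.
  have [|z [z1 z2 z3 z4]] := window_quantile mz al0 ab fH (c := 7 / 10); first by lra.
  have [|w [w1 w2 w3 w4]] := window_quantile mz al0 ab fH (c := 1 / 2); first by lra.
  have zx : z <= x by rewrite leNgt; apply/negP => /z3; rewrite leNgt Hx.
  have yw : y <= w by rewrite leNgt; apply/negP => /w4; rewrite ltNge (ltW Hy).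
  exists (al, be, l, H, (z, w)); split=> //; split=> //.
  apply: (lt_le_trans _ yw); apply: le_lt_trans xy; exact: ler_wpM2l.
have [D hD] := choice bad.
pose al n := (D n).1.1.1.1; pose be n := (D n).1.1.1.2; pose ls n := (D n).1.1.2.
pose Hs n := (D n).1.2; pose zs n := (D n).2.1; pose ws n := (D n).2.2.
have hD' n : [/\ 0 < al n, lmin <= ls n <= lmax, window_fixed (al n) (be n) (ls n) (Hs n),
      [/\ al n <= zs n, ws n <= be n & n%:R * zs n < ws n] &
      [/\ forall x, x < zs n -> 7 / 10 <= Hs n x, forall x, zs n < x -> Hs n x < 7 / 10,
        forall x, x < ws n -> 1 / 2 <= Hs n x & forall x, ws n < x -> Hs n x < 1 / 2]].
  have := hD n; rewrite /al /be /ls /Hs /zs /ws.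
  by case: (D n) => [[[[? ?] ?] ?] [? ?]].
clearbody al be ls Hs zs ws; clear D hD bad noC.
have [|phi [l [hphi hl ll]]] := @bounded_subseq _ ls lmin lmax.
  by move=> n; have [] := hD' n.
have l0 : 0 < l by exact: lt_le_trans ll.
have ls0 n : 0 < ls (phi n) by have [_ /andP[h _] _ _ _] := hD' (phi n); exact: lt_le_trans h.
have al0 n : 0 < al n by have [] := hD' n.
have zp n : 0 < zs n by have [h _ _ [h' _ _] _] := hD' n; exact: lt_le_trans h'.
have nw n : n%:R * zs (phi n) < ws (phi n).
  have [_ _ _ [_ _ h] _] := hD' (phi n); apply: le_lt_trans h.
  by rewrite ler_pM2r// ler_nat.
have wp n : 0 < ws (phi n) by apply: le_lt_trans (nw n); rewrite mulr_ge0// ltW.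
have fH n : window_fixed (al n) (be n) (ls n) (Hs n) by have [] := hD' n.
have sH n : survival (Hs n) by exact: (window_survival mz (al0 n) (fH n)).
have [A [sA rA upA loA fA]] := stationary_limit m mz z0 l0 ls0 hl
  (fun n => survival_scale (zp (phi n)) (sH (phi n))).
have [B [sB rB upB loB fB]] := stationary_limit m mz z0 l0 ls0 hl
  (fun n => survival_scale (wp n) (sH (phi n))).
have A1 x : x < 1 -> 7 / 10 <= A x.
  move=> x1; apply: (loA x ((x + 1) / 2)); first by lra.
  apply: nearW => n; have [_ _ _ _ [h _ _ _]] := hD' (phi n); apply: h.
  by rewrite gtr_pMr//; lra.
have A2 x : 1 <= x -> A x <= 7 / 10.
  move=> x1; apply: upA => y xy.
  apply: nearW => n; have [_ _ _ _ [_ h _ _]] := hD' (phi n); apply/ltW/h.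
  by rewrite ltr_pMr//; exact: le_lt_trans xy.
have A3 x : 1 / 2 <= A x.
  apply: (loA x (x + 1)); first by rewrite ltrDl.
  have h1 := near_gt_nat (x + 1); near=> n.
  have [_ _ _ _ [_ _ h _]] := hD' (phi n); apply: h.
  apply: lt_trans (nw n); rewrite mulrC ltr_pM2r//; near: n; exact: h1.
have A4 x : 1 < x -> A x = T l A x.
  move=> x1; apply: (fA x 1) => // y /andP[xy yx].
  have h1 := near_gt_nat y; near=> n.
  have [_ _ _ [k1 k2 _] _] := hD' (phi n).
  apply: (window_scale (al0 (phi n)) (ls0 n) (zp (phi n)) (fH (phi n))).
    by apply: (le_trans k1); rewrite ler_pMr// ltW// (lt_trans x1).
  apply: lt_le_trans k2; apply: lt_trans (nw n); rewrite mulrC ltr_pM2r//.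
  by near: n; exact: h1.
have B1 x : x < 1 -> 1 / 2 <= B x.
  move=> x1; apply: (loB x ((x + 1) / 2)); first by lra.
  apply: nearW => n; have [_ _ _ _ [_ _ h _]] := hD' (phi n); apply: h.
  by rewrite gtr_pMr//; lra.
have B2 x : 1 <= x -> B x <= 1 / 2.
  move=> x1; apply: upB => y xy.
  apply: nearW => n; have [_ _ _ _ [_ _ _ h]] := hD' (phi n); apply/ltW/h.
  by rewrite ltr_pMr//; exact: le_lt_trans xy.
have nx x n : 0 < x -> x^-1 < n%:R -> zs (phi n) < ws (phi n) * x.
  move=> x0 xn; rewrite -ltr_pdivrMr//; apply: lt_trans (nw n).
  by rewrite mulrC ltr_pM2r.
have B3 x : 0 < x -> B x <= 7 / 10.
  move=> x0; apply: upB => y xy.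
  have h1 := near_gt_nat y^-1; near=> n.
  have [_ _ _ _ [_ h _ _]] := hD' (phi n); apply/ltW/h/nx; first exact: lt_trans xy.
  by near: n; exact: h1.
have B4 x : 0 < x < 1 -> B x = T l B x.
  move=> /andP[x0 x1]; apply: (fB x (1 - x)) => [|y /andP[xy yx]]; first by lra.
  have h1 := near_gt_nat y^-1; near=> n.
  have [_ _ _ [k1 k2 _] _] := hD' (phi n).
  apply: (window_scale (al0 (phi n)) (ls0 n) (wp n) (fH (phi n))).
    apply: (le_trans k1); apply/ltW/nx; first exact: lt_trans xy.
    by near: n; exact: h1.
  by apply: lt_le_trans k2; rewrite gtr_pMr//; lra.
have [t [tA At gt]] := mass_at_infty mz z0 l0 sA A4.
have tb : 1 / 2 <= t.
  apply/ler_addgt0Pr => e /At[x Ax]; exact: le_trans (A3 x) Ax.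
have tb' : t <= 7 / 10 by exact: le_trans (tA 1) (A2 1 (lexx 1)).
have tE : t ^+ 2 + t = 1 by case: (gmap_fix gt) => //; lra.
have t0 : 0 <= t by lra.
have /andP[tl tu] := golden_bounds t0 tE.
have [t' [Bt' tB' gt']] := mass_at_zero mz z0 l0 sB B4.
have half0 : 0 < 1 / 2 :> R by rewrite divr_gt0.
have half1 : 1 / 2 < 1 :> R by rewrite ltr_pdivrMr// mul1r ltr1n.
have tb2 : 1 / 2 <= t' by exact: le_trans (B1 _ half1) (Bt' _ half0).
have tb2' : t' <= 7 / 10.
  apply/ler_addgt0Pr => e /tB'[x x0 Bx].
  by move: (B3 x x0) Bx; set b := B x; clearbody b; lra.
have tE' : t' ^+ 2 + t' = 1.
  by case: (gmap_fix gt') => //; move: tb2 tb2'; lra.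
have t0' : 0 <= t' by move: tb2; lra.
have /andP[tl' tu'] := golden_bounds t0' tE'.
have A12 : t < A (1 / 2).
  by apply: lt_le_trans (A1 _ half1); move: tu; lra.
have B21 : B 2 < t'.
  have := B2 2 (ler1n _ 2); move: tl'; set b := B 2; clearbody b; lra.
have x20 : 0 < 2 :> R by [].
have e1 := upper_front mz z0 z_large l0 t0 tE sA rA tA half0 A12 At A4.
have e2 := lower_front mz z0 z_small l0 t0' tE' sB Bt' x20 B21 tB' B4.
exact: (no_two_drifts l0 e1 e2).
Unshelve. all: by end_near. Qed.

End front_width.

(** * The critical scale *)

Section stationary_law.
Context {R : realType} d (S : measurableType d) (m : probability S R).
Context (zeta : S -> R).
Hypothesis mz : measurable_fun setT zeta.
Hypothesis z0 : forall s, 0 < zeta s.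
Hypothesis z_small : forall e, 0 < e -> 0 < pr m [set s | zeta s < e].
Hypothesis z_large : forall e, 0 < pr m [set s | e < zeta s].
Local Notation T := (glue_op m zeta).
Local Notation window_fixed := (window_fixed m zeta).
Local Notation window_op := (window_op m zeta).

(** Stationary laws without mass at [0] and at infinity. *)
Definition proper_stationary (l : R) (G : R -> R) : Prop :=
  [/\ 0 < l, survival G, rcont G & forall x, 0 < x -> G x = T l G x] /\
  ((forall e, 0 < e -> exists2 x, 0 < x & 1 - e <= G x) /\
   (forall e, 0 < e -> exists x, G x <= e)).

(** The masses can only be [0], [1] and the root of [t ^+ 2 + t = 1], which lies
    between [1 / 2] and [7 / 10]. *)
Lemma proper_of_bounds l G x1 x2 : 0 < l -> survival G -> rcont G ->
  (forall x, 0 < x -> G x = T l G x) -> 0 < x1 -> 7 / 10 <= G x1 ->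
  G x2 <= 1 / 2 -> proper_stationary l G.
Proof.
move=> l0 sG rG fG x10 h1 h2.
have [t [tG Gt gt]] : exists t, [/\ forall x, t <= G x,
    forall e, 0 < e -> exists x, G x <= t + e & gmap t = t].
  by apply: (mass_at_infty mz z0 l0 sG) => x xp; apply: fG; exact: lt_trans xp.
have [u [Gu uG gu]] : exists t, [/\ forall x, 0 < x -> G x <= t,
    forall e, 0 < e -> (exists2 x, 0 < x & t - e <= G x) & gmap t = t].
  by apply: (mass_at_zero mz z0 l0 sG) => x /andP[xp _]; exact: fG.
have [Ga G0 G1 Gn] := sG.
have t0 : 0 <= t.
  by apply/ler_addgt0Pr => e /Gt[x Gx]; exact: le_trans (G0 x) Gx.
have th : t <= 1 / 2 by exact: le_trans (tG x2) h2.
have uh : 7 / 10 <= u by exact: le_trans h1 (Gu x1 x10).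
have tE : t = 0.
  case: (gmap_fix gt) => //; first by lra.
  by move=> /(golden_bounds t0)/andP[]; lra.
have u0 : 0 <= u by lra.
have uE : u = 1.
  case: (gmap_fix gu) => //; first by lra.
  by move=> /(golden_bounds u0)/andP[]; lra.
split=> //; split=> [e /uG[x xp]|e /Gt[x]]; first by rewrite uE; exists x.
by rewrite tE add0r; exists x.
Qed.

Lemma scale_small (c : R) : 0 < c -> exists2 l, 0 < l &
  99 / 100 < pr m [set s | l * zeta s < c].
Proof.
move=> c0; pose A (n : nat) := [set s | zeta s < n.+1%:R * c].
have mA n : measurable (A n) by exact: measurable_set_lt.
have UA : \bigcup_n A n = setT.
  apply/seteqP; split=> // s _; exists (Num.truncn (zeta s / c)) => //.
  by rewrite /A /= -ltr_pdivrMr// truncnS_gt.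
have ndA : {homo A : a b / (a <= b)%N >-> a `<=` b}.
  by move=> a b ab s /= h; apply: (lt_le_trans h); rewrite ler_pM2r// ler_nat.
have := @pr_cvg_bigcup _ _ _ m A mA ndA; rewrite UA pr_setT.
move=> /cvgr_gt/(_ (99 / 100) ltac:(lra))[n _ /(_ n (leqnn n)) h].
exists n.+1%:R^-1; first by rewrite invr_gt0.
suff <- : A n = [set s | n.+1%:R^-1 * zeta s < c] by [].
by apply/seteqP; split=> s; rewrite /A /= ltr_pdivrMl.
Qed.

Lemma scale_large : exists2 l, 0 < l & 99 / 100 < pr m [set s | 1 < l * zeta s].
Proof.
pose A (n : nat) := [set s | 1 < n.+1%:R * zeta s].
have mA n : measurable (A n).
  by apply: measurable_set_lt => //; exact: measurable_funM.
have UA : \bigcup_n A n = setT.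
  apply/seteqP; split=> // s _; exists (Num.truncn (zeta s)^-1) => //.
  by rewrite /A /= -ltr_pdivrMr// mul1r truncnS_gt.
have ndA : {homo A : a b / (a <= b)%N >-> a `<=` b}.
  by move=> a b ab s /= h; apply: (lt_le_trans h); rewrite ler_pM2r// ler_nat.
have := @pr_cvg_bigcup _ _ _ m A mA ndA; rewrite UA pr_setT.
move=> /cvgr_gt/(_ (99 / 100) ltac:(lra))[n _ /(_ n (leqnn n)) h].
by exists n.+1%:R.
Qed.

(** Let [s] be the last place where the tail exceeds [1 / 2] and [y] a place
    slightly before it. If the factor is small, one of the minima must exceed
    [5 / 4 * s] in order that the sum exceeds [y], so the tail at [y] is hardly
    larger than [gmap (1 / 2) = 7 / 16]. *)
Lemma window_collapse l al be H x : 0 < l -> 0 < al ->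
  99 / 100 < pr m [set s | l * zeta s < 1 / 8] ->
  window_fixed al be l H -> al <= x -> H x <= 1 / 2.
Proof.
move=> l0 al0 small fH ax; rewrite leNgt; apply/negP => Hx.
have sH := window_survival mz al0 fH; have [Ha H0 H1 Hn] := sH.
pose Z := [set y | al <= y /\ 1 / 2 < H y].
have Zx : Z x by [].
have Zbe y : Z y -> y < be.
  move=> [ay]; rewrite fH /window_op (ltNge y al) ay /=; case: (ltP y be) => //= _.
  by rewrite ltNge divr_ge0.
have Zb : has_ubound Z by exists be => y /Zbe/ltW.
pose s := sup Z.
have s0 : 0 < s by apply: lt_le_trans al0 (le_trans ax _); exact: ub_le_sup.
have [y [ay Hy] sy] : exists2 y, Z y & 3 / 4 * s < y.
  by apply: sup_gt; [exists x|rewrite -/s; lra].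
have y0 : 0 < y by exact: lt_le_trans ay.
have Hs : H (5 / 4 * s) <= 1 / 2.
  rewrite leNgt; apply/negP => h; have : Z (5 / 4 * s).
    split=> //; have := ub_le_sup Zb (conj ay Hy : Z y); rewrite -/s => ys.
    by apply: (le_trans ay); lra.
  by move=> /(ub_le_sup Zb); rewrite -/s; lra.
have yb := Zbe y (conj ay Hy).
pose A := [set s | l * zeta s < 1 / 8].
have mA : measurable A.
  by apply: measurable_set_lt => //; exact: measurable_funM.
move: Hy; apply/negP; rewrite -leNgt fH /window_op (ltNge y al) ay /= yb.
apply: (@le_trans _ _ (1 - 9 / 16 * pr m A)); last by rewrite -/A in small; lra.
apply: glue_op_le_event => //.
- by move=> t; exact: (pr_le1 _ (measurable_above2 _ _)).
move=> t At; apply: le_trans (sum_tail_le _ sH) _.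
have -> : 1 - 9 / 16 = gmap (1 / 2) :> R by rewrite /gmap; field.
apply: gmap_le => //; last by lra.
apply: le_trans Hs; apply: Ha.
rewrite ler_pdivlMr// ler_pdivlMr ?mulr_gt0//.
have lz : 0 < l * zeta t by rewrite mulr_gt0.
by move: At; rewrite /A /=; set L := l * zeta t in lz *; clearbody L; nra.
Qed.

(** The tail equal to [7 / 10] on the whole window is a sub-solution, because
    [gmap (7 / 10)] exceeds [7 / 10] by a margin. *)
Lemma window_fill l al be H : 0 < l -> 0 < al -> al <= be ->
  99 / 100 < pr m [set s | 1 < l * zeta s] -> window_fixed al be l H ->
  (forall J, (forall x, x < al -> J x = 1) -> (forall x, 0 <= J x) ->
      (forall x, J x <= 1) -> (forall x, be <= x -> J x = 0) ->
      (forall x, J x <= window_op al be l J x) -> forall x, J x <= H x) ->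
  forall x, x < be -> 7 / 10 <= H x.
Proof.
move=> l0 al0 ab big fH gH.
pose J x : R := if x < al then 1 else if x < be then 7 / 10 else 0.
have J1 x : J x <= 1 by rewrite /J; case: ifP => // _; case: ifP => // _; lra.
have J0 x : 0 <= J x by rewrite /J; case: ifP => // _; case: ifP => // _; lra.
have Jb x : x < be -> 7 / 10 <= J x.
  by move=> xb; rewrite /J xb; case: ifP => // _; lra.
have sJ : survival J.
  split=> // [x y xy|x x0]; last by rewrite /J (lt_trans x0 al0).
  rewrite /J; case: (ltP x al) => xa.
    by case: ifP => // _; case: ifP => // _; lra.
  rewrite ltNge (le_trans xa xy) /=; case: (ltP x be) => xb.
    by case: ifP => // _; lra.
  by rewrite ltNge (le_trans xb xy).
move=> x xb; apply: (le_trans (Jb x xb)).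
apply: gH => // [y ya|y yb|y].
- by rewrite /J ya.
- by rewrite /J !ltNge (le_trans ab yb) yb.
rewrite {1}/J /window_op; case: (ltP y al) => // ya; case: (ltP y be) => // yb.
pose A := [set s | 1 < l * zeta s].
have mA : measurable A.
  by apply: measurable_set_lt => //; exact: measurable_funM.
have y0 : 0 < y by exact: lt_le_trans ya.
apply: (@le_trans _ _ (0 + gmap (7 / 10) * pr m A)).
  rewrite add0r /gmap; set p := pr m A; have : 99 / 100 < p by []; clearbody p; nra.
apply: glue_op_ge_event => //.
- by rewrite gmap_ge0//; lra.
- by move=> t; exact: pr_ge0.
move=> t At; rewrite add0r.
have mid : y < (y + be) / 2 by lra.
have low : y / (l * zeta t) <= y.
  by rewrite ler_pdivrMr ?mulr_gt0// ler_peMr// ltW.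
apply: (sum_tail_ge sJ _ (le_lt_trans low mid)); first by lra.
by apply: Jb; lra.
Qed.

End stationary_law.

Section existence.
Context {R : realType} d (S : measurableType d) (m : probability S R).
Context (zeta : S -> R).
Hypothesis mz : measurable_fun setT zeta.
Hypothesis z0 : forall s, 0 < zeta s.
Hypothesis z_small : forall e, 0 < e -> 0 < pr m [set s | zeta s < e].
Hypothesis z_large : forall e, 0 < pr m [set s | e < zeta s].
Local Notation T := (glue_op m zeta).
Local Notation window_fixed := (window_fixed m zeta).
Local Notation window_op := (window_op m zeta).

(** The largest stationary tail in a window increases with the scale. Walk
    through the scales by steps of length [del] and stop when its value at [1]
    passes [7 / 10]. *)
Lemma transition (lmin lmax del al be : R) : 0 < lmin -> 0 < lmax ->
  0 < del -> 0 < al -> al <= 1 -> 1 < be ->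
  99 / 100 < pr m [set s | lmin * zeta s < 1 / 8] ->
  99 / 100 < pr m [set s | 1 < lmax * zeta s] ->
  exists D : (R * R) * ((R -> R) * (R -> R)),
    let: ((l, l'), (H, H')) := D in
    [/\ lmin <= l, l <= l' & l' <= Order.min (l + del) (lmax + del)] /\
    [/\ window_fixed al be l H, window_fixed al be l' H', H 1 < 7 / 10 &
      7 / 10 <= H' 1].
Proof.
move=> lm0 lM0 d0 al0 al1 be1 small big.
have ab : al <= be by exact: le_trans al1 (ltW be1).
pose good l H := 0 < l -> window_fixed al be l H /\
    forall J, (forall x, x < al -> J x = 1) -> (forall x, 0 <= J x) ->
      (forall x, J x <= 1) -> (forall x, be <= x -> J x = 0) ->
      (forall x, J x <= window_op al be l J x) -> forall x, J x <= H x.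
have [F hF] : {F : R -> R -> R & forall l, good l (F l)}.
  apply: choice => l; case: (ltP 0 l) => l0.
    by have [H hH] := window_exists m mz al0 ab l0; exists H.
  by exists (fun=> 0); rewrite /good ltNge l0.
have monoF l l' : 0 < l -> l <= l' -> F l 1 <= F l' 1.
  move=> l0 ll; have l0' : 0 < l' by exact: lt_le_trans ll.
  have [fl _] := hF l l0; have [_ gl'] := hF l' l0'.
  have [_ F0 F1 _] := window_survival mz al0 fl.
  apply: gl' => // [x xa|x xb|x].
  - by rewrite fl /window_op xa.
  - by rewrite fl /window_op !ltNge (le_trans ab xb) xb.
  rewrite {1}fl /window_op; case: (ltP x al) => xa; first exact: lexx.
  case: (ltP x be) => xb; last exact: lexx.
  apply: (glue_op_le_scale m mz z0) => //; apply/ltW; exact: lt_le_trans xa.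
have Fmin : F lmin 1 < 7 / 10.
  have [fl _] := hF lmin lm0.
  by apply: le_lt_trans (window_collapse mz z0 lm0 al0 small fl al1) _; lra.
have Fmax : 7 / 10 <= F lmax 1.
  have [fl gl] := hF lmax lM0.
  exact: (window_fill mz z0 lM0 al0 ab big fl gl).
pose L (i : nat) := lmin + i%:R * del.
have L0 i : 0 < L i by rewrite ltr_wpDr// mulr_ge0// ltW.
have exi : exists i, 7 / 10 <= F (L i) 1.
  exists (Num.truncn (lmax / del)).+1; apply: (le_trans Fmax); apply: monoF => //.
  by apply: ler_wpDl; [exact: ltW|rewrite -ler_pdivrMr//; exact/ltW/truncnS_gt].
case: (ex_minnP exi) => -[|i]; first by rewrite /L mul0r addr0 leNgt Fmin.
move=> hi mini.
have hi' : F (L i) 1 < 7 / 10.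
  by rewrite ltNge; apply/negP => /mini; rewrite ltnn.
have LS : L i.+1 = L i + del by rewrite /L -natr1 mulrDl mul1r addrA.
exists ((L i, L i.+1), (F (L i), F (L i.+1))); split; split=> //.
- by rewrite lerDl mulr_ge0// ltW.
- by rewrite LS lerDl ltW.
- rewrite LS le_min lexx /= lerD2r leNgt; apply/negP => lL.
  by move: hi'; rewrite ltNge (le_trans Fmax)// monoF// ltW.
- by have [] := hF _ (L0 i).
- by have [] := hF _ (L0 i.+1).
Qed.

(** The windows are [[n.+2^-1, n.+2[]. The lower tails [H1 n] have their quantile
    of order [7 / 10] on the left of [1], the upper tails [H2 n] on the right;
    the former can only be lost at the left ends of the windows, the latter only
    at the right ends. *)
Lemma stationary_law_exists : exists l G, proper_stationary m zeta l G.
Proof.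
have [lmin lm0 small] := scale_small m mz (ltac:(lra) : 0 < 1 / 8 :> R).
have [lmax lM0 big] := scale_large m mz z0.
have [C [C0 hC]] : exists C, 0 < C /\
    forall al be l H x y, 0 < al -> al <= be -> lmin <= l <= lmax + 1 ->
      window_fixed al be l H -> H x < 7 / 10 -> 1 / 2 < H y -> y <= C * x.
  have [C hC] := front_width mz z0 z_small z_large (lmax + 1) lm0.
  exists (Order.max C 1); split=> [|al be l H x y a0 ab lb fH Hx Hy].
    by rewrite lt_max ltr01 orbT.
  have x0 : 0 < x.
    apply: (lt_le_trans a0); rewrite leNgt; apply/negP => xa.
    by move: Hx; rewrite fH /window_op xa; lra.
  by apply: le_trans (hC _ _ _ _ _ _ a0 ab lb fH Hx Hy) _; rewrite ler_pM2r// le_max lexx.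
have tr (n : nat) := @transition lmin lmax n.+1%:R^-1 n.+2%:R^-1 n.+2%:R lm0 lM0
  ltac:(by rewrite invr_gt0) ltac:(by rewrite invr_gt0)
  ltac:(by rewrite invf_le1// ler1n) ltac:(by rewrite ltr1n) small big.
have [D hD] := choice tr.
pose l1 n := (D n).1.1; pose l2 n := (D n).1.2.
pose H1 n := (D n).2.1; pose H2 n := (D n).2.2.
have hD' n : [/\ lmin <= l1 n, l1 n <= l2 n & l2 n <= Order.min (l1 n + n.+1%:R^-1) (lmax + n.+1%:R^-1)] /\
    [/\ window_fixed n.+2%:R^-1 n.+2%:R (l1 n) (H1 n),
      window_fixed n.+2%:R^-1 n.+2%:R (l2 n) (H2 n), H1 n 1 < 7 / 10 &
      7 / 10 <= H2 n 1].
  have := hD n; rewrite /l1 /l2 /H1 /H2.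
  by case: (D n) => [[? ?] [? ?]].
clearbody l1 l2 H1 H2; clear D hD tr.
have al0 n : 0 < n.+2%:R^-1 :> R by rewrite invr_gt0.
have ab n : n.+2%:R^-1 <= n.+2%:R :> R.
  by apply: (@le_trans _ _ 1); [rewrite invf_le1// ler1n|rewrite ler1n].
have inv1 n : n.+1%:R^-1 <= 1 :> R by rewrite invf_le1// ler1n.
have l1b n : lmin <= l1 n <= lmax + 1.
  have [[h1 h2 h3] _] := hD' n; rewrite h1 /=; apply: (le_trans h2); apply: (le_trans h3).
  by rewrite ge_min lerD2l inv1 orbT.
have l2b n : lmin <= l2 n <= lmax + 1.
  have [[h1 h2 h3] _] := hD' n; rewrite (le_trans h1 h2) /=; apply: (le_trans h3).
  by rewrite ge_min lerD2l inv1 orbT.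
have f1 n : window_fixed n.+2%:R^-1 n.+2%:R (l1 n) (H1 n) by have [_ []] := hD' n.
have f2 n : window_fixed n.+2%:R^-1 n.+2%:R (l2 n) (H2 n) by have [_ []] := hD' n.
have s1 n : survival (H1 n) := window_survival mz (al0 n) (f1 n).
have s2 n : survival (H2 n) := window_survival mz (al0 n) (f2 n).
have l10 n : 0 < l1 n by have /andP[h _] := l1b n; exact: lt_le_trans h.
have l20 n : 0 < l2 n by have /andP[h _] := l2b n; exact: lt_le_trans h.
have c7 : (0 : R) < 7 / 10 <= (1 : R) by apply/andP; split; lra.
have [z1 hz1] := choice (fun n => window_quantile mz (al0 n) (ab n) (f1 n) c7).
have [z2 hz2] := choice (fun n => window_quantile mz (al0 n) (ab n) (f2 n) c7).
have z1le n : z1 n <= 1.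
  have [_ _ h _] := hz1 n; have [_ [_ _ k _]] := hD' n.
  by rewrite leNgt; apply/negP => /h; rewrite leNgt k.
have z2ge n : 1 <= z2 n.
  have [_ _ _ h] := hz2 n; have [_ [_ _ _ k]] := hD' n.
  by rewrite leNgt; apply/negP => /h; rewrite ltNge k.
have z1p n : 0 < z1 n by have [h _ _ _] := hz1 n; exact: lt_le_trans h.
have z2p n : 0 < z2 n by exact: lt_le_trans (z2ge n).
(* the width of the fronts is bounded in units of these quantiles *)
have w1 n x : C * z1 n < x -> H1 n x <= 1 / 2.
  move=> zx; rewrite leNgt; apply/negP => Hx.
  have [_ _ _ h] := hz1 n.
  have zy : z1 n < (z1 n + x / C) / 2 by rewrite mulrC -ltr_pdivlMr// in zx; lra.
  have := hC _ _ _ _ _ _ (al0 n) (ab n) (l1b n) (f1 n) (h _ zy) Hx.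
  by rewrite mulrC -ler_pdivrMr//; rewrite mulrC -ltr_pdivlMr// in zx; lra.
have w2 n x : C * z2 n < x -> H2 n x <= 1 / 2.
  move=> zx; rewrite leNgt; apply/negP => Hx.
  have [_ _ _ h] := hz2 n.
  have zy : z2 n < (z2 n + x / C) / 2 by rewrite mulrC -ltr_pdivlMr// in zx; lra.
  have := hC _ _ _ _ _ _ (al0 n) (ab n) (l2b n) (f2 n) (h _ zy) Hx.
  by rewrite mulrC -ler_pdivrMr//; rewrite mulrC -ltr_pdivlMr// in zx; lra.
have [phi [l [hphi hl ll]]] := bounded_subseq l1b.
have l0 : 0 < l by exact: lt_le_trans ll.
have hl2 : l2 (phi n) @[n --> \oo] --> l.
  have hl' : l1 (phi n) + (phi n).+1%:R^-1 @[n --> \oo] --> l.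
    rewrite -[X in _ --> X]addr0; apply: cvgD => //.
    exact: (cvg_sub hphi (@cvg_harmonic R)).
  apply: squeeze_cvgr hl hl'; apply: nearW => n.
  have [[_ h2 h3] _] := hD' (phi n); rewrite h2 /=; apply: (le_trans h3).
  by rewrite ge_min lexx.
(* a quantile away from the ends of the windows gives a stationary law *)
have full (ls : nat -> R) (Hs : nat -> R -> R) (zs : nat -> R) (psi : nat -> nat) :
    (forall n, 0 < ls n) -> ls (psi n) @[n --> \oo] --> l ->
    (forall n, window_fixed n.+2%:R^-1 n.+2%:R (ls n) (Hs n)) ->
    (forall n, 0 < zs n) -> (forall n x, x < zs n -> 7 / 10 <= Hs n x) ->
    (forall n x, C * zs n < x -> Hs n x <= 1 / 2) ->
    (forall y : R, 0 < y -> \forall n \near \oo,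
       (psi n).+2%:R^-1 <= zs (psi n) * y /\ zs (psi n) * y < (psi n).+2%:R) ->
    exists l G, proper_stationary m zeta l G.
  move=> ls0 hls fs zs0 hz hC' wide.
  have sHs n := window_survival mz (al0 n) (fs n).
  have [G [sG rG upG loG fG]] := stationary_limit m mz z0 l0 (fun n => ls0 (psi n)) hls
    (fun n => survival_scale (zs0 (psi n)) (sHs (psi n))).
  exists l, G; apply: (proper_of_bounds mz z0 (x1 := 1 / 2) (x2 := C) l0 sG rG) => //.
  - move=> x x0; apply: (fG x 1) => // y /andP[xy _].
    have y0 : 0 < y by exact: lt_trans xy.
    apply: filterS (wide y y0) => n [k1 k2].
    exact: (window_scale mz z0 (al0 (psi n)) (ls0 (psi n)) (zs0 (psi n)) (fs (psi n)) k1 k2).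
  - apply: (loG _ (3 / 4)); first by lra.
    apply: nearW => n; apply: hz; rewrite gtr_pMr//; lra.
  - apply: upG => y xy; apply: nearW => n; apply: hC'.
    by rewrite mulrC ltr_pM2l.
have [h|/existsNP[K1 /existsNP[k1 hK1]]] := pselect (forall (K : nat) (k : nat),
    exists n, (k <= n)%N /\ K%:R < z1 (phi n) * (phi n).+2%:R).
  have [nk hnk] := choice (fun n => h n n).
  have nkn n : (n <= phi (nk n))%N by have [a _] := hnk n; exact: leq_trans (hphi _).
  apply: (full l1 H1 z1 (phi \o nk)) => //.
  - by apply: cvg_sub hl => n; have [] := hnk n.
  - by move=> n; have [_ _] := hz1 n.
  move=> y y0; have a1 := near_gt_nat y^-1; have a2 := near_gt_nat y.
  near=> n; have [_ b] := hnk n.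
  have c1 : y^-1 < n%:R by near: n; exact: a1.
  have c2 : y < n%:R by near: n; exact: a2.
  have N0 : 0 < (phi (nk n)).+2%:R :> R by [].
  split=> /=.
    rewrite -[X in X <= _]mul1r ler_pdivrMr// mulrAC -ler_pdivrMr// mul1r.
    by apply: ltW; apply: lt_trans b.
  apply: le_lt_trans (ler_piMl (ltW y0) (z1le _)) _; apply: (lt_trans c2).
  by rewrite ltr_nat ltnS; exact: (leq_trans (nkn n)).
have {}hK1 n : (k1 <= n)%N -> z1 (phi n) * (phi n).+2%:R <= K1%:R.
  by move=> kn; rewrite leNgt; apply/negP => b; apply: hK1; exists n.
have [h|/existsNP[K2 /existsNP[k2 hK2]]] := pselect (forall (K : nat) (k : nat),
    exists n, (k <= n)%N /\ K%:R < (phi n).+2%:R / z2 (phi n)).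
  have [nk hnk] := choice (fun n => h n n).
  have nkn n : (n <= phi (nk n))%N by have [a _] := hnk n; exact: leq_trans (hphi _).
  apply: (full l2 H2 z2 (phi \o nk)) => //.
  - by apply: cvg_sub hl2 => n; have [] := hnk n.
  - by move=> n; have [_ _] := hz2 n.
  move=> y y0; have a1 := near_gt_nat y^-1; have a2 := near_gt_nat y.
  near=> n; have [_ b] := hnk n.
  have c1 : y^-1 < n%:R by near: n; exact: a1.
  have c2 : y < n%:R by near: n; exact: a2.
  have N0 : 0 < (phi (nk n)).+2%:R :> R by [].
  split=> /=.
    apply: (@le_trans _ _ y); last exact: (ler_peMl (ltW y0) (z2ge _)).
    rewrite -[X in _ <= X]invrK lef_pV2 ?posrE ?invr_gt0//; apply/ltW/(lt_trans c1).
    by rewrite ltr_nat ltnS; exact: (leq_trans (nkn n)).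
  by rewrite mulrC -ltr_pdivlMr//; exact: lt_trans c2 b.
have {}hK2 n : (k2 <= n)%N -> (phi n).+2%:R / z2 (phi n) <= K2%:R.
  by move=> kn; rewrite leNgt; apply/negP => b; apply: hK2; exists n.
(* Both quantiles stay within a bounded ratio of an end of their windows. In the
   frames of these ends, [Y] is the limit of the lower tails; it is stationary
   on the right of [1] and equal to [1] on the left, hence a super-solution.
   The limit [V] of the upper tails is a sub-solution. *)
have N0 n : 0 < (phi n).+2%:R :> R by [].
have nN n : n%:R < (phi n).+2%:R :> R by rewrite ltr_nat ltnS; exact: (leq_trans (hphi n)).
have [Y [sY rY upY loY fY]] := stationary_limit m mz z0 l0 (fun n => l10 (phi n)) hl
  (fun n => survival_scale (al0 (phi n)) (s1 (phi n))).
have [V [sV rV upV loV fV]] := stationary_limit m mz z0 l0 (fun n => l20 (phi n)) hl2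
  (fun n => survival_scale (N0 n) (s2 (phi n))).
have [Ya Y0 Y1 Yn] := sY; have [Va V0 V1 Vn] := sV.
have YE x : x < 1 -> Y x = 1.
  move=> x1; apply/eqP; rewrite eq_le Y1 /=; apply: (loY x ((x + 1) / 2)); first by lra.
  apply: nearW => n; rewrite f1 /window_op gtr_pMr//.
  by rewrite (_ : _ / 2 < 1) //; lra.
have YT x : 1 <= x -> Y x = T l Y x.
  move=> x1; apply: (fY x 1) => // y /andP[xy _].
  have y1 : 1 < y by exact: le_lt_trans xy.
  have a2 := near_gt_nat y; near=> n.
  apply: (window_scale mz z0 (al0 (phi n)) (l10 (phi n)) (al0 (phi n)) (f1 (phi n))).
    by rewrite ler_pMr// ltW.
  apply: (@le_lt_trans _ _ y).
    by apply: ler_piMl; [lra|rewrite invf_le1// ler1n].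
  by apply: lt_trans (nN n); near: n; exact: a2.
have Yh : Y (C * K1%:R) <= 1 / 2.
  apply: upY => y xy; exists k1 => // n /= kn; apply: w1.
  rewrite [X in _ < X]mulrC ltr_pdivlMr// -mulrA; apply: le_lt_trans xy.
  by rewrite ler_pM2l// hK1.
have VE x : 1 <= x -> V x = 0.
  move=> x1; apply/eqP; rewrite eq_le V0 andbT; apply: upV => y xy.
  have y1 : 1 < y by exact: le_lt_trans xy.
  apply: nearW => n; rewrite f2 /window_op !ltNge.
  have yN : (phi n).+2%:R <= (phi n).+2%:R * y by rewrite ler_pMr// ltW.
  by rewrite yN (le_trans (ab _) yN).
have VT x : 0 <= x < 1 -> V x = T l V x.
  move=> /andP[x0 x1]; apply: (fV x (1 - x)) => [|y /andP[xy yx]]; first by lra.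
  have y0 : 0 < y by exact: le_lt_trans xy.
  have a1 := near_gt_nat y^-1; near=> n.
  apply: (window_scale mz z0 (al0 (phi n)) (l20 (phi n)) (N0 n) (f2 (phi n))).
    apply: (@le_trans _ _ 1); first by rewrite invf_le1// ler1n.
    rewrite mulrC -ler_pdivrMl// mulr1; apply/ltW/(lt_trans _ (nN n)).
    by near: n; exact: a1.
  by rewrite gtr_pMr//; lra.
pose K : R := K2%:R + 1.
have K0 : 0 < K by rewrite ltr_wpDl.
have Vh : 7 / 10 <= V (2^-1 / K).
  apply: (loV _ K^-1); first by rewrite gtr_pMl ?invr_gt0// invf_lt1// ltr1n.
  exists k2.+1 => // n /= kn; have [_ _ h _] := hz2 (phi n); apply: h.
  have := hK2 n (ltnW kn); rewrite ler_pdivrMr// => b.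
  rewrite ltr_pdivrMr// mulrC; apply: (le_lt_trans b).
  by rewrite ltr_pM2r// /K ltrDl.
have V1' x : V x <= Y x.
  by case: (ltP x 1) => x1; [rewrite YE|rewrite VE].
have mono (J J' : R -> R) : (forall x, V x <= J x) -> (forall x, J x <= J' x) ->
    (forall x, J' x <= Y x) -> forall x, T l J x <= T l J' x.
  move=> VJ JJ _ x; apply: (glue_op_le m mz) => // y.
  exact: (le_trans (V0 y) (VJ y)).
have VTV x : V x <= T l V x.
  have [x0|x0] := ltP x 0; first by rewrite (glue_op_neg m mz z0)// Vn.
  have [x1|x1] := ltP x 1; first by rewrite -VT// x0.
  by rewrite VE//; exact: glue_op_ge0.
have TYY x : T l Y x <= Y x.
  by have [x1|x1] := ltP x 1; [rewrite YE//; exact: (glue_op_le1 m mz)|rewrite -YT].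
have [G [VG GY fG _]] := tarski_between V1' mono VTV TYY.
have sG : survival G.
  split=> [x y xy|x|x|x x0].
  - by rewrite (fG x) (fG y); exact: (glue_op_anti m mz).
  - exact: le_trans (V0 x) (VG x).
  - exact: le_trans (GY x) (Y1 x).
  - by apply/eqP; rewrite eq_le (le_trans (GY x))//= -(Vn x x0).
have rG : rcont G.
  move=> x c; rewrite fG => /(glue_op_rcont mz)[y xy cy]; exists y => //.
  by rewrite fG.
exists l, G; apply: (proper_of_bounds mz z0 l0 sG rG (x1 := 2^-1 / K) (x2 := C * K1%:R)).
- by move=> x _; exact: fG.
- by rewrite divr_gt0// invr_gt0.
- exact: le_trans Vh (VG _).
- exact: le_trans (GY _) Yh.
Unshelve. all: by end_near. Qed.

End existence.

(** * The Borel structure of the space of metrics *)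

Transparent glue_op sum_tail pr.

Definition Gedge_code (e : Gedge) : nat :=
  match e with E1 => 0 | E2 => 1 | E3 => 2 | E4 => 3 end.

Definition Gedge_decode (n : nat) : option Gedge :=
  match n with 0 => Some E1 | 1 => Some E2 | 2 => Some E3 | 3 => Some E4 | _ => None end.

Lemma Gedge_codeK : pcancel Gedge_code Gedge_decode.
Proof. by case. Qed.

HB.instance Definition _ := Countable.copy Gedge (pcan_type Gedge_codeK).

Definition Vinf_code (x : Vinf) : option (option (seq Gedge)) :=
  match x with VIn => None | VOut => Some None | VMid w => Some (Some w) end.

Definition Vinf_decode (c : option (option (seq Gedge))) : Vinf :=
  match c with None => VIn | Some None => VOut | Some (Some w) => VMid w end.

Lemma Vinf_codeK : cancel Vinf_code Vinf_decode.
Proof. by case. Qed.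

HB.instance Definition _ := Countable.copy Vinf (can_type Vinf_codeK).

Section borel_Mspace.
Context {R : realType}.
Local Notation M := (borel (Mspace R)).

(** The boxes with rational sides form a countable basis of the topology. *)
Definition box (s : seq ((Vinf * Vinf) * (rat * rat))) : set (Mspace R) :=
  [set d | forall i, i \in s -> ratr i.2.1 < Mdist d i.1.1 i.1.2 < ratr i.2.2].

Lemma box_cat s t d : box (s ++ t) d <-> box s d /\ box t d.
Proof.
split=> [h|[h1 h2] i]; last by rewrite mem_cat => /orP[/h1|/h2].
by split=> i his; apply: h; rewrite mem_cat his ?orbT.
Qed.

Lemma open_box (U : set (Mspace R)) d : open U -> U d ->
  exists s, box s d /\ box s `<=` U.
Proof.
move=> [V oV <-] /= Vd.
pose F : set_system {ptws Vinf * Vinf -> R} :=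
  [set A | exists s, box s d /\ forall d', box s d' -> A (set_val d')].
have FF : Filter F.
  split.
  - by exists [::]; split.
  - move=> A B [s [sd sA]] [t [td tB]]; exists (s ++ t); split; first by rewrite box_cat.
    by move=> d' /box_cat[/sA ? /tB ?].
  - by move=> A B AB [s [sd sA]]; exists s; split=> // d' /sA/AB.
have Fd : F --> (set_val d : {ptws Vinf * Vinf -> R}).
  apply/cvg_sup => -[x y] A [B] [[W oW <-]] /= Wd WA.
  have [e /= e0 We] : exists2 e, 0 < e & ball (Mdist d x y) e `<=` W.
    have : nbhs (Mdist d x y) W by apply: open_nbhs_nbhs.
    by move=> /nbhs_ballP[e e0 h]; exists e.
  have [|p /andP[p1 p2]] := @ratr_between R (Mdist d x y - e) (Mdist d x y).
    by rewrite gtrBl.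
  have [|q /andP[q1 q2]] := @ratr_between R (Mdist d x y) (Mdist d x y + e).
    by rewrite ltrDl.
  exists [:: ((x, y), (p, q))]; split.
    by move=> i; rewrite inE => /eqP -> /=; rewrite p2 q1.
  move=> d' /(_ ((x, y), (p, q))); rewrite inE eqxx => /(_ isT) /= /andP[h1 h2].
  apply: WA; apply: We; suff : `|Mdist d x y - Mdist d' x y| < e by [].
  by rewrite ltr_norml; apply/andP; split; lra.
have [s [sd sV]] : F V by apply: Fd; exact: open_nbhs_nbhs.
by exists s.
Qed.

Lemma open_Mdist_gt x y (c : R) : open [set d : Mspace R | c < Mdist d x y].
Proof.
exists ((fun f : {ptws Vinf * Vinf -> R} => f (x, y)) @^-1` `]c, +oo[%classic).
  apply: open_comp; last exact: interval_open.
  by move=> f _; exact: (@proj_continuous _ (fun _ : Vinf * Vinf => R) (x, y) f).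
by apply/seteqP; split=> d /=; rewrite in_itv/= andbT.
Qed.

Lemma open_Mdist_lt x y (c : R) : open [set d : Mspace R | Mdist d x y < c].
Proof.
exists ((fun f : {ptws Vinf * Vinf -> R} => f (x, y)) @^-1` `]-oo, c[%classic).
  apply: open_comp; last exact: interval_open.
  by move=> f _; exact: (@proj_continuous _ (fun _ : Vinf * Vinf => R) (x, y) f).
by apply/seteqP; split=> d /=; rewrite in_itv/=.
Qed.

Lemma Mspace_hausdorff : hausdorff_space (Mspace R).
Proof.
rewrite open_hausdorff => d d' dd'.
have [x [y xy]] : exists x y, Mdist d x y <> Mdist d' x y.
  apply: contrapT => h; move/eqP: dd'; apply; apply: val_inj; apply: funext => -[x y].
  by apply: contrapT => k; apply: h; exists x, y.
have sep (a b : Mspace R) : Mdist a x y < Mdist b x y ->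
    exists c, Mdist a x y < c /\ c < Mdist b x y.
  by move=> ab; exists ((Mdist a x y + Mdist b x y) / 2); rewrite !midf_lt.
have dis c : [set d : Mspace R | Mdist d x y < c] `&` [set d | c < Mdist d x y] = set0.
  by apply/seteqP; split=> // a [/= h1 h2]; have := lt_trans h1 h2; rewrite ltxx.
have [ab|ba|ab] := ltgtP (Mdist d x y) (Mdist d' x y); last by case: xy.
  have [c [c1 c2]] := sep _ _ ab.
  exists ([set d | Mdist d x y < c], [set d | c < Mdist d x y]); first by rewrite !inE.
  by split; [exact: open_Mdist_lt|exact: open_Mdist_gt|rewrite dis].
have [c [c1 c2]] := sep _ _ ba.
exists ([set d | c < Mdist d x y], [set d | Mdist d x y < c]); first by rewrite !inE.
by split; [exact: open_Mdist_gt|exact: open_Mdist_lt|rewrite /= setIC dis].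
Qed.

Lemma open_borel (T : ptopologicalType) (U : set T) : open U ->
  measurable (U : set (borel T)).
Proof. by move=> oU; exact: sub_sigma_algebra. Qed.

Lemma measurable_Mdist x y :
  measurable_fun setT (fun d : M => Mdist d x y).
Proof.
apply: measurable_fun_gt => c; apply: open_borel; exact: open_Mdist_gt.
Qed.

(** Open sets are countable unions of boxes. *)
Lemma measurable_into_M d (T : measurableType d) (f : T -> M) :
  (forall x y, measurable_fun setT (fun t => Mdist (f t) x y)) ->
  measurable_fun setT f.
Proof.
move=> mf.
have mbox s : measurable (f @^-1` box s).
  elim: s => [|i s ih].
    rewrite (_ : _ @^-1` _ = setT); first exact: measurableT.
    by apply/seteqP; split.
  rewrite (_ : _ @^-1` _ = [set t | ratr i.2.1 < Mdist (f t) i.1.1 i.1.2] `&`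
     [set t | Mdist (f t) i.1.1 i.1.2 < ratr i.2.2] `&` f @^-1` box s); last first.
    apply/seteqP; split=> t /=.
      move=> h; have := h i; rewrite inE eqxx => /(_ isT)/andP[h1 h2]; split=> //.
      by move=> j js; apply: h; rewrite inE js orbT.
    by move=> [[h1 h2] h3] j; rewrite inE => /orP[/eqP ->|/h3//]; rewrite h1 h2.
  by apply: measurableI => //; apply: measurableI; exact: measurable_set_lt.
apply: (@measurability _ _ T M setT f (@open (Mspace R)) erefl).
move=> _ [U oU <-]; rewrite setTI.
rewrite (_ : f @^-1` U = [set t | exists s, (box s `<=` U /\ box s (f t))]).
  apply: measurable_ex_countable => s.
  have [h|h] := pselect (box s `<=` U).
    by rewrite [X in measurable X](_ : _ = f @^-1` box s)//; apply/seteqP; split=> t //= [].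
  by rewrite [X in measurable X](_ : _ = set0)//; apply/seteqP; split=> t //= [].
apply/seteqP; split=> t /=; last by move=> [s [sU st]]; exact: sU.
by move=> /(open_box oU)[s [st sU]]; exists s.
Qed.

(** One-sided boxes already determine laws, and only involve the events
    [q < d x y] that serve as bits below. *)
Definition lbox (s : seq ((Vinf * Vinf) * rat)) : set M :=
  [set d | forall i, i \in s -> ratr i.2 < Mdist d i.1.1 i.1.2].

Lemma lbox_cat s t : lbox (s ++ t) = lbox s `&` lbox t.
Proof.
apply/seteqP; split=> d; last first.
  by move=> [h1 h2] i; rewrite mem_cat => /orP[/h1|/h2].
by move=> h; split=> i his; apply: h; rewrite mem_cat his ?orbT.
Qed.

Lemma lbox_cons i s : lbox (i :: s) =
  [set d | ratr i.2 < Mdist d i.1.1 i.1.2] `&` lbox s.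
Proof.
rewrite -cat1s lbox_cat; congr (_ `&` _); apply/seteqP; split=> d /=.
  by apply; rewrite inE.
by move=> h j; rewrite inE => /eqP ->.
Qed.

Lemma lbox_nil : lbox [::] = setT.
Proof. by apply/seteqP; split. Qed.

Lemma measurable_lbox s : measurable (lbox s).
Proof.
elim: s => [|i s ih]; first by rewrite lbox_nil; exact: measurableT.
rewrite lbox_cons; apply: measurableI => //; apply: open_borel.
exact: open_Mdist_gt.
Qed.

(** The [lbox]es are stable under intersection and generate the Borel sets. *)
Lemma M_law_unique (P Q : probability M R) :
  (forall s, P (lbox s) = Q (lbox s)) -> forall A, measurable A -> P A = Q A.
Proof.
move=> PQ A mA.
pose G := range lbox.
have Gm : G `<=` measurable by move=> _ [s _ <-]; exact: measurable_lbox.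
have sA : <<s G >> A.
  have := @measurable_into_M _ (g_sigma_algebraType G) id.
  have h : forall x y, measurable_fun setT
      (fun t : g_sigma_algebraType G => Mdist (t : M) x y).
    move=> x y; apply: measurable_fun_gt => c.
    rewrite [X in measurable X](_ : _ = [set t : g_sigma_algebraType G |
      exists q : rat, c < ratr q /\ ratr q < Mdist (t : M) x y]).
      apply: measurable_ex_countable => q.
      have [h|h] := pselect (c < ratr q :> R).
        rewrite [X in measurable X](_ : _ = lbox [:: ((x, y), q)]).
          by apply: sub_sigma_algebra; exists [:: ((x, y), q)].
        apply/seteqP; split=> t /=.
          by move=> [_ k] i; rewrite inE => /eqP ->.
        by move=> k; split=> //; apply: (k ((x, y), q)); rewrite inE.
      by rewrite [X in measurable X](_ : _ = set0)//; apply/seteqP; split=> t //= [].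
    apply/seteqP; split=> t /=; last by move=> [q [h1 h2]]; exact: lt_trans h2.
    by move=> /ratr_between[q /andP[h1 h2]]; exists q.
  move=> /(_ h measurableT A mA); rewrite setTI; exact.
apply: (@g_sigma_algebra_measure_unique _ _ _ G Gm (fun=> setT)) => //.
- by move=> _; exists [::] => //; exact: lbox_nil.
- by rewrite bigcup_const.
- by move=> _ _ [s _ <-] [t _ <-]; exists (s ++ t) => //; exact: lbox_cat.
- by move=> _ [s _ <-]; exact: PQ.
- by move=> _; apply: le_lt_trans (probability_le1 _ measurableT) _; rewrite ltry.
Qed.

End borel_Mspace.

(** * Image laws *)

Section push.
Context d1 d2 (T1 : measurableType d1) (T2 : measurableType d2) (R : realType).
Variables (P : probability T1 R) (f : T1 -> T2).
Hypothesis mf : measurable_fun setT f.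

Definition push of measurable_fun setT f := fun A : set T2 => P (f @^-1` A).
Local Notation Q := (push mf).

Lemma measurable_preim A : measurable A -> measurable (f @^-1` A).
Proof. by move=> mA; rewrite -[X in measurable X]setTI; exact: mf. Qed.

Let push0 : Q set0 = 0%E.
Proof. by rewrite /push preimage_set0 measure0. Qed.

Let push_ge0 A : (0 <= Q A)%E.
Proof. exact: measure_ge0. Qed.

Let push_sigma_additive : semi_sigma_additive Q.
Proof.
move=> F mF tF mUF; rewrite /push preimage_bigcup.
apply: measure_semi_sigma_additive.
- by move=> n; exact: measurable_preim.
- apply/trivIsetP => /= i j _ _ ij; rewrite -preimage_setI.
  by move/trivIsetP : tF => /(_ _ _ _ _ ij) ->//; rewrite preimage_set0.
- by rewrite -preimage_bigcup; exact: measurable_preim.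
Qed.

Let push_setT : Q setT = 1%E.
Proof. by rewrite /push preimage_setT; exact: probability_setT. Qed.

HB.instance Definition _ := isMeasure.Build _ _ _ Q push0 push_ge0 push_sigma_additive.
HB.instance Definition _ := Measure_isProbability.Build _ _ _ Q push_setT.
End push.

Definition law_is d1 d2 (T1 : measurableType d1) (T2 : measurableType d2)
    (R : realType) (P : probability T1 R) (f : T1 -> T2) (Q : probability T2 R) :=
  forall A, measurable A -> P (f @^-1` A) = Q A.

Section product_laws.
Context {R : realType}.

Lemma law_is_prod d1 d2 d3 d4 (T1 : measurableType d1) (T2 : measurableType d2)
    (U1 : measurableType d3) (U2 : measurableType d4)
    (P1 : probability T1 R) (P2 : probability T2 R)
    (Q1 : probability U1 R) (Q2 : probability U2 R) (f : T1 -> U1) (g : T2 -> U2) :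
  measurable_fun setT f -> measurable_fun setT g ->
  law_is P1 f Q1 -> law_is P2 g Q2 ->
  law_is (P1 \x P2)%E (fun z => (f z.1, g z.2)) (Q1 \x Q2)%E.
Proof.
move=> mf mg fPQ gPQ A mA.
have mh : measurable_fun setT (fun z : T1 * T2 => (f z.1, g z.2)).
  apply/measurable_fun_pairP; split.
    exact: (measurableT_comp mf measurable_fst).
  exact: (measurableT_comp mg measurable_snd).
apply/esym/(@product_measure_unique _ _ _ _ _ Q1 Q2 (push (P1 \x P2)%E mh)) => //.
move=> B C mB mC; rewrite /= -fPQ// -gPQ//.
transitivity ((P1 \x P2)%E ((f @^-1` B) `*` (g @^-1` C))); first by [].
by rewrite product_measure1E//; exact: measurable_preim.
Qed.

Lemma law_is_swap d1 d2 (T1 : measurableType d1) (T2 : measurableType d2)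
    (P1 : probability T1 R) (P2 : probability T2 R) :
  law_is (P1 \x P2)%E (fun z => (z.2, z.1)) (P2 \x P1)%E.
Proof.
move=> A mA.
have mh : measurable_fun setT (fun z : T1 * T2 => (z.2, z.1)).
  by apply/measurable_fun_pairP; split; [exact: measurable_snd|exact: measurable_fst].
apply/esym/(@product_measure_unique _ _ _ _ _ P2 P1 (push (P1 \x P2)%E mh)) => //.
move=> B C mB mC.
transitivity ((P1 \x P2)%E (C `*` B)).
  by congr ((P1 \x P2)%E _); apply/seteqP; split=> z [].
by rewrite product_measure1E//= muleC.
Qed.

Lemma law_is_assoc d1 d2 d3 (T1 : measurableType d1) (T2 : measurableType d2)
    (T3 : measurableType d3)
    (P1 : probability T1 R) (P2 : probability T2 R) (P3 : probability T3 R) :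
  law_is ((P1 \x P2) \x P3)%E (fun z => (z.1.1, (z.1.2, z.2))) (P1 \x (P2 \x P3))%E.
Proof.
move=> A mA.
have mh : measurable_fun setT (fun z : (T1 * T2) * T3 => (z.1.1, (z.1.2, z.2))).
  apply/measurable_fun_pairP; split.
    exact: (measurableT_comp measurable_fst measurable_fst).
  apply/measurable_fun_pairP; split; last exact: measurable_snd.
  exact: (measurableT_comp measurable_snd measurable_fst).
have mA' := measurable_preim mh mA.
set A' := _ @^-1` A in mA' *.
transitivity (\int[(P1 \x P2)%E]_z (P3 (xsection A' z)))%E; first by [].
rewrite fubini_tonelli1; [|exact: measurable_fun_xsection|by move=> z; exact: measure_ge0].
apply: eq_integral => x _.
apply: eq_integral => y _ /=.
congr (P3 _); apply/seteqP; split=> z; rewrite /xsection /A' /= !inE /=.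
  by move=> h; rewrite inE.
by rewrite inE.
Qed.

Lemma law_is_comp d1 d2 d3 (T1 : measurableType d1) (T2 : measurableType d2)
    (T3 : measurableType d3)
    (P1 : probability T1 R) (P2 : probability T2 R) (P3 : probability T3 R)
    (f : T1 -> T2) (g : T2 -> T3) : measurable_fun setT g ->
  law_is P1 f P2 -> law_is P2 g P3 -> law_is P1 (fun x => g (f x)) P3.
Proof.
move=> mg fP gP A mA; rewrite -gP// -fP//; exact: measurable_preim.
Qed.

Lemma real_law_unique (P Q : probability R R) :
  (forall c, P [set x | c < x] = Q [set x | c < x]) ->
  forall A, measurable A -> P A = Q A.
Proof.
move=> PQ A mA.
pose G := [set [set x : R | c < x] | c in setT].
have Gm : G `<=` measurable.
  by move=> _ [c _ <-]; exact: measurable_set_lt.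
have sA : <<s G >> A.
  have mid : measurable_fun setT (id : g_sigma_algebraType G -> R).
    by apply: measurable_fun_gt => c; apply: sub_sigma_algebra; exists c.
  by have := mid measurableT A mA; rewrite setTI.
apply: (@g_sigma_algebra_measure_unique _ _ _ G Gm (fun n => [set x | - n%:R < x])) => //.
- by move=> n; exists (- n%:R).
- apply/seteqP; split=> // x _; exists (Num.truncn (- x)).+1 => //=.
  by rewrite ltrNl truncnS_gt.
- move=> _ _ [c _ <-] [c' _ <-]; exists (Order.max c c') => //.
  by apply/seteqP; split=> x /=; rewrite gt_max; [move=> /andP|move=> [-> ->]].
- by move=> _ [c _ <-]; exact: PQ.
- move=> n; apply: le_lt_trans (probability_le1 _ _) _; last by rewrite ltry.
  exact: measurable_set_lt.
Qed.

End product_laws.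

(** * Locality of the glued metric *)

Definition glue_point (u : {e : Gedge & Vinf}) : Vinf := copy (tag u) (tagged u).

(** The vertices of the finite graph of level [k]. *)
Definition inV (k : nat) (x : Vinf) : bool :=
  if x is VMid w then (size w < k)%N else true.

Lemma inV_copy k y : inV k.+1 y -> exists e x, inV k x /\ y = copy e x.
Proof.
case: y => [||[|e w]] h.
- by exists E1, VIn.
- by exists E3, VOut.
- by exists E1, VOut.
- by exists e, (VMid w).
Qed.

Lemma inV_copy' k e x : inV k x -> inV k.+1 (copy e x).
Proof. by case: x => [||w] //=; case: e. Qed.

Section locality.
Context {R : realType}.

(** Every cell of the glued space may be replaced by its subspace of vertices of
    level [k], which contains its ends. *)
Lemma chain_dist_local (k : nat) (c c' : Gedge -> Vinf -> Vinf -> R) x y :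
  (forall e, is_metric (c e)) -> (forall e, is_metric (c' e)) ->
  (forall e x y, inV k x -> inV k y -> c e x y = c' e x y) ->
  inV k.+1 x -> inV k.+1 y -> chain_dist c glue_point x y = chain_dist c' glue_point x y.
Proof.
move=> cm cm' cc' /inV_copy[e [x0 [hx ->]]] /inV_copy[f [y0 [hy ->]]].
pose X0 (e : Gedge) : Type := {x : Vinf | inV k x}.
pose P0 : Type := {y : Vinf | inV k.+1 y}.
pose i (e : Gedge) (x : X0 e) : Vinf := sval x.
pose a (e : Gedge) : X0 e := exist _ VIn isT.
pose b (e : Gedge) : X0 e := exist _ VOut isT.
pose d0 (e : Gedge) (x y : X0 e) : R := c e (sval x) (sval y).
pose j0 (u : {e & X0 e}) : P0 :=
  exist _ (copy (tag u) (sval (tagged u))) (inV_copy' (tag u) (svalP (tagged u))).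
have P0E (u v : P0) : u = v <-> sval u = sval v.
  split=> [->//|]; case: u v => [u hu] [v hv] /= uv; subst v.
  by rewrite (bool_irrelevance hu hv).
have X0E e' (u v : X0 e') : u = v <-> sval u = sval v.
  split=> [->//|]; case: u v => [u hu] [v hv] /= uv; subst v.
  by rewrite (bool_irrelevance hu hv).
have d0met e' : is_metric (@d0 e').
  have [m1 m2 m3 m4] := cm e'; split=> [u|u v /m2|u v|u v w]; rewrite /d0 //.
  by move/X0E.
have j0P : is_gluing a b j0.
  split=> [p|u v].
    have [e' [z [hz pE]]] := inV_copy (svalP p).
    by exists (existT _ e' (exist _ z hz)); apply/P0E.
  rewrite P0E /j0 /=.
  have := copy_gluing.2 (existT _ (tag u) (sval (tagged u))) (existT _ (tag v) (sval (tagged v))).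
  move=> /= ->; split.
    case.
      case: u v => [e1 u] [e2 v] /= uv.
      have e12 : e1 = e2 := congr1 (@tag _ _) uv.
      subst e2; left; congr existT; apply/X0E.
      exact: (eq_from_Tagged uv).
    move=> [w [h1 h2]]; right; exists w.
    have at_im (z : {e & X0 e}) : at_vertex (fun=> VIn) (fun=> VOut)
        (existT (fun=> Vinf) (tag z) (sval (tagged z))) w -> at_vertex a b z w.
      by move=> [[z1 z2]|[z1 z2]]; [left|right]; split=> //; apply/X0E.
    by split; exact: at_im.
  move=> [->|[w [h1 h2]]]; first by left.
  right; exists w.
  have at_im (z : {e & X0 e}) : at_vertex a b z w -> at_vertex (fun=> VIn) (fun=> VOut)
      (existT (fun=> Vinf) (tag z) (sval (tagged z))) w.
    by move=> [[z1 z2]|[z1 z2]]; [left|right]; split=> //=; rewrite z1.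
  by split; exact: at_im.
have is1 e' (u v : X0 e') : c e' (i e' u) (i e' v) = d0 e' u v by [].
have is2 e' (u v : X0 e') : c' e' (i e' u) (i e' v) = d0 e' u v.
  by rewrite /d0 cc' ?(svalP u) ?(svalP v).
have h1 := chain_dist_sub d0met cm is1 j0P copy_gluing
  (existT _ e (exist _ x0 hx)) (existT _ f (exist _ y0 hy)).
have h2 := chain_dist_sub d0met cm' is2 j0P copy_gluing
  (existT _ e (exist _ x0 hx)) (existT _ f (exist _ y0 hy)).
by rewrite [LHS]h1 [RHS]h2.
Qed.

(** Chains of two steps give the upper bound. For the lower bound, [G] is the
    function that grows like the distance to the initial point of the cell, cut
    off at the value prescribed at its final point; it is 1-Lipschitz on each
    cell. *)
Lemma chain_dist_ends (c : Gedge -> Vinf -> Vinf -> R) :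
  (forall e, is_metric (c e)) ->
  chain_dist c glue_point VIn VOut =
  Order.min (c E1 VIn VOut) (c E2 VIn VOut) + Order.min (c E3 VIn VOut) (c E4 VIn VOut).
Proof.
move=> cm; have conn := gluing_conn copy_gluing.
set m1 := Order.min (c E1 _ _) _; set m2 := Order.min (c E3 _ _) _.
have c0 e x : c e x x = 0 by have [] := cm e.
have m10 : 0 <= m1 by rewrite /m1 le_min !(is_metric_ge0 (cm _)).
have m20 : 0 <= m2 by rewrite /m2 le_min !(is_metric_ge0 (cm _)).
apply/eqP; rewrite eq_le; apply/andP; split.
  have [e1 e1P h1] : exists2 e, Gsrc e = GI /\ Gtgt e = GM & c e VIn VOut = m1.
    by rewrite /m1 /Order.min; case: ifP => _; [exists E1|exists E2].
  have [e2 e2P h2] : exists2 e, Gsrc e = GM /\ Gtgt e = GO & c e VIn VOut = m2.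
    by rewrite /m2 /Order.min; case: ifP => _; [exists E3|exists E4].
  have := @chain_dist_le _ _ c _ glue_point cm VIn VOut
    [:: existT _ e1 (VIn, VOut); existT _ e2 (VIn, VOut)].
  rewrite /chain_length !big_cons big_nil addr0 /step_length /= h1 h2; apply.
  by rewrite /glue_point /= !(e1P.1, e1P.2, e2P.1, e2P.2).
pose g (u : {e : Gedge & Vinf}) : R := match tag u with
  | E1 | E2 => Order.min (c (tag u) VIn (tagged u)) m1
  | E3 | E4 => m1 + Order.min (c (tag u) VIn (tagged u)) m2 end.
pose G (y : Vinf) : R := match y with
  | VIn => 0 | VOut => m1 + m2 | VMid [::] => m1 | VMid (e :: w) => g (existT _ e (VMid w)) end.
have gG u : g u = G (glue_point u).
  case: u => e x; rewrite /glue_point /=.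
  by case: e; case: x => [||w] //=; rewrite /g /= ?c0; [apply/min_idPl|apply/min_idPr; rewrite /m1 ge_min lexx|
    apply/min_idPl|apply/min_idPr; rewrite /m1 ge_min lexx orbT|
    rewrite (min_idPl _)// addr0|congr (_ + _); apply/min_idPr; rewrite /m2 ge_min lexx|
    rewrite (min_idPl _)// addr0|congr (_ + _); apply/min_idPr; rewrite /m2 ge_min lexx orbT].
have := @chain_dist_lip _ _ c _ glue_point conn g.
move=> /(_ _ _ (existT _ E3 VOut) (existT _ E1 VIn)).
have -> : g (existT _ E3 VOut) = m1 + m2 by rewrite gG.
have -> : g (existT _ E1 VIn) = 0 by rewrite gG.
rewrite subr0 (chain_distC cm conn); apply.
  by move=> u v uv; rewrite !gG uv.
move=> e x y.
have lip : c e VIn x - c e VIn y <= c e x y.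
  by have [_ _ h1 h2] := cm e; have := h2 y VIn x; rewrite (h1 y x); lra.
have ge0 := is_metric_ge0 (cm e) x y.
have mlip (p q r s : R) : p - q <= s -> 0 <= s -> Order.min p r - Order.min q r <= s.
  by move=> *; rewrite /Order.min; case: ifP; case: ifP => /= h h'; move: h h' => /= ; lra.
have addK (p q r : R) : p + q - (p + r) = q - r by rewrite opprD addrACA subrr add0r.
rewrite /g; clearbody m1 m2; case: e lip ge0 => lip ge0.
- exact: mlip lip ge0.
- exact: mlip lip ge0.
- by rewrite [X in X <= _]addK; exact: mlip lip ge0.
- by rewrite [X in X <= _]addK; exact: mlip lip ge0.
Qed.

End locality.

(** * Laws that agree on a level *)

Section projection.
Context {R : realType}.
Local Notation M := (borel (Mspace R)).

Definition reduceV (k : nat) (x : Vinf) : Vinf := if inV k x then x else VIn.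
Definition weightV (k : nat) (x : Vinf) : R := (~~ inV k x)%:R.

Definition proj_dist (k : nat) (d : Mspace R) (x y : Vinf) : R :=
  if x == y then 0 else Mdist d (reduceV k x) (reduceV k y) + weightV k x + weightV k y.

Lemma proj_dist_metric k d : is_metric (proj_dist k d).
Proof.
have [d0 dp dC dT] := Mdist_metric d; have dge := is_metric_ge0 (Mdist_metric d).
have w0 x : 0 <= weightV k x by rewrite /weightV.
have p0 x y : 0 <= proj_dist k d x y.
  by rewrite /proj_dist; case: ifP => // _; rewrite !addr_ge0.
split=> [x|x y|x y|y x z]; rewrite /proj_dist.
- by rewrite eqxx.
- case: eqP => // _ h.
  have [hx hy hd] : [/\ weightV k x = 0, weightV k y = 0 & Mdist d (reduceV k x) (reduceV k y) = 0].
    have := w0 x; have := w0 y; have := dge (reduceV k x) (reduceV k y); move: h.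
    move: (weightV k x) (weightV k y) (Mdist _ _ _) => u v w *; split; lra.
  move/dp: hd; move: hx hy; rewrite /weightV /reduceV.
  case: (inV k x) => /=; last by move=> /eqP; rewrite oner_eq0.
  by case: (inV k y) => /=; last by move=> _ /eqP; rewrite oner_eq0.
- by rewrite eq_sym; case: eqP => // _; rewrite dC addrAC.
- have [->|xz] := eqVneq x z; first by rewrite addr_ge0// ?p0 //; exact: p0.
  have [<-|xy] := eqVneq x y; first by rewrite (negbTE xz) add0r.
  have [->|yz] := eqVneq y z; first by rewrite addr0.
  have := dT (reduceV k y) (reduceV k x) (reduceV k z); have := w0 y.
  move: (weightV k x) (weightV k y) (weightV k z) (Mdist _ _ _) (Mdist _ _ _) (Mdist _ _ _) => *.
  lra.
Qed.

(** Forgets all distances except those between vertices of level [k]; the other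
    vertices are attached to [VIn] by edges of length [1], so that the result
    is a point of the same space. *)
Definition projV (k : nat) (d : M) : M := Mspace_of (proj_dist_metric k d).

Lemma proj_eq k (d d' : M) :
  (forall x y, inV k x -> inV k y -> Mdist d x y = Mdist d' x y) -> projV k d = projV k d'.
Proof.
move=> dd'; apply: val_inj; apply: funext => -[x y] /=.
rewrite /proj_dist; case: ifP => // _; congr (_ + _ + _); apply: dd';
  by rewrite /reduceV; case: ifP.
Qed.

Lemma Mdist_proj k (d : M) x y : inV k x -> inV k y ->
  Mdist (projV k d) x y = Mdist d x y.
Proof.
move=> hx hy; rewrite [LHS]/(Mdist _ _ _) /= /proj_dist /reduceV hx hy.
rewrite /weightV hx hy !addr0; case: eqP => // ->.
by have [-> _ _ _] := Mdist_metric d.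
Qed.

Lemma measurable_proj k : measurable_fun setT (projV k).
Proof.
apply: measurable_into_M => x y.
have [xy|xy] := boolP (x == y).
  rewrite (_ : (fun t => _) = cst 0); first exact: measurable_cst.
  by apply: funext => t; rewrite [LHS]/(Mdist _ _ _) /= /proj_dist xy.
rewrite (_ : (fun t => _) = (fun t : M => Mdist t (reduceV k x) (reduceV k y) + (weightV k x + weightV k y))).
  by apply: measurable_funD; [exact: measurable_Mdist|exact: measurable_cst].
by apply: funext => t; rewrite [LHS]/(Mdist _ _ _) /= /proj_dist (negbTE xy) addrA.
Qed.

Definition agree (k : nat) (P Q : probability M R) :=
  forall A, measurable A -> P (projV k @^-1` A) = Q (projV k @^-1` A).

Definition inVbox k (s : seq ((Vinf * Vinf) * rat)) :=
  all (fun i => inV k i.1.1 && inV k i.1.2) s.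

Lemma lbox_proj k s : inVbox k s -> projV k @^-1` lbox s = lbox s.
Proof.
move=> /allP h; apply/seteqP; split=> d /= hd i his.
  by have := hd i his; have /andP[h1 h2] := h _ his; rewrite Mdist_proj.
by have /andP[h1 h2] := h _ his; rewrite Mdist_proj//; exact: hd.
Qed.

Lemma agree_lbox k P Q s : inVbox k s -> agree k P Q -> P (lbox s) = Q (lbox s).
Proof.
move=> ks PQ; rewrite -(lbox_proj ks); apply: PQ; exact: measurable_lbox.
Qed.

Lemma inV_level x : exists k, inV k x.
Proof. by case: x => [||w]; [exists 0%N|exists 0%N|exists (size w).+1 => /=]. Qed.

Lemma inV_le k k' x : (k <= k')%N -> inV k x -> inV k' x.
Proof. by case: x => //= w kk' h; exact: leq_trans kk'. Qed.

Lemma inVbox_le k k' s : (k <= k')%N -> inVbox k s -> inVbox k' s.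
Proof.
move=> kk'; apply: sub_all => i /andP[h1 h2].
by rewrite !(inV_le kk').
Qed.

Lemma inVbox_level s : exists k, inVbox k s.
Proof.
elim: s => [|[[x y] q] s [k ks]]; first by exists 0%N.
have [kx hx] := inV_level x; have [ky hy] := inV_level y.
exists (maxn k (maxn kx ky)); rewrite /inVbox /=.
rewrite (inV_le _ hx) ?(inV_le _ hy) ?leq_max ?leqnn ?orbT//=.
by apply: inVbox_le ks; rewrite leq_max leqnn.
Qed.

Lemma agree_all P Q : (forall k, agree k P Q) -> forall A, measurable A -> P A = Q A.
Proof.
move=> PQ; apply: M_law_unique => s.
by have [k ks] := inVbox_level s; exact: agree_lbox (PQ k).
Qed.

Lemma agree_trans k Q P S : agree k P Q -> agree k Q S -> agree k P S.
Proof. by move=> h1 h2 A mA; rewrite h1// h2. Qed.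

Lemma agree_sym k P Q : agree k P Q -> agree k Q P.
Proof. by move=> h A mA; rewrite h. Qed.

Lemma agree_le k k' P Q : (k <= k')%N -> agree k' P Q -> agree k P Q.
Proof.
move=> kk' h A mA.
have E : projV k @^-1` A = projV k' @^-1` (projV k @^-1` A).
  rewrite -comp_preimage; congr (_ @^-1` A); apply: funext => d /=.
  by apply: proj_eq => x y hx hy; rewrite Mdist_proj// (inV_le kk').
by rewrite E h//; exact: (measurable_preim (measurable_proj k)).
Qed.

Lemma agree_of_lbox k (P Q : probability M R) : (forall s, inVbox k s -> P (lbox s) = Q (lbox s)) ->
  agree k P Q.
Proof.
move=> PQ.
have mp := measurable_proj k.
suff : forall A, measurable A -> push P mp A = push Q mp A by [].
apply: M_law_unique => s; rewrite /= /push.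
(* a lower bound on a distance of the reduced metric is void, impossible, or a
   lower bound on a distance of level [k] *)
suff [[t [kt ->]]|->] : (exists t, inVbox k t /\ projV k @^-1` lbox s = lbox t) \/
    projV k @^-1` lbox s = set0.
- exact: PQ.
- by rewrite !measure0.
elim: s => [|[[x y] q] s ih].
  by left; exists [::]; split=> //; rewrite lbox_nil.
rewrite lbox_cons preimage_setI /=.
case: ih => [[t [kt ->]]|->]; last by right; rewrite setI0.
have [xy|xy] := boolP (x == y).
  have [q0|q0] := boolP (ratr q < 0 :> R).
    left; exists t; split=> //; rewrite -[RHS]setTI; congr (_ `&` _).
    by apply/seteqP; split=> // d _; rewrite /= [X in _ < X]/(Mdist _ _ _) /= /proj_dist xy.
  right; rewrite -[RHS](set0I (lbox t)); congr (_ `&` _).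
  apply/seteqP; split=> // d; rewrite /= [X in _ < X]/(Mdist _ _ _) /= /proj_dist xy => h.
  by rewrite h in q0.
have [q' q'E] : exists q' : rat, ratr q' = ratr q - (weightV k x + weightV k y) :> R.
  exists (q - ((~~ inV k x)%:R + (~~ inV k y)%:R)).
  by rewrite rmorphB rmorphD /= !ratr_nat.
left; exists (((reduceV k x, reduceV k y), q') :: t); split.
  rewrite [inVbox _ _]/= -/(inVbox k t) kt andbT /= /reduceV.
  by case hx: (inV k x); case hy: (inV k y); rewrite /= ?hx ?hy.
rewrite lbox_cons; congr (_ `&` _); apply/seteqP; split=> d;
  rewrite /= q'E [X in _ < X -> _]/(Mdist _ _ _) [X in _ -> _ < X]/(Mdist _ _ _) /= /proj_dist (negbTE xy) /Mdist /=;
  by rewrite ltrBlDr addrA.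
Qed.

End projection.

(** * The operator on laws *)

Section operator_step.
Context {R : realType}.
Local Notation M := (borel (Mspace R)).
Local Notation S := (borel (Rpos R)).

Lemma measurable_val : measurable_fun setT (fun z : S => \val z : R).
Proof.
apply: measurable_fun_gt => c; apply: open_borel.
exists [set y | c < y]; last by [].
by rewrite (_ : [set y | c < y] = `]c, +oo[%classic); [exact: interval_open|apply/seteqP; split=> y /=; rewrite in_itv/= andbT].
Qed.

Lemma cells_metric (d : M * M * M * M) e : is_metric (cells d e).
Proof. by case: e; exact: Mdist_metric. Qed.

Lemma measurable_fun_compose d1 d2 d3 (T1 : measurableType d1) (T2 : measurableType d2)
    (T3 : measurableType d3) (g : T2 -> T3) (f : T1 -> T2) :
  measurable_fun setT g -> measurable_fun setT f ->
  measurable_fun setT (fun x => g (f x)).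
Proof. by move=> mg mf; exact: (measurableT_comp mg mf). Qed.

Section coordinates4.
Context d d' (T : measurableType d) (T' : measurableType d') (f : T -> T').
Hypothesis mf : measurable_fun setT f.
Notation T4 := (T * T * T * T)%type.
Lemma measurable_coord1 : measurable_fun setT (fun z : T4 => f z.1.1.1).
Proof.
by apply: (measurable_fun_compose mf); apply: (measurable_fun_compose measurable_fst);
  apply: (measurable_fun_compose measurable_fst); exact: measurable_fst.
Qed.
Lemma measurable_coord2 : measurable_fun setT (fun z : T4 => f z.1.1.2).
Proof.
by apply: (measurable_fun_compose mf); apply: (measurable_fun_compose measurable_snd);
  apply: (measurable_fun_compose measurable_fst); exact: measurable_fst.
Qed.
Lemma measurable_coord3 : measurable_fun setT (fun z : T4 => f z.1.2).
Proof.
by apply: (measurable_fun_compose mf); apply: (measurable_fun_compose measurable_snd); exact: measurable_fst.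
Qed.
Lemma measurable_coord4 : measurable_fun setT (fun z : T4 => f z.2).
Proof. by apply: (measurable_fun_compose mf); exact: measurable_snd. Qed.
End coordinates4.

Lemma measurable_cells e x y : measurable_fun setT (fun d : M * M * M * M => cells d e x y).
Proof.
case: e.
- exact: (measurable_coord1 (@measurable_Mdist R x y)).
- exact: (measurable_coord2 (@measurable_Mdist R x y)).
- exact: (measurable_coord3 (@measurable_Mdist R x y)).
- exact: (measurable_coord4 (@measurable_Mdist R x y)).
Qed.

Lemma measurable_chain_length (c : seq (step (fun _ : Gedge => Vinf))) :
  measurable_fun setT (fun d : M * M * M * M => chain_length (cells d) c).
Proof.
apply: measurable_sum => s; exact: measurable_cells.
Qed.

Lemma measurable_chain_dist x y :
  measurable_fun setT (fun d : M * M * M * M => chain_dist (cells d) glue_point x y).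
Proof.
rewrite (_ : (fun d => _) = (fun d : M * M * M * M => - (- chain_dist (cells d) glue_point x y))); last first.
  by apply: funext => d; rewrite opprK.
apply: measurable_funN.
apply: measurable_fun_gt => t.
rewrite (_ : [set d | _] = [set d : M * M * M * M | exists c : seq {e : Gedge & (Vinf * Vinf)%type},
    is_chain glue_point x y c /\ chain_length (cells d) c < - t]).
  apply: measurable_ex_countable => c.
  have [h|h] := pselect (is_chain glue_point x y c); last first.
    by rewrite [X in measurable X](_ : _ = set0)//; apply/seteqP; split=> d //= [].
  rewrite [X in measurable X](_ : _ = [set d | chain_length (cells d) c < - t]).
    by apply: measurable_set_lt; [exact: measurable_chain_length|exact: measurable_cst].
  by apply/seteqP; split=> d //= [].
apply/seteqP; split=> d /=.
  rewrite ltrNr => dt; apply: contrapT => h.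
  have : - t <= chain_dist (cells d) glue_point x y.
    apply: (chain_dist_ge (gluing_conn copy_gluing)) => c hc.
    by rewrite leNgt; apply/negP => ct; apply: h; exists c.
  by rewrite leNgt dt.
move=> [c [hc ct]]; rewrite ltrNr; apply: le_lt_trans ct.
exact: (chain_dist_le (cells_metric d) hc).
Qed.

Lemma measurable_Rglue lambda :
  measurable_fun setT (@Rglue R lambda : (M * M * M * M * S)%type -> M).
Proof.
apply: measurable_into_M => x y.
rewrite (_ : (fun t => _) = (fun p : M * M * M * M * S =>
  \val lambda * \val p.2 * chain_dist (cells p.1) glue_point x y)); last by [].
apply: measurable_funM.
  apply: measurable_funM; first exact: measurable_cst.
  exact: (measurableT_comp measurable_val measurable_snd).
exact: (measurableT_comp (measurable_chain_dist x y) measurable_fst).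
Qed.

Lemma law_is_id d (T : measurableType d) (P : probability T R) : law_is P id P.
Proof. by []. Qed.

Lemma measurable_fun2 d1 d2 d3 d4 (T1 : measurableType d1) (T2 : measurableType d2)
    (U1 : measurableType d3) (U2 : measurableType d4) (f : T1 -> U1) (g : T2 -> U2) :
  measurable_fun setT f -> measurable_fun setT g ->
  measurable_fun setT (fun z : T1 * T2 => (f z.1, g z.2)).
Proof.
move=> mf mg; apply/measurable_fun_pairP; split.
  exact: (measurable_fun_compose mf measurable_fst).
exact: (measurable_fun_compose mg measurable_snd).
Qed.

Definition prod4 d d' (T : measurableType d) (U : measurableType d')
  (P : probability T R) (m : probability U R) : probability (T * T * T * T * U)%type R :=
  (P \x P \x P \x P \x m)%E.

Section five_fold.
Context d d' d'' (T : measurableType d) (T' : measurableType d'') (U : measurableType d')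
  (f : T -> T').
Hypothesis mf : measurable_fun setT f.
Variables (P : probability T R) (Q : probability T' R) (m : probability U R).

Definition map4 (p : T * T * T * T * U) : T' * T' * T' * T' * U :=
  (f p.1.1.1.1, f p.1.1.1.2, f p.1.1.2, f p.1.2, p.2).

Lemma law_is_map4 : law_is P f Q -> law_is (prod4 P m) map4 (prod4 Q m).
Proof.
move=> PQ.
have p2 := law_is_prod mf mf PQ PQ; have m2 := measurable_fun2 mf mf.
have p3 := law_is_prod m2 mf p2 PQ; have m3 := measurable_fun2 m2 mf.
have p4 := law_is_prod m3 mf p3 PQ; have m4 := measurable_fun2 m3 mf.
exact: (law_is_prod m4 (@measurable_id _ U setT) p4 (law_is_id m)).
Qed.

Lemma measurable_map4 : measurable_fun setT map4.
Proof.
have m2 := measurable_fun2 mf mf; have m3 := measurable_fun2 m2 mf.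
have m4 := measurable_fun2 m3 mf.
exact: (measurable_fun2 m4 (@measurable_id _ U setT)).
Qed.
End five_fold.

(** Both laws are images of the product of the laws of [f]. *)
Lemma law4_eq d d' d'' (T : measurableType d) (U : measurableType d')
    (V : measurableType d'') (f : T -> T) (mf : measurable_fun setT f)
    (P Q : probability T R) (m : probability U R) (G : T * T * T * T * U -> V) :
  (forall A, measurable A -> P (f @^-1` A) = Q (f @^-1` A)) ->
  measurable_fun setT G -> (forall p, G p = G (map4 f p)) ->
  forall A, measurable A ->
  prod4 P m (G @^-1` A) = prod4 Q m (G @^-1` A).
Proof.
move=> PQ mG GG A mA.
have hP : law_is P f (push Q mf) by [].
have hQ : law_is Q f (push Q mf) by [].
have mGA : measurable (G @^-1` A) by exact: measurable_preim.
have E : G @^-1` A = map4 f @^-1` (G @^-1` A).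
  by apply: funext => p; rewrite /preimage /= -(GG p).
move: (G @^-1` A) mGA E => B mB E.
have h1 := law_is_map4 mf m hP mB; have h2 := law_is_map4 mf m hQ mB.
rewrite -E in h1; rewrite -E in h2.
rewrite h1 h2; reflexivity.
Qed.

Lemma proj_Rglue k lambda (p : M * M * M * M * S) :
  projV k.+1 (Rglue lambda p) = projV k.+1 (Rglue lambda (@map4 _ _ _ M M S (@projV R k) p)).
Proof.
apply: proj_eq => x y hx hy.
transitivity (\val lambda * \val p.2 * chain_dist (cells p.1) glue_point x y); first by [].
transitivity (\val lambda * \val p.2 * chain_dist (cells (@map4 _ _ _ M M S (@projV R k) p).1) glue_point x y); last by [].
congr (_ * _); apply: (@chain_dist_local _ k) => //; [exact: cells_metric|exact: cells_metric|].
by move=> [] u v hu hv /=; rewrite Mdist_proj.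
Qed.

Definition Phi_law (m : probability S R) lambda (P : probability M R) : probability M R :=
  push (prod4 P m) (@measurable_Rglue lambda).

Lemma Phi_lawE m lambda P A : Phi_law m lambda P A = Phi m lambda P A.
Proof. by []. Qed.

(** This is [chain_dist_local] for laws. *)
Lemma agree_step m lambda k P Q : agree k P Q ->
  agree k.+1 (Phi_law m lambda P) (Phi_law m lambda Q).
Proof.
move=> PQ A mA.
apply: (law4_eq (@measurable_proj R k) m PQ _ (@proj_Rglue k lambda) mA).
exact: (measurable_fun_compose (@measurable_proj R k.+1) (@measurable_Rglue lambda)).
Qed.

End operator_step.

(** * Random bits on the unit interval *)

Section ae_generic.
Context d (T : measurableType d) (R : realType) (P : probability T R).

Lemma pr_setI_full A B : measurable A -> measurable B -> pr P B = 1 ->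
  pr P (A `&` B) = pr P A.
Proof.
move=> mA mB B1; apply/eqP; rewrite eq_le; apply/andP; split.
  by apply: pr_le => //; exact: measurableI.
have mC : measurable (~` B) by exact: measurableC.
have C0 : pr P (~` B) = 0 by rewrite pr_setC// B1 subrr.
have mAB : measurable (A `&` B) by exact: measurableI.
rewrite -[leRHS]addr0 -[in leRHS]C0; apply: le_trans (pr_setU P mAB mC).
apply: pr_le => //; first exact: measurableU.
by move=> x Ax; have [Bx|Bx] := pselect (B x); [left|right].
Qed.

Lemma pr_eq_full A A' B : measurable A -> measurable A' -> measurable B -> pr P B = 1 ->
  (forall x, B x -> A x <-> A' x) -> pr P A = pr P A'.
Proof.
move=> mA mA' mB B1 AA'; rewrite -(pr_setI_full mA mB B1) -(pr_setI_full mA' mB B1).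
by congr (pr P _); apply/seteqP; split=> x [Ax Bx]; split=> //; apply/AA'.
Qed.

Lemma pr_full_countable (I : countType) (F : I -> set T) :
  (forall i, measurable (F i)) -> (forall i, pr P (F i) = 1) ->
  measurable [set x | forall i, F i x] /\ pr P [set x | forall i, F i x] = 1.
Proof.
move=> mF F1.
have E : [set x | forall i, F i x] = ~` [set x | exists i, (~` F i) x].
  apply/seteqP; split=> x /=; first by move=> h [i]; apply.
  by move=> h i; apply: contrapT => Fi; apply: h; exists i.
have mE : measurable [set x | exists i, (~` F i) x].
  by apply: measurable_ex_countable => i; exact: measurableC.
split; first by rewrite E; exact: measurableC.
rewrite E pr_setC// (_ : pr P _ = 0) ?subr0//.
apply: EFin_inj; rewrite -(prE P mE).
have -> : [set x | exists i, (~` F i) x] =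
    \bigcup_n (if unpickle n is Some i then ~` F i else set0).
  apply/seteqP; split=> x /=.
    by move=> [i h]; exists (pickle i) => //; rewrite pickleK.
  by move=> [n _]; case: (unpickle n) => [i h|//]; exists i.
apply/(negligibleP P); last apply: negligible_bigcup => n.
  by apply: bigcup_measurable => n _; case: (unpickle n) => [i|] //; exact: measurableC.
case: (unpickle n) => [i|]; last exact: negligible_set0.
have mCi : measurable (~` F i) by exact: measurableC.
by apply/(negligibleP P) => //; have := prE P mCi; rewrite pr_setC// F1 subrr.
Qed.
End ae_generic.

(** Sum over the atoms. *)
Lemma law_countable d1 d2 (T1 : measurableType d1) (T2 : measurableType d2)
    (R : realType) (P : probability T1 R) (Q : probability T2 R) (C : countType)
    (X : T1 -> C) (Y : T2 -> C) :
  (forall c, measurable [set t | X t = c]) -> (forall c, measurable [set t | Y t = c]) ->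
  (forall c, P [set t | X t = c] = Q [set t | Y t = c]) ->
  forall S : set C, P [set t | S (X t)] = Q [set t | S (Y t)].
Proof.
move=> mX mY XY S.
have H d (T : measurableType d) (P' : probability T R) (Z : T -> C) :
    (forall c, measurable [set t | Z t = c]) ->
    P' [set t | S (Z t)] = (\sum_(n <oo) P' (if pickle_inv n is Some c then [set t | Z t = c /\ S c] else set0))%E.
  move=> mZ.
  have mF n : measurable (if pickle_inv n is Some c then [set t | Z t = c /\ S c] else set0).
    case: (pickle_inv n) => [c|] //.
    have [Sc|Sc] := pselect (S c).
      by rewrite [X in measurable X](_ : _ = [set t | Z t = c])//; apply/seteqP; split=> t //= [].
    by rewrite [X in measurable X](_ : _ = set0)//; apply/seteqP; split=> t //= [].
  have -> : [set t | S (Z t)] = \bigcup_n (if pickle_inv n is Some c then [set t | Z t = c /\ S c] else set0).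
    apply/seteqP; split=> t /=.
      by move=> h; exists (pickle (Z t)) => //; rewrite pickleK_inv.
    by move=> [n _]; case: (pickle_inv n) => [c [<-]|].
  apply: measure_semi_bigcup => //.
  - apply/trivIsetP => i j _ _ ij.
    case ui: (pickle_inv i) => [c|]; last by rewrite set0I.
    case uj: (pickle_inv j) => [c'|]; last by rewrite setI0.
    apply/seteqP; split=> // t [[Zc _] [Zc' _]]; move/eqP: ij; apply.
    have hi : pickle c = i by have := @pickle_invK C i; rewrite ui.
    have hj : pickle c' = j by have := @pickle_invK C j; rewrite uj.
    by rewrite -hi -hj -Zc -Zc'.
  - by apply: bigcup_measurable => n _; exact: mF.
rewrite !H//; apply: eq_eseriesr => n _; case: (pickle_inv n) => [c|]; last by rewrite !measure0.
have [Sc|Sc] := pselect (S c).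
  rewrite (_ : [set t | X t = c /\ S c] = [set t | X t = c]); last by apply/seteqP; split=> t //= [].
  by rewrite XY; congr (Q _); apply/seteqP; split=> t //= [].
rewrite (_ : [set t | X t = c /\ S c] = set0); last by apply/seteqP; split=> t //= [].
rewrite (_ : [set t | Y t = c /\ S c] = set0); last by apply/seteqP; split=> t //= [].
by rewrite !measure0.
Qed.

(** The first [n] bits, the last one in front: prolonging a word is then a [cons]. *)
Fixpoint words (b : nat -> bool) (n : nat) : seq bool :=
  if n is n'.+1 then b n' :: words b n' else [::].

Lemma size_words b n : size (words b n) = n.
Proof. by elim: n => //= n ->. Qed.

Lemma words_inj b b' n : words b n = words b' n -> forall i, (i < n)%N -> b i = b' i.
Proof.
elim: n => // n ih /= [bn /ih h] i; rewrite ltnS leq_eqVlt => /orP[/eqP ->//|].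
exact: h.
Qed.

Lemma measurable_words d (T : measurableType d) (b : nat -> T -> bool) n w :
  (forall k, measurable [set t | b k t]) -> measurable [set t | words (b^~ t) n = w].
Proof.
move=> mb; elim: n w => [|n ih] [|c v].
- by rewrite [X in measurable X](_ : _ = setT)//; apply/seteqP; split.
- by rewrite [X in measurable X](_ : _ = set0)//; apply/seteqP; split.
- by rewrite [X in measurable X](_ : _ = set0)//; apply/seteqP; split.
rewrite [X in measurable X](_ : _ = [set t | b n t = c] `&` [set t | words (b^~ t) n = v]).
  apply: measurableI => //; case: c; first exact: mb.
  rewrite [X in measurable X](_ : _ = ~` [set t | b n t]); first exact: measurableC.
  by apply/seteqP; split=> t /=; [move=> ->|move=> /negP/negbTE].
by apply/seteqP; split=> t /=; [move=> [<- <-]|move=> [-> ->]].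
Qed.

Section random_words.
Context {R : realType}.
Local Notation U := (@unif R).
Variable p : seq bool -> R.
Hypothesis p_ge0 : forall w, 0 <= p w.
Hypothesis p_nil : p [::] = 1.
Hypothesis p_split : forall w, p (true :: w) + p (false :: w) = p w.

(** The words of length [n] cut the unit interval into intervals of lengths
    [p w]; each interval is divided by the next bit, [false] first. *)
Fixpoint left_end (w : seq bool) : R :=
  if w is b :: v then left_end v + (if b then p (false :: v) else 0) else 0.

Fixpoint word_at (n : nat) (u : R) : seq bool :=
  if n is n'.+1 then let v := word_at n' u in (left_end v + p (false :: v) <= u) :: v
  else [::].

Definition bit_at (n : nat) (u : R) : bool := head false (word_at n.+1 u).

Lemma word_at_words n u : word_at n u = words (bit_at^~ u) n.
Proof. by elim: n => // n ih; rewrite [RHS]/= -ih. Qed.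

Lemma size_word_at n u : size (word_at n u) = n.
Proof. by rewrite word_at_words size_words. Qed.

Lemma word_atE n u w : 0 <= u < 1 -> size w = n ->
  word_at n u = w <-> left_end w <= u < left_end w + p w.
Proof.
move=> u01; elim: n w => [|n ih] [|b v] //=.
  by rewrite p_nil add0r u01.
move=> [sv]; have h := ih _ sv.
split.
  move=> [bE vE]; rewrite vE in bE.
  have /andP[h1 h2] := h.1 vE; have := p_split v; move: bE.
  case: b => /= bE; last first.
    by rewrite addr0 h1 /= => _; rewrite ltNge bE.
  by move=> ps; rewrite bE /= -addrA [X in _ + X]addrC ps.
have ps := p_split v; have p1 := p_ge0 (true :: v); have p2 := p_ge0 (false :: v).
move=> /andP[h1 h2].
have vE : word_at n u = v.
  apply/h; move: h1 h2; case: b => h1 h2; apply/andP; split; lra.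
rewrite vE; congr (_ :: _); move: h1 h2; case: b => h1 h2; first by rewrite h1.
by apply/negbTE; rewrite -ltNge; move: h2; rewrite addr0.
Qed.

Lemma left_end_bounds w : 0 <= left_end w /\ left_end w + p w <= 1.
Proof.
elim: w => [|b v [h1 h2]] /=; first by rewrite p_nil add0r.
have ps := p_split v; have p1 := p_ge0 (true :: v); have p2 := p_ge0 (false :: v).
by case: b; split; lra.
Qed.

Definition unit_co : set R := [set u | 0 <= u < 1].

Lemma measurable_unit_co : measurable unit_co.
Proof.
rewrite (_ : unit_co = [set` `[0, 1[%R]); first exact: measurable_itv.
by apply/seteqP; split=> u; rewrite /unit_co /= in_itv.
Qed.

Lemma pr_unit_co : pr U unit_co = 1.
Proof. by rewrite /unit_co pr_unif_co ?subr0. Qed.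

Lemma measurable_bit_at n : measurable [set u | bit_at n u].
Proof.
have main k : forall w, measurable [set u | word_at k u = w].
  elim: k => [|k ih] [|b v].
  - by rewrite [X in measurable X](_ : _ = setT)//; apply/seteqP; split.
  - by rewrite [X in measurable X](_ : _ = set0)//; apply/seteqP; split.
  - by rewrite [X in measurable X](_ : _ = set0)//; apply/seteqP; split.
  - rewrite [X in measurable X](_ : _ = [set u | word_at k u = v] `&`
       [set u | (left_end v + p (false :: v) <= u) = b]).
      apply: measurableI => //; case: b.
        by apply: measurable_set_le; [exact: measurable_cst|exact: measurable_id].
      rewrite [X in measurable X](_ : _ = [set u | u < left_end v + p (false :: v)]).
        by apply: measurable_set_lt; [exact: measurable_id|exact: measurable_cst].
      by apply/seteqP; split=> u /=; rewrite ltNge; [move=> ->|move=> /negbTE].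
    apply/seteqP; split=> u /=; first by move=> [<- <-].
    by move=> [-> <-].
rewrite [X in measurable X](_ : _ = [set u | exists w, word_at n.+1 u = true :: w]).
  by apply: measurable_ex_countable => w; exact: main.
apply/seteqP; split=> u /=; rewrite /bit_at /=; last by move=> [w [-> _]].
by move=> ->; exists (word_at n u).
Qed.

Lemma measurable_word_at n w : measurable [set u | words (bit_at^~ u) n = w].
Proof. by apply: measurable_words; exact: measurable_bit_at. Qed.

Lemma pr_words n w : size w = n -> pr U [set u | words (bit_at^~ u) n = w] = p w.
Proof.
move=> sw; have [l0 l1] := left_end_bounds w; have pw := p_ge0 w.
rewrite (@pr_eq_full _ _ _ U _ [set u | left_end w <= u < left_end w + p w] unit_co).
- by rewrite pr_unif_co//; [lra|lra].
- exact: measurable_word_at.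
- rewrite [X in measurable X](_ : _ = [set` `[left_end w, left_end w + p w[%R]); first exact: measurable_itv.
  by apply/seteqP; split=> u; rewrite /= in_itv.
- exact: measurable_unit_co.
- exact: pr_unit_co.
- by move=> u u01; rewrite /= -word_at_words; exact: word_atE.
Qed.

Lemma p_word_at n u : 0 <= u < 1 -> 0 < p (words (bit_at^~ u) n).
Proof.
move=> u01; rewrite -word_at_words.
have /(word_atE u01 (size_word_at n u))/andP[h1 h2] : word_at n u = word_at n u by [].
lra.
Qed.

End random_words.

(** * A random metric with prescribed levels *)

Section extension.
Context {R : realType}.
Local Notation M := (borel (Mspace R)).
Local Notation U := (@unif R).
Local Notation bound := ((Vinf * Vinf) * rat)%type.
Variable mm : nat -> probability M R.
Hypothesis consistent : forall k, agree k (mm k) (mm k.+1).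

Lemma agree_up k k' : (k <= k')%N -> agree k (mm k) (mm k').
Proof.
move=> /subnK <-; elim: (k' - k)%N => [//|n ih]; rewrite addSn.
apply: (agree_trans ih); apply: (agree_le _ (consistent _)); exact: leq_addl.
Qed.

Definition satisfies (d : M) (i : bound) : bool := ratr i.2 < Mdist d i.1.1 i.1.2.

Definition bound_bit (n : nat) (d : M) : bool :=
  if unpickle n is Some i then satisfies d i else false.

Definition level (x : Vinf) : nat := if x is VMid w then (size w).+1 else 0%N.

Definition bit_level (n : nat) : nat :=
  if unpickle n is Some i then maxn (level (i : bound).1.1) (level i.1.2) else 0%N.

Fixpoint bits_level (n : nat) : nat :=
  if n is n'.+1 then maxn (bit_level n') (bits_level n') else 0%N.

Lemma inV_of_level k x : (level x <= k)%N -> inV k x.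
Proof. by case: x. Qed.

Lemma bound_bit_proj k n d : (bit_level n <= k)%N -> bound_bit n (projV k d) = bound_bit n d.
Proof.
rewrite /bit_level /bound_bit; case: (unpickle n) => [i|//].
rewrite geq_max => /andP[h1 h2].
by rewrite /satisfies Mdist_proj//; exact: inV_of_level.
Qed.

Lemma bits_proj k n d : (bits_level n <= k)%N ->
  words (bound_bit^~ (projV k d)) n = words (bound_bit^~ d) n.
Proof.
elim: n => //= n ih; rewrite geq_max => /andP[h1 h2].
by rewrite bound_bit_proj// ih.
Qed.

Lemma measurable_satisfies i : measurable [set d | satisfies d i].
Proof. by apply: open_borel; exact: open_Mdist_gt. Qed.

Lemma measurable_bound_bit n : measurable [set d | bound_bit n d].
Proof.
rewrite /bound_bit; case: (unpickle n) => [i|]; first exact: measurable_satisfies.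
by rewrite [X in measurable X](_ : _ = set0)//; apply/seteqP; split.
Qed.

Lemma measurable_bits n w : measurable [set d | words (bound_bit^~ d) n = w].
Proof. by apply: measurable_words; exact: measurable_bound_bit. Qed.

(** The mass that the laws [mm k] eventually give to a word. *)
Definition word_mass (w : seq bool) : R :=
  pr (mm (bits_level (size w))) [set d | words (bound_bit^~ d) (size w) = w].
Local Notation p := word_mass.

Lemma word_massE k n w : size w = n -> (bits_level n <= k)%N ->
  pr (mm k) [set d | words (bound_bit^~ d) n = w] = p w.
Proof.
move=> <- hk; rewrite /p; set A := [set d | _].
have -> : A = projV (bits_level (size w)) @^-1` A.
  by apply/seteqP; split=> d; rewrite /A /preimage /= bits_proj.
congr fine; apply/esym/(agree_up hk); exact: measurable_bits.
Qed.

Lemma word_mass_ge0 w : 0 <= p w.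
Proof. exact: pr_ge0. Qed.

Lemma word_mass_nil : p [::] = 1.
Proof.
by rewrite /p (_ : [set d | _] = setT) ?pr_setT//; apply/seteqP; split.
Qed.

Lemma word_mass_split w : p (true :: w) + p (false :: w) = p w.
Proof.
set n := size w; have hk : (bits_level n <= bits_level n.+1)%N by rewrite /= leq_maxr.
rewrite -(word_massE (erefl n) hk).
rewrite -(@word_massE (bits_level n.+1) n.+1 (true :: w))//.
rewrite -(@word_massE (bits_level n.+1) n.+1 (false :: w))//.
rewrite -pr_setU_disj; [|exact: measurable_bits|exact: measurable_bits|].
- congr (pr _ _); apply/seteqP; split=> d /=; first by move=> [[_ ->]|[_ ->]].
  by move=> ->; case: (bound_bit n d); [left|right].
- by apply/seteqP; split=> // d [/= [-> _] []].
Qed.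

Definition random_bit (u : R) (i : bound) : bool := bit_at p (pickle i) u.

Lemma seq_pickle_bound (s : seq bound) : exists n, forall i, i \in s -> (pickle i < n)%N.
Proof.
elim: s => [|j s [n h]]; first by exists 0%N.
exists (maxn n (pickle j).+1) => i; rewrite inE => /orP[/eqP ->|/h hi].
  by rewrite leq_max leqnn orbT.
by apply: leq_trans hi _; rewrite leq_maxl.
Qed.

(** Only words of positive mass occur, and these are realized by metrics. All
    the properties of distances that involve finitely many bits carry over to
    the random bits in this way. *)
Lemma rbit_realized (u : R) (s : seq bound) : 0 <= u < 1 ->
  exists d : M, forall i, i \in s -> random_bit u i = satisfies d i.
Proof.
move=> u01; have [n hn] := seq_pickle_bound s.
have := p_word_at word_mass_ge0 word_mass_nil word_mass_split n u01.
set w := words _ n => pw.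
have sw : size w = n by rewrite size_words.
have [d dw] : exists d, words (bound_bit^~ d) n = w.
  apply: contrapT => h; move: pw; rewrite -(word_massE sw (leqnn _)).
  rewrite (_ : [set d | _] = set0) ?pr_set0 ?ltxx//.
  by apply/seteqP; split=> // d dw; apply: h; exists d.
exists d => i /hn hi; have := words_inj dw hi.
by rewrite /bound_bit pickleK /random_bit => <-.
Qed.

Lemma measurable_rbit i : measurable [set u | random_bit u i].
Proof. exact: measurable_bit_at. Qed.

Lemma measurable_rbits (s : seq bound) : measurable [set u | forall i, i \in s -> random_bit u i].
Proof.
elim: s => [|j s ih].
  by rewrite [X in measurable X](_ : _ = setT)//; apply/seteqP; split.
rewrite [X in measurable X](_ : _ = [set u | random_bit u j] `&` [set u | forall i, i \in s -> random_bit u i]).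
  by apply: measurableI => //; exact: measurable_rbit.
apply/seteqP; split=> u /=.
  move=> h; split; first by apply: h; rewrite inE eqxx.
  by move=> i hi; apply: h; rewrite inE hi orbT.
by move=> [h1 h2] i; rewrite inE => /orP[/eqP ->|/h2].
Qed.

Lemma pr_rbits k (s : seq bound) : inVbox k s ->
  pr U [set u | forall i, i \in s -> random_bit u i] = pr (mm k) (lbox s).
Proof.
move=> ks; have [n hn] := seq_pickle_bound s.
pose k' := maxn k (bits_level n).
have -> : pr (mm k) (lbox s) = pr (mm k') (lbox s).
  by congr fine; apply: (agree_lbox ks); apply: agree_up; rewrite leq_maxl.
pose S : set (seq bool) := [set w | exists b, w = words b n /\ forall i, i \in s -> b (pickle i)].
have SE b : S (words b n) <-> forall i, i \in s -> b (pickle i).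
  split; last by exists b.
  by move=> [b' [/esym bb' h]] i hi; rewrite -(words_inj bb' (hn _ hi)); exact: h.
have := @law_countable _ _ _ _ R U (mm k') (seq bool) (fun u => words ((bit_at p)^~ u) n)
  (fun d => words (bound_bit^~ d) n) _ _ _ S.
rewrite /pr => h; congr fine.
transitivity (U [set u | S (words (bit_at p ^~ u) n)]).
  by congr (U _); apply/seteqP; split=> u; rewrite /= SE.
rewrite h.
- congr (mm k' _); apply/seteqP; split=> d; rewrite /= SE => hd i his.
    by have := hd i his; rewrite /bound_bit pickleK.
  by rewrite /bound_bit pickleK; exact: hd.
- exact: measurable_word_at.
- exact: measurable_bits.
- move=> w; have [sw|sw] := eqVneq (size w) n.
    have h1 := pr_words word_mass_ge0 word_mass_nil word_mass_split sw.
    have h2 := word_massE sw (leq_maxr k (bits_level n)).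
    rewrite (prE U (measurable_word_at p n w)) (prE (mm k') (measurable_bits n w)).
    by rewrite h1 h2.
  rewrite (_ : [set t | _] = set0); last first.
    by apply/seteqP; split=> // t /= tw; rewrite -tw size_words eqxx in sw.
  rewrite [in RHS](_ : [set t | _] = set0) ?measure0//.
  by apply/seteqP; split=> // t /= tw; rewrite -tw size_words eqxx in sw.
Qed.

Definition good_bits (u : R) (x y : Vinf) : Prop :=
  (exists q : rat, ~~ random_bit u ((x, y), q)) /\
  (x <> y -> exists2 q : rat, 0 < q & random_bit u ((x, y), q)).

(** The sample points whose bits define finite distances, positive between
    distinct vertices; these two requirements involve infinitely many bits. *)
Definition good : set R := [set u | 0 <= u < 1 /\ forall xy : Vinf * Vinf, good_bits u xy.1 xy.2].

(** Under the laws [mm k] distances are finite and positive; by continuity of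
    probability this holds for the bits as well. *)
Lemma good_bits_full (xy : Vinf * Vinf) :
  measurable [set u | good_bits u xy.1 xy.2] /\ pr U [set u | good_bits u xy.1 xy.2] = 1.
Proof.
case: xy => x y /=.
have [k [kx ky]] : exists k, inV k x /\ inV k y.
  have [kx hx] := inV_level x; have [ky hy] := inV_level y.
  by exists (maxn kx ky); rewrite (inV_le _ hx) ?(inV_le _ hy) ?leq_max ?leqnn ?orbT.
pose A := [set u | exists q : rat, ~~ random_bit u ((x, y), q)].
pose B := [set u | exists q : rat, 0 < q /\ random_bit u ((x, y), q)].
have mA : measurable A.
  apply: measurable_ex_countable => q.
  rewrite [X in measurable X](_ : _ = ~` [set u | random_bit u ((x, y), q)]).
    by apply: measurableC; exact: measurable_rbit.
  by apply/seteqP; split=> u /= /negP.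
have mB : measurable B.
  apply: measurable_ex_countable => q; case: (boolP (0 < q)) => q0.
    rewrite [X in measurable X](_ : _ = [set u | random_bit u ((x, y), q)]); first exact: measurable_rbit.
    by apply/seteqP; split=> u //= [].
  by rewrite [X in measurable X](_ : _ = set0)//; apply/seteqP; split=> u //= [].
have pr1 q : pr U [set u | random_bit u ((x, y), q)] = pr (mm k) [set d | ratr q < Mdist d x y].
  have := @pr_rbits k [:: ((x, y), q)]; rewrite /inVbox /= kx ky => /(_ isT).
  rewrite (_ : [set u | _] = [set u | random_bit u ((x, y), q)]); last first.
    apply/seteqP; split=> u /=; first by apply; rewrite inE.
    by move=> h i; rewrite inE => /eqP ->.
  by rewrite lbox_cons lbox_nil setIT.
have mq q : measurable [set d : M | ratr q < Mdist d x y] by apply: open_borel; exact: open_Mdist_gt.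
have A1 : pr U A = 1.
  apply/eqP; rewrite eq_le pr_le1//=.
  pose F (n : nat) := [set d : M | Mdist d x y <= n%:R].
  have mF n : measurable (F n).
    by apply: measurable_set_le; [exact: measurable_Mdist|exact: measurable_cst].
  have ndF : {homo F : m n / (m <= n)%N >-> m `<=` n}.
    by move=> m n mn d /= dm; apply: le_trans dm _; rewrite ler_nat.
  have := @pr_cvg_bigcup _ _ _ (mm k) F mF ndF.
  rewrite (_ : \bigcup_n F n = setT) ?pr_setT; last first.
    apply/seteqP; split=> // d _; exists (Num.truncn (Mdist d x y)).+1 => //=.
    by apply: ltW; rewrite /F /=; exact: truncnS_gt.
  move=> /cvgr_to_le; apply; apply: nearW => n.
  have -> : F n = ~` [set d | ratr n%:R < Mdist d x y].
    by apply/seteqP; split=> d; rewrite /F /= ratr_nat leNgt => /negP.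
  rewrite pr_setC// -pr1 -pr_setC; last exact: measurable_rbit.
  apply: pr_le => //; first by apply: measurableC; exact: measurable_rbit.
  by move=> u /= /negP h; exists n%:R.
have B1 : x <> y -> pr U B = 1.
  move=> xy; apply/eqP; rewrite eq_le pr_le1//=.
  pose F (n : nat) := [set d : M | ratr (n.+1%:R)^-1 < Mdist d x y].
  have mF n : measurable (F n) by exact: mq.
  have ndF : {homo F : m n / (m <= n)%N >-> m `<=` n}.
    move=> m n mn d /= dm; apply: le_lt_trans dm.
    by rewrite ler_rat lef_pV2 ?posrE// ler_nat.
  have := @pr_cvg_bigcup _ _ _ (mm k) F mF ndF.
  rewrite (_ : \bigcup_n F n = setT) ?pr_setT; last first.
    apply/seteqP; split=> // d _.
    have d0 : 0 < Mdist d x y.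
      rewrite lt_neqAle (is_metric_ge0 (Mdist_metric d)) andbT eq_sym.
      by apply/eqP => h; apply: xy; have [_ + _ _] := Mdist_metric d; apply.
    exists (Num.truncn (Mdist d x y)^-1) => //.
    rewrite /F /= fmorphV /= ratr_nat invf_plt ?posrE//; exact: truncnS_gt.
  move=> /cvgr_to_le; apply; apply: nearW => n.
  rewrite -pr1; apply: pr_le => //; first exact: measurable_rbit.
  by move=> u /= h; exists (n.+1%:R)^-1; rewrite invr_gt0 ltr0n.
have [xy|xy] := pselect (x = y).
  have -> : [set u | good_bits u x y] = A.
    by apply/seteqP; split=> u; [move=> []|move=> h; split].
  by [].
have -> : [set u | good_bits u x y] = A `&` B.
  apply/seteqP; split=> u [h1 h2]; split=> //.
    by have [q q0 h] := h2 xy; exists q.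
  by move=> _; have [q [q0 h]] := h2; exists q.
split; first exact: measurableI.
by rewrite pr_setI_full// B1.
Qed.

Lemma measurable_good : measurable good.
Proof.
apply: measurableI; first exact: measurable_unit_co.
exact: (pr_full_countable (fun i => (good_bits_full i).1) (fun i => (good_bits_full i).2)).1.
Qed.

Lemma pr_good : pr U good = 1.
Proof.
have [m1 p1] := pr_full_countable (fun i => (good_bits_full i).1) (fun i => (good_bits_full i).2).
by rewrite -[RHS](@pr_unit_co R) -(pr_setI_full (@measurable_unit_co R) m1 p1).
Qed.

Definition rdist (u : R) (x y : Vinf) : R :=
  sup [set ratr q | q in [set q : rat | random_bit u ((x, y), q)]].

Section on_good.
Variable u : R.
Hypothesis gu : good u.

Let u01 : 0 <= u < 1.
Proof. by have [] := gu. Qed.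

Let S x y : set R := [set ratr q | q in [set q : rat | random_bit u ((x, y), q)]].

Lemma rbit_mono x y q q' : q' <= q -> random_bit u ((x, y), q) -> random_bit u ((x, y), q').
Proof.
move=> qq'; have [d dE] := rbit_realized [:: ((x, y), q); ((x, y), q')] u01.
rewrite !dE ?inE ?eqxx ?orbT// /satisfies /=.
by apply: le_lt_trans; rewrite ler_rat.
Qed.

Let S_ub x y q : ~~ random_bit u ((x, y), q) -> ubound (S x y) (ratr q).
Proof.
move=> hq _ [q' /= hq' <-]; rewrite ler_rat leNgt; apply/negP => qq'.
by move: hq; rewrite (rbit_mono (ltW qq') hq').
Qed.

Let S_sup x y : has_sup (S x y).
Proof.
split.
  exists (ratr (-1)), (-1) => //=.
  have [d dE] := rbit_realized [:: ((x, y), -1)] u01.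
  rewrite dE ?inE// /satisfies /= rmorphN1.
  by apply: lt_le_trans (is_metric_ge0 (Mdist_metric d) _ _); rewrite ltrN10.
by have [q hq] := (gu.2 (x, y)).1; exists (ratr q); exact: S_ub.
Qed.

Lemma rbit_le x y q : random_bit u ((x, y), q) -> ratr q <= rdist u x y.
Proof. by move=> h; apply: ub_le_sup; [exact: (S_sup x y).2|exists q]. Qed.

Lemma rbitN_ge x y q : ~~ random_bit u ((x, y), q) -> rdist u x y <= ratr q.
Proof.
by move=> h; apply: ge_sup; [exact: (S_sup x y).1|exact: S_ub].
Qed.

Lemma rdist_metric : is_metric (rdist u).
Proof.
have lt_bit x y q : ratr q < rdist u x y -> random_bit u ((x, y), q).
  by move=> h; apply: contraTT h => /rbitN_ge; rewrite -leNgt.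
have gt_bit x y q : rdist u x y < ratr q -> ~~ random_bit u ((x, y), q).
  by move=> h; apply: contraTN h => /rbit_le; rewrite -leNgt.
split.
- move=> x; apply/eqP; rewrite eq_le; apply/andP; split.
    rewrite -(rmorph0 (@ratr R)); apply: rbitN_ge.
    have [d dE] := rbit_realized [:: ((x, x), 0)] u01.
    rewrite dE ?inE// /satisfies /= rmorph0.
    by have [-> _ _ _] := Mdist_metric d; rewrite ltxx.
  rewrite leNgt; apply/negP => /ratr_between[q /andP[q1 q2]].
  have := gt_bit _ _ _ q1; have [d dE] := rbit_realized [:: ((x, x), q)] u01.
  rewrite dE ?inE// /satisfies /=.
  by have [-> _ _ _] := Mdist_metric d; rewrite q2.
- move=> x y d0; apply: contrapT => xy.
  have [q q0 /rbit_le] := (gu.2 (x, y)).2 xy.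
  by rewrite d0 leNgt ltr0q q0.
- move=> x y; rewrite /rdist; congr sup; apply/seteqP; split=> _ [q /= h <-]; exists q => //=.
    have [d dE] := rbit_realized [:: ((x, y), q); ((y, x), q)] u01.
    move: h; rewrite !dE ?inE ?eqxx ?orbT// /satisfies /=.
    by have [_ _ -> _] := Mdist_metric d.
  have [d dE] := rbit_realized [:: ((x, y), q); ((y, x), q)] u01.
  move: h; rewrite !dE ?inE ?eqxx ?orbT// /satisfies /=.
  by have [_ _ -> _] := Mdist_metric d.
- move=> y x z; rewrite leNgt; apply/negP => h.
  set a := rdist u x y in h *; set b := rdist u y z in h *; set c := rdist u x z in h *.
  have [q1 /andP[h1 h2]] := @ratr_between R a (a + (c - (a + b)) / 2) ltac:(lra).
  have [q2 /andP[h3 h4]] := @ratr_between R b (b + (c - (a + b)) / 2) ltac:(lra).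
  have hc : ratr (q1 + q2) < rdist u x z by rewrite rmorphD /= -/c; lra.
  have := lt_bit _ _ _ hc; have := gt_bit _ _ _ h3; have := gt_bit _ _ _ h1.
  have [d dE] := rbit_realized [:: ((x, y), q1); ((y, z), q2); ((x, z), q1 + q2)] u01.
  rewrite !dE ?inE ?eqxx ?orbT// /satisfies /= -!leNgt => k1 k2.
  rewrite ltNge => /negP; apply; rewrite rmorphD /=.
  have [_ _ _ tri] := Mdist_metric d.
  by apply: le_trans (tri y _ _) _; exact: lerD.
Qed.

Lemma lt_rdist x y q : ratr q < rdist u x y ->
  exists n, forall m, (n <= m)%N -> random_bit u ((x, y), q + (m.+1%:R)^-1).
Proof.
move=> h; set a := rdist u x y - ratr q.
have a0 : 0 < a by rewrite subr_gt0.
exists (Num.truncn a^-1) => m hm; apply: contraTT h => /rbitN_ge h; rewrite -leNgt.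
have : (m.+1%:R)^-1 < a.
  rewrite invf_plt ?posrE//; apply: lt_le_trans (truncnS_gt _) _.
  by rewrite ler_nat ltnS.
move: h; rewrite /a rmorphD /= fmorphV /= ratr_nat.
by move: (rdist u x y) (ratr q) (_^-1) => *; lra.
Qed.

Lemma rbit_lt x y q m : random_bit u ((x, y), q + (m.+1%:R)^-1) -> ratr q < rdist u x y.
Proof.
move=> /rbit_le; apply: lt_le_trans; rewrite rmorphD /= ltrDl fmorphV /= ratr_nat.
by rewrite invr_gt0 ltr0n.
Qed.
End on_good.

End extension.

Section extension_law.
Context {R : realType}.
Local Notation M := (borel (Mspace R)).
Local Notation U := (@unif R).
Local Notation bound := ((Vinf * Vinf) * rat)%type.
Variable mm : nat -> probability M R.
Hypothesis consistent : forall k, agree k (mm k) (mm k.+1).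
Local Notation random_bit := (random_bit mm).
Local Notation good := (good mm).
Local Notation rdist := (rdist mm).

Definition rmetric (u : R) : M :=
  if pselect (good u) is left h then Mspace_of (rdist_metric consistent h)
  else (point : Mspace R).

Lemma rmetricE u x y : good u -> Mdist (rmetric u) x y = rdist u x y.
Proof. by move=> gu; rewrite /rmetric; case: pselect. Qed.

Lemma measurable_rmetric : measurable_fun setT rmetric.
Proof.
apply: measurable_into_M => x y; apply: measurable_fun_gt => c.
pose A := [set u | exists q : rat, c < ratr q /\ random_bit u ((x, y), q)].
have mA : measurable A.
  apply: measurable_ex_countable => q; case: (boolP (c < ratr q)) => q0.
    rewrite [X in measurable X](_ : _ = [set u | random_bit u ((x, y), q)]); first exact: measurable_rbit.
    by apply/seteqP; split=> u //= [].
  by rewrite [X in measurable X](_ : _ = set0)//; apply/seteqP; split=> u //= [].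
have mg := measurable_good consistent.
rewrite [X in measurable X](_ : _ = (good `&` A) `|`
    (~` good `&` [set u : R | c < Mdist (point : Mspace R) x y])).
  apply: measurableU; first exact: measurableI.
  apply: measurableI; first exact: measurableC.
  by apply: measurable_set_lt; exact: measurable_cst.
apply/seteqP; split=> u /=.
  move=> h; have [gu|gu] := pselect (good u).
    left; split=> //; move: h; rewrite rmetricE// => /ratr_between[q /andP[q1 q2]].
    exists q; split=> //; apply: contraTT q2 => /(rbitN_ge consistent gu).
    by rewrite -leNgt.
  by right; split=> //; move: h; rewrite /rmetric; case: pselect.
move=> [[gu [q [q1 q2]]]|[gu h]].
  by rewrite rmetricE//; apply: lt_le_trans q1 _; exact: (rbit_le consistent).
by rewrite /rmetric; case: pselect.
Qed.

(** A distance exceeds [q] if and only if the bit of [q + n.+1^-1] is set for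
    some [n]; with bits alone one cannot tell [q < d] from [q <= d]. *)
Definition shift_bounds (n : nat) (s : seq bound) : seq bound :=
  [seq (i.1, i.2 + (n.+1%:R)^-1) | i <- s].

Lemma shift_boundsP n s (P : bound -> Prop) :
  (forall i, i \in shift_bounds n s -> P i) <->
  (forall i, i \in s -> P (i.1, i.2 + (n.+1%:R)^-1)).
Proof.
split=> [h i his|h _ /mapP[i his ->]]; last exact: h.
by apply: h; apply/mapP; exists i.
Qed.

Lemma inVbox_shift n k s : inVbox k s -> inVbox k (shift_bounds n s).
Proof. by rewrite /inVbox all_map. Qed.

Lemma shift_lt_ex (P : nat -> bound -> Prop) (s : seq bound) :
  (forall i, i \in s -> exists n, forall m, (n <= m)%N -> P m i) ->
  exists n, forall i, i \in s -> P n i.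
Proof.
move=> h; suff [n hn] : exists n, forall m, (n <= m)%N -> forall i, i \in s -> P m i.
  by exists n; exact: hn.
elim: s h => [|j s ih] h; first by exists 0%N.
have [|n1 h1] := ih; first by move=> i his; apply: h; rewrite inE his orbT.
have [|n2 h2] := h j; first by rewrite inE eqxx.
exists (maxn n1 n2) => m; rewrite geq_max => /andP[k1 k2] i.
by rewrite inE => /orP[/eqP ->|his]; [exact: h2|exact: h1].
Qed.

(** Both sides are limits, as [n] tends to infinity, of the probabilities of the
    shifted bounds, which are equal. *)
Lemma rmetric_law k : agree k (push U measurable_rmetric) (mm k).
Proof.
apply: agree_of_lbox => s ks.
have ml := measurable_lbox (R := R).
have mg := measurable_good consistent; have g1 := pr_good consistent.
pose A := rmetric @^-1` lbox s.
have mA : measurable A by exact: (measurable_preim measurable_rmetric).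
suff h : pr U A = pr (mm k) (lbox s).
  transitivity (U A); first by [].
  by rewrite (prE U mA) (prE (mm k) (ml s)) h.
pose E n := [set u | forall i, i \in shift_bounds n s -> random_bit u i].
have mE n : measurable (E n) by exact: measurable_rbits.
pose F n := good `&` E n.
have mF n : measurable (F n) by exact: measurableI.
pose G n := lbox (R := R) (shift_bounds n s).
have inv_le m n : (m <= n)%N -> (n.+1%:R)^-1 <= (m.+1%:R)^-1 :> rat.
  by move=> mn; rewrite lef_pV2 ?posrE// ler_nat.
have ndF : {homo F : m n / (m <= n)%N >-> m `<=` n}.
  move=> m n mn u [gu /shift_boundsP h]; split=> //; apply/shift_boundsP => -[[x y] q] his.
  apply: (rbit_mono consistent gu) (h _ his); rewrite lerD2l; exact: inv_le.
have ndG : {homo G : m n / (m <= n)%N >-> m `<=` n}.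
  move=> m n mn d /shift_boundsP h; apply/shift_boundsP => i his /=.
  apply: le_lt_trans (h _ his); rewrite ler_rat lerD2l; exact: inv_le.
have UF : \bigcup_n F n = good `&` A.
  apply/seteqP; split=> u.
    move=> [n _ [gu /shift_boundsP h]]; split=> //= -[[x y] q] his /=.
    by rewrite rmetricE//; apply: (rbit_lt consistent gu (m := n)); exact: h his.
  move=> [gu Au]; have [|n hn] := @shift_lt_ex (fun n i => random_bit u (i.1, i.2 + (n.+1%:R)^-1)) s.
    move=> [[x y] q] his; apply: (lt_rdist consistent gu).
    by have := Au _ his; rewrite /= rmetricE.
  by exists n => //; split=> //; apply/shift_boundsP.
have UG : \bigcup_n G n = lbox s.
  apply/seteqP; split=> d.
    move=> [n _ /shift_boundsP h] i his; apply: lt_trans (h _ his).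
    by rewrite ltr_rat /= ltrDl invr_gt0 ltr0n.
  move=> h; have [|n hn] := @shift_lt_ex (fun n i => ratr (i.2 + (n.+1%:R)^-1) < Mdist d i.1.1 i.1.2) s.
    move=> i his; have := h _ his; set a := Mdist d _ _; rewrite -subr_gt0 => a0.
    exists (Num.truncn (a - ratr i.2)^-1) => m hm; rewrite rmorphD /= fmorphV /= ratr_nat.
    rewrite -ltrBrDl invf_plt ?posrE//; apply: lt_le_trans (truncnS_gt _) _.
    by rewrite ler_nat ltnS.
  by exists n => //; apply/shift_boundsP.
have cF := @pr_cvg_bigcup _ _ _ U F mF ndF.
have cG := @pr_cvg_bigcup _ _ _ (mm k) G (fun n => ml _) ndG.
rewrite UF setIC pr_setI_full// in cF; rewrite UG in cG.
have FG n : pr U (F n) = pr (mm k) (G n).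
  by rewrite /F setIC pr_setI_full// (pr_rbits consistent (inVbox_shift n ks)).
rewrite (_ : (fun n => pr U (F n)) = (fun n => pr (mm k) (G n))) in cF; last exact: funext.
by apply: (cvg_unique _ cF cG).
Qed.

End extension_law.

(** * The one-dimensional equation for random variables *)

Section squared_max.
Context {R : realType}.
Local Notation U := (@unif R).

Definition sqmax (u : R * R) : R := Order.max 0 (Order.max u.1 u.2) ^+ 2.

Lemma measurable_sqmax : measurable_fun setT sqmax.
Proof.
apply: measurable_funX; apply: measurable_maxr; first exact: measurable_cst.
by apply: measurable_maxr; [exact: measurable_fst|exact: measurable_snd].
Qed.

Lemma measurable_le_cst (c : R) : measurable [set u : R | u <= c].
Proof. by apply: measurable_set_le; [exact: measurable_id|exact: measurable_cst]. Qed.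

Lemma pr_unif_le (c : R) : 0 <= c -> pr U [set u | u <= c] = Order.min c 1.
Proof.
move=> c0.
have h c' : 0 <= c' <= 1 -> c' <= c -> c' <= pr U [set u | u <= c].
  move=> c01 cc; rewrite -[leLHS](pr_unif_lt c01); apply: pr_le; last 1 first.
  - by move=> u /= /ltW/le_trans; apply.
  - by apply: measurable_set_lt; [exact: measurable_id|exact: measurable_cst].
  - exact: measurable_le_cst.
have [c1|c1] := leP c 1; last first.
  apply/eqP; rewrite eq_le pr_le1 ?h ?lexx ?ler01 ?ltW//; exact: measurable_le_cst.
have c01 : 0 <= c <= 1 by rewrite c0.
apply/eqP; rewrite eq_le h// ?lexx// andbT.
have m1 : measurable [set u : R | u < c].
  by apply: measurable_set_lt; [exact: measurable_id|exact: measurable_cst].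
have m2 : measurable [set c] by exact: measurable_set1.
have := pr_setU U m1 m2; rewrite (pr_unif_lt c01) (pr_unif_countable (countable1 c) m2) addr0.
apply: le_trans.
apply: pr_le; [exact: measurable_le_cst|exact: measurableU|].
by move=> u /=; rewrite le_eqVlt => /orP[/eqP|]; [right|left].
Qed.

(** [P (max u v <= s) = s ^+ 2]. *)
Lemma law_sqmax : law_is (U \x U)%E sqmax U.
Proof.
suff h : forall A, measurable A -> push (U \x U)%E measurable_sqmax A = U A by exact: h.
have compl (P : probability R R) c : P [set x | c < x] = (1 - (pr P [set x | x <= c])%:E)%E.
  rewrite -(prE P (measurable_le_cst c)) -probability_setC; last exact: measurable_le_cst.
  by congr (P _); apply/seteqP; split=> x /=; rewrite ltNge => /negP.
apply: real_law_unique => c; rewrite !compl; congr (1 - _%:E)%E.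
transitivity (pr (U \x U)%E [set u | sqmax u <= c]); first by [].
have [c0|c0] := ltP c 0.
  rewrite (_ : [set u | _] = set0); last first.
    by apply/seteqP; split=> // u; rewrite /= leNgt (lt_le_trans c0)// /sqmax sqr_ge0.
  rewrite pr_set0; apply/eqP; rewrite eq_le pr_ge0 /=.
  have z01 : 0 <= (0 : R) <= 1 by rewrite lexx ler01.
  rewrite -[leRHS](pr_unif_lt z01); apply: pr_le; [exact: measurable_le_cst| |].
    by apply: measurable_set_lt; [exact: measurable_id|exact: measurable_cst].
  by move=> u /= /le_lt_trans; apply.
have s0 := sqrtr_ge0 c.
rewrite (_ : [set u | _] = [set u | u <= Num.sqrt c] `*` [set u | u <= Num.sqrt c]); last first.
  have sq (a : R) : 0 <= a -> (a ^+ 2 <= c) = (a <= Num.sqrt c).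
    by move=> a0; rewrite -[a in RHS]ger0_norm// -sqrtr_sqr ler_sqrt.
  apply/seteqP; split=> u /=; rewrite /sqmax sq ?le_max ?lexx// !ge_max s0 /=.
    by move=> /andP[].
  by move=> [-> ->].
rewrite pr_prod; [|exact: measurable_le_cst|exact: measurable_le_cst].
rewrite !pr_unif_le// -expr2.
have [c1|c1] := leP c 1.
  rewrite (min_idPl _) ?sqr_sqrtr//.
  by rewrite -[leRHS]sqrtr1 ler_sqrt.
rewrite (min_idPr _) ?expr1n//.
by rewrite -[leLHS]sqrtr1 ler_sqrt// ltW.
Qed.

End squared_max.

Section base_law.
Context {R : realType} d (S : measurableType d) (m : probability S R).
Context (zeta : S -> R).
Hypothesis mz : measurable_fun setT zeta.
Hypothesis z0 : forall s, 0 < zeta s.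
Variables (l : R) (G : R -> R).
Hypothesis Gst : proper_stationary m zeta l G.
Local Notation U := (@unif R).

Let l0 : 0 < l. Proof. by have [[]] := Gst. Qed.
Let sG : survival G. Proof. by have [[]] := Gst. Qed.
Let rG : rcont G. Proof. by have [[]] := Gst. Qed.

Definition quantile (u : R) : R :=
  if 0 < u < 1 then sup [set ratr q | q in [set q : rat | u < G (ratr q)]] else 1.

Lemma lt_quantile u x : 0 < u < 1 -> x < quantile u <-> u < G x.
Proof.
move=> u01; rewrite /quantile u01; set A := [set _ | _ in _].
have [Gle G0 G1 Gneg] := sG; have [u0 u1] := andP u01.
have supA : has_sup A.
  split.
    by exists (ratr (-1)), (-1) => //=; rewrite Gneg// rmorphN1 ltrN10.
  have u20 : 0 < u / 2 by rewrite divr_gt0.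
  have [y hy] := (Gst.2).2 _ u20; exists y => _ [q /= h <-].
  rewrite leNgt; apply/negP => yq; have := Gle _ _ (ltW yq); lra.
split.
  apply: contraTT; rewrite -!leNgt => Gu; apply: ge_sup supA.1 _ => _ [q /= h <-].
  rewrite leNgt; apply/negP => xq.
  by move: h; rewrite ltNge (le_trans (Gle _ _ (ltW xq))).
move=> /rG[y xy uy]; have [q /andP[q1 q2]] := ratr_between xy.
apply: lt_le_trans q1 _; apply: ub_le_sup; first exact: supA.2.
by exists q => //=; apply: lt_le_trans uy _; apply: Gle; exact: ltW.
Qed.

Lemma quantile_gt0 u : 0 < quantile u.
Proof.
have [u01|u01] := boolP (0 < u < 1); last by rewrite /quantile (negbTE u01).
have [u0 u1] := andP u01; have e0 : 0 < (1 - u) / 2 by lra.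
have [x x0 hx] := (Gst.2).1 _ e0.
by apply: lt_trans x0 _; apply/lt_quantile => //; lra.
Qed.

Let mI : measurable [set u : R | 0 < u < 1].
Proof.
rewrite (_ : [set u | _] = [set` `]0, 1[%R]); first exact: measurable_itv.
by apply/seteqP; split=> u; rewrite /= in_itv.
Qed.

Let prI : pr U [set u : R | 0 < u < 1] = 1.
Proof.
have z1 : 0 <= (0 : R) /\ (0 : R) <= 1 by rewrite lexx ler01.
have m2 : measurable [set (0 : R)] by exact: measurable_set1.
apply/eqP; rewrite eq_le pr_le1//=.
have h : pr U [set u : R | 0 <= u < 1] = 1 by rewrite pr_unif_co ?subr0.
have := pr_setU U mI m2; rewrite (pr_unif_countable (countable1 (0 : R)) m2) addr0.
apply: le_trans; rewrite -[X in X <= _]h; apply: pr_le.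
- rewrite (_ : [set u | _] = [set` `[0, 1[%R]); first exact: measurable_itv.
  by apply/seteqP; split=> u; rewrite /= in_itv.
- exact: measurableU.
- by move=> u /= /andP[]; rewrite le_eqVlt => /orP[/eqP <-|-> ->]; [right|left].
Qed.

Lemma measurable_quantile : measurable_fun setT quantile.
Proof.
apply: measurable_fun_gt => c.
rewrite [X in measurable X](_ : _ = ([set u | 0 < u < 1] `&` [set u | u < G c]) `|`
   (~` [set u | 0 < u < 1] `&` [set u : R | c < 1])).
  apply: measurableU; apply: measurableI => //.
  - by apply: measurable_set_lt; [exact: measurable_id|exact: measurable_cst].
  - exact: measurableC.
  - by apply: measurable_set_lt; exact: measurable_cst.
apply/seteqP; split=> u /=.
  have [u01|u01] := boolP (0 < u < 1); first by move=> /(lt_quantile _ u01); left.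
  by rewrite /quantile (negbTE u01); right.
move=> [[u01 h]|[/negP u01 h]]; first exact/lt_quantile.
by rewrite /quantile (negbTE u01).
Qed.

Lemma pr_quantile c : 0 < c -> pr U [set u | c < quantile u] = G c.
Proof.
move=> c0; have [Gle G0 G1 Gneg] := sG.
have c01 : 0 <= G c <= 1 by rewrite G0 G1.
rewrite -[RHS](pr_unif_lt c01); apply: (pr_eq_full _ _ mI prI).
- by apply: measurable_set_lt; [exact: measurable_cst|exact: measurable_quantile].
- by apply: measurable_set_lt; [exact: measurable_id|exact: measurable_cst].
- by move=> u u01; exact: lt_quantile.
Qed.

(** The squared maxima of the two pairs of uniform variables are the two uniform
    variables in the definition of [above]. *)
Definition to_squares (p : R * R * R * R * S) : S * (R * R) :=
  (p.2, (sqmax p.1.1.1, sqmax (p.1.1.2, p.1.2))).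

Lemma measurable_to_squares : measurable_fun setT to_squares.
Proof.
apply/measurable_fun_pairP; split; first exact: measurable_snd.
have m1 : measurable_fun setT (fun p : R * R * R * R => p.1.1).
  by apply: (measurable_fun_compose measurable_fst); exact: measurable_fst.
have m2 : measurable_fun setT (fun p : R * R * R * R => (p.1.2, p.2)).
  apply/measurable_fun_pairP; split; last exact: measurable_snd.
  by apply: (measurable_fun_compose measurable_snd); exact: measurable_fst.
apply/measurable_fun_pairP; split.
  exact: (measurable_fun_compose measurable_sqmax (measurable_fun_compose m1 measurable_fst)).
exact: (measurable_fun_compose measurable_sqmax (measurable_fun_compose m2 measurable_fst)).
Qed.

Lemma law_to_squares : law_is (prod4 U m) to_squares (glue_prob m).
Proof.
have h1 := law_is_assoc (U \x U)%E U U.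
have msq := @measurable_sqmax R.
have h2 := law_is_prod msq msq (@law_sqmax R) (@law_sqmax R).
have ms2 := measurable_fun2 msq msq.
have h12 := law_is_comp ms2 h1 h2.
have massoc : measurable_fun setT (fun z : R * R * R * R => (z.1.1, (z.1.2, z.2))).
  apply/measurable_fun_pairP; split; first exact: (measurableT_comp measurable_fst measurable_fst).
  apply/measurable_fun_pairP; split; last exact: measurable_snd.
  by apply: (measurable_fun_compose measurable_snd); exact: measurable_fst.
have h3 := law_is_prod (measurable_fun_compose ms2 massoc) (@measurable_id _ S setT) h12 (law_is_id m).
have h4 := law_is_swap (U \x U)%E m.
have msw : measurable_fun setT (fun z : (R * R) * S => (z.2, z.1)).
  by apply/measurable_fun_pairP; split; [exact: measurable_snd|exact: measurable_fst].
exact: (law_is_comp msw h3 h4).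
Qed.

Definition series_parallel (p : R * R * R * R * S) : R :=
  l * zeta p.2 * (Order.min p.1.1.1.1 p.1.1.1.2 + Order.min p.1.1.2 p.1.2).

Lemma measurable_series_parallel : measurable_fun setT series_parallel.
Proof.
apply: measurable_funM.
  by apply: measurable_funM => //; exact: (measurable_fun_compose mz measurable_snd).
have m1 := @measurable_coord1 _ _ R R id (@measurable_id _ R setT).
have m2 := @measurable_coord2 _ _ R R id (@measurable_id _ R setT).
have m3 := @measurable_coord3 _ _ R R id (@measurable_id _ R setT).
have m4 := @measurable_coord4 _ _ R R id (@measurable_id _ R setT).
apply: measurable_funD; apply: measurable_minr.
- exact: (measurable_fun_compose m1 measurable_fst).
- exact: (measurable_fun_compose m2 measurable_fst).
- exact: (measurable_fun_compose m3 measurable_fst).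
- exact: (measurable_fun_compose m4 measurable_fst).
Qed.

(** The minimum of two quantiles is the quantile of the maximum. *)
Lemma lt_min_quantile u v x : 0 < u < 1 -> 0 < v < 1 ->
  x < Order.min (quantile u) (quantile v) <-> sqmax (u, v) < G x ^+ 2.
Proof.
move=> u01 v01; have [_ G0 _ _] := sG.
rewrite lt_min /sqmax /=.
have -> : (Order.max 0 (Order.max u v) ^+ 2 < G x ^+ 2) = (Order.max 0 (Order.max u v) < G x).
  by rewrite ltr_pXn2r// nnegrE ?G0// le_max lexx.
rewrite !gt_max.
have -> : (0 < G x) && ((u < G x) && (v < G x)) = (u < G x) && (v < G x).
  by case: (ltP u (G x)) => uG; rewrite ?andbF//= (lt_trans _ uG)//; case/andP: u01.
split=> /andP[h1 h2]; apply/andP; split; exact/(lt_quantile _).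
Qed.

Lemma quantile_equation c :
  pr (prod4 U m) [set p | c < series_parallel (map4 quantile p)] =
  pr U [set u | c < quantile u].
Proof.
have mq4 := measurable_map4 measurable_quantile (U := S).
have msp := measurable_fun_compose measurable_series_parallel mq4.
have [c0|c0] := leP c 0.
  rewrite (_ : [set p | _] = setT) ?pr_setT; last first.
    apply/seteqP; split=> // p _; apply: le_lt_trans c0 _.
    by rewrite /series_parallel mulr_gt0// ?mulr_gt0// addr_gt0// lt_min !quantile_gt0.
  rewrite (_ : [set u | _] = setT) ?pr_setT//.
  by apply/seteqP; split=> // u _; apply: le_lt_trans c0 _; exact: quantile_gt0.
rewrite pr_quantile//; have [[_ _ _ GT] _] := Gst.
rewrite GT// /glue_op; have mab := measurable_above mz G l c.
transitivity (pr (prod4 U m) (to_squares @^-1` above zeta G l c)); last first.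
  by congr fine; exact: law_to_squares.
pose I := [set u : R | 0 < u < 1].
pose B : set (R * R * R * R * S) := I `*` I `*` I `*` I `*` setT.
have mB : measurable B by do 4!apply: measurableX => //.
apply: (pr_eq_full _ _ mB _).
- by apply: measurable_set_lt; [exact: measurable_cst|exact: msp].
- exact: (measurable_preim measurable_to_squares).
- rewrite /B /prod4 pr_prod//; last by do 3!apply: measurableX => //.
  rewrite pr_setT mulr1 pr_prod//; last by do 2!apply: measurableX => //.
  rewrite pr_prod//; last by apply: measurableX.
  by rewrite pr_prod// !prI !mulr1.
- move=> [[[[u1 u2] u3] u4] s] [[[[i1 i2] i3] i4] _] /=.
  rewrite /above /series_parallel /to_squares /=.
  set a := Order.min _ _; set b := Order.min _ _.
  have k0 : 0 < l * zeta s by rewrite mulr_gt0.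
  split.
    rewrite mulrC -ltr_pdivrMr// => h.
    set e := a + b - c / (l * zeta s).
    have e0 : 0 < e by rewrite subr_gt0.
    have [r /andP[r1 r2]] := @ratr_between R (a - e / 2) a ltac:(lra).
    have [t /andP[t1 t2]] := @ratr_between R (b - e / 2) b ltac:(lra).
    exists (r, t); split=> /=.
    + exact/lt_min_quantile.
    + exact/lt_min_quantile.
    + by rewrite mulrC -ltr_pdivrMr//; move: r1 t1; rewrite /e; lra.
  move=> [[r t] [/= h1 h2 h3]]; apply: lt_le_trans h3 _.
  rewrite ler_pM2l//; apply: lerD; apply: ltW; exact/lt_min_quantile.
Qed.

End base_law.

(** * The stationary law *)

Section stationary_metric.
Context {R : realType}.
Local Notation M := (borel (Mspace R)).
Local Notation S := (borel (Rpos R)).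
Local Notation U := (@unif R).

Definition end_dist (d : M) : R := Mdist d VIn VOut.

Lemma measurable_end_dist : measurable_fun setT end_dist.
Proof. exact: measurable_Mdist. Qed.

(** On level [0] there is only one distance. *)
Lemma agree0_end_dist (P Q : probability M R) :
  (forall c, pr P [set d | c < end_dist d] = pr Q [set d | c < end_dist d]) ->
  agree 0 P Q.
Proof.
move=> PQ.
have mt c : measurable [set d : M | c < end_dist d].
  by apply: measurable_set_lt; [exact: measurable_cst|exact: measurable_end_dist].
have E A : measurable A -> P (end_dist @^-1` A) = Q (end_dist @^-1` A).
  move=> mA; have := @real_law_unique R (push P measurable_end_dist) (push Q measurable_end_dist).
  apply=> // c; rewrite /= /push.
  by rewrite (prE P (mt c)) (prE Q (mt c)) PQ.
apply: agree_of_lbox => s ks.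
pose B : set R := [set t | forall i, i \in s ->
  ratr i.2 < (if (i : (Vinf * Vinf) * rat).1.1 == i.1.2 then 0 else t)].
have -> : lbox s = end_dist @^-1` B.
  have dE (d : M) x y : inV 0 x -> inV 0 y -> Mdist d x y = if x == y then 0 else end_dist d.
    have [d0 _ dC _] := Mdist_metric d.
    by case: x => [||w]; case: y => [||w'] //= _ _; rewrite ?d0 ?eqxx//; rewrite dC.
  move/allP : ks => ks; apply/seteqP; split=> d h i his; have /andP[h1 h2] := ks _ his.
    by have := h _ his; rewrite dE.
  by rewrite dE//; exact: (h _ his).
apply: E; rewrite /B; elim: s {ks B} => [|j s ih].
  by rewrite [X in measurable X](_ : _ = setT)//; apply/seteqP; split.
rewrite [X in measurable X](_ : _ = [set t | ratr j.2 < (if j.1.1 == j.1.2 then 0 else t)] `&`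
  [set t | forall i, i \in s -> ratr i.2 < (if i.1.1 == i.1.2 then 0 else t)]).
  apply: measurableI => //; apply: measurable_set_lt; first exact: measurable_cst.
  by case: (j.1.1 == j.1.2); [exact: measurable_cst|exact: measurable_id].
apply/seteqP; split=> t /=.
  move=> h; split; first by apply: h; rewrite inE eqxx.
  by move=> i hi; apply: h; rewrite inE hi orbT.
by move=> [h1 h2] i; rewrite inE => /orP[/eqP ->|/h2].
Qed.

Definition equidistant (c : R) (x y : Vinf) : R := if x == y then 0 else c.

Lemma equidistant_metric c : 0 < c -> is_metric (equidistant c).
Proof.
move=> c0; split=> [x|x y|x y|y x z]; rewrite /equidistant.
- by rewrite eqxx.
- by case: eqP => // _ /eqP; rewrite gt_eqF.
- by rewrite eq_sym.
- have [->|xz] := eqVneq x z; first by rewrite addr_ge0//; case: ifP => _ //; exact: ltW.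
  have [<-|xy] := eqVneq x y; first by rewrite (negbTE xz) add0r.
  by rewrite lerDl; case: ifP => _ //; exact: ltW.
Qed.

Variables (m : probability S R) (lambda : Rpos R) (G : R -> R).
Local Notation zeta := (fun z : S => \val z : R).
Hypothesis Gst : proper_stationary m zeta (\val lambda) G.

Let mz : measurable_fun setT zeta := @measurable_val R.
Let z0 (z : S) : 0 < zeta z := Rpos_gt0 z.
Local Notation quant := (quantile G).

Definition base_metric (u : R) : M :=
  Mspace_of (equidistant_metric (quantile_gt0 Gst u)).

Lemma measurable_base_metric : measurable_fun setT base_metric.
Proof.
apply: measurable_into_M => x y.
have [xy|xy] := boolP (x == y).
  rewrite (_ : (fun t => _) = cst 0); first exact: measurable_cst.
  by apply: funext => t; rewrite [LHS]/(Mdist _ _ _) /= /equidistant xy.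
rewrite (_ : (fun t => _) = quant); first exact: (measurable_quantile Gst).
by apply: funext => t; rewrite [LHS]/(Mdist _ _ _) /= /equidistant (negbTE xy).
Qed.

Definition base_law : probability M R := push U measurable_base_metric.

Lemma end_dist_Rglue (p : M * M * M * M * S) :
  end_dist (Rglue lambda p) = series_parallel zeta (\val lambda) (map4 end_dist p).
Proof.
rewrite /series_parallel /=; transitivity (\val lambda * \val p.2 * chain_dist (cells p.1) glue_point VIn VOut).
  by [].
by rewrite (chain_dist_ends (cells_metric p.1)).
Qed.

(** This is the one-dimensional equation. *)
Lemma agree0_base : agree 0 base_law (Phi_law m lambda base_law).
Proof.
apply: agree0_end_dist => c.
transitivity (pr U [set u | c < quant u]); first by [].
rewrite -(quantile_equation mz z0 Gst c).
have mt : measurable [set d : M | c < end_dist d].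
  by apply: measurable_set_lt; [exact: measurable_cst|exact: measurable_end_dist].
have hb : law_is U base_metric base_law by [].
have h := law_is_map4 measurable_base_metric m hb.
have mA := measurable_preim (@measurable_Rglue R lambda) mt.
transitivity (pr (prod4 base_law m) (@Rglue R lambda @^-1` [set d : M | c < end_dist d])); last by [].
rewrite /pr -(h _ mA); congr fine; congr (prod4 U m _).
by apply/seteqP; split=> p; rewrite /preimage /= end_dist_Rglue.
Qed.

Definition approx_law (k : nat) : probability M R := iter k (Phi_law m lambda) base_law.

Lemma approx_consistent k : agree k (approx_law k) (approx_law k.+1).
Proof.
elim: k => [|k ih]; first exact: agree0_base.
exact: agree_step.
Qed.

Definition limit_metric : R -> M := rmetric approx_consistent.

Lemma measurable_limit_metric : measurable_fun setT limit_metric.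
Proof. exact: measurable_rmetric. Qed.

Definition limit_law : probability M R := push U measurable_limit_metric.

(** The law and its image agree on every level. *)
Lemma limit_law_stationary : stationary m lambda limit_law.
Proof.
move=> A mA; rewrite -Phi_lawE; apply: agree_all mA => k.
have lk j : agree j limit_law (approx_law j) by exact: rmetric_law.
apply: (@agree_le _ k k.+1) => //.
apply: (agree_trans (agree_step m lambda (lk k))); apply: agree_sym; exact: lk.
Qed.

End stationary_metric.

(** * The Radon property *)

Section radon_image.
Context {R : realType}.
Local Notation M := (borel (Mspace R)).
Local Notation U := (@unif R).
Variable f : R -> M.
Hypothesis mf : measurable_fun setT f.

Let fT : R -> Mspace R := f.

Lemma measurable_compact_Mspace (K : set (Mspace R)) : compact K -> measurable (K : set M).
Proof.
move=> cK; rewrite -(setCK K); apply: measurableC; apply: open_borel.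
by apply: closed_openC; exact: (compact_closed (@Mspace_hausdorff R)).
Qed.

Lemma within_continuous_Mspace (C : set R) :
  (forall x y, {within C, continuous (fun u => Mdist (fT u) x y)}) ->
  {within C, continuous fT}.
Proof.
move=> hC; apply/subspace_continuousP => u Cu V /=.
rewrite nbhsE => -[W [oW Wu] WV].
have [s [us sW]] := open_box oW Wu.
suff : within C (nbhs u) (fT @^-1` box s).
  by apply: filterS => v /sW/WV.
elim: s us {sW} => [|i s ih] us; first by apply: filterS filterT => v _ j.
have is1 : within C (nbhs u) [set v | ratr i.2.1 < Mdist (fT v) i.1.1 i.1.2 < ratr i.2.2].
  have /subspace_continuousP/(_ u Cu) := hC i.1.1 i.1.2.
  have /andP[h1 h2] := us i (mem_head _ _).
  move=> h; have : nbhs (Mdist (fT u) i.1.1 i.1.2) [set` `]ratr i.2.1, ratr i.2.2[%R].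
    apply: open_nbhs_nbhs; split; first exact: interval_open.
    by rewrite /= in_itv /= h1 h2.
  move=> /h k.
  have {}k : within C (nbhs u) ((fun v => Mdist (fT v) i.1.1 i.1.2) @^-1`
      [set` `]ratr i.2.1, ratr i.2.2[%R]) by exact: k.
  by apply: filterS k => v; rewrite /preimage /= in_itv.
have is2 : within C (nbhs u) (fT @^-1` box s).
  by apply: ih => j js; apply: us; rewrite inE js orbT.
apply: filterS2 is1 is2 => v h1 h2 j; rewrite inE => /orP[/eqP ->//|js]; exact: h2.
Qed.

(** By Lusin's theorem for each of the countably many distances, the map is
    continuous on a compact set of almost full measure; the image of that set
    is compact. *)
Lemma radon_push : radon (push U mf).
Proof.
move=> A mA; apply/eqP; rewrite eq_le; apply/andP; split; last first.
  apply: ge_ereal_sup => _ [K [cK KA] <-].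
  by apply: le_measure; rewrite ?inE//; exact: measurable_compact_Mspace.
apply/lee_addgt0Pr => e e0.
have mB' : measurable (f @^-1` A) by exact: measurable_preim.
pose B := f @^-1` A `&` `[0, 1].
have mB : measurable B by apply: measurableI => //; exact: measurable_itv.
have finB : (lebesgue_measure B < +oo)%E.
  rewrite -unifE//; apply: le_lt_trans (probability_le1 U mB') _; exact: ltry.
pose g (n : nat) (u : R) : R :=
  if unpickle n is Some xy then Mdist (f u) (xy : Vinf * Vinf).1 xy.2 else 0.
have mg n : measurable_fun B (g n).
  apply: measurable_funTS; rewrite /g; case: (unpickle n) => [xy|]; last exact: measurable_cst.
  exact: (measurableT_comp (measurable_Mdist xy.1 xy.2) mf).
have en0 n : 0 < e / (2 ^ n.+1)%:R :> R by rewrite divr_gt0// ltr0n expn_gt0.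
have [K hK] := choice (fun n => measurable_almost_continuous mB finB (en0 n) (mg n)).
pose C := \bigcap_n K n.
have hR : hausdorff_space R by exact: Rhausdorff.
have clK n : closed (K n) by apply: (compact_closed hR); have [] := hK n.
have CK n : C `<=` K n by move=> u; apply.
have clC : closed C by apply: closed_bigI => n _; exact: clK.
have cC : compact C by apply: (subclosed_compact clC _ (CK 0%N)); have [] := hK 0%N.
have CB : C `<=` B by apply: subset_trans (CK 0%N) _; have [] := hK 0%N.
have mK n : measurable (K n) by exact: closed_measurable.
have mC : measurable C by exact: closed_measurable.
have contC : {within C, continuous fT}.
  apply: within_continuous_Mspace => x y.
  have [_ _ _] := hK (pickle (x, y)).
  move/(continuous_subspaceW (CK _)); rewrite /g pickleK; exact.
have cI := continuous_compact contC cC.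
have mI := measurable_compact_Mspace cI.
apply: (@le_trans _ _ (push U mf (fT @` C) + e%:E)%E); last first.
  rewrite leeD2r//; apply: ereal_sup_ubound; exists (fT @` C) => //; split=> //.
  by move=> _ [u Cu <-]; have [] := CB _ Cu.
have leC : (lebesgue_measure C <= push U mf (fT @` C))%E.
  rewrite /push /= unifE; last exact: measurable_preim.
  apply: le_measure; rewrite ?inE//.
    apply: measurableI; [exact: measurable_preim|exact: measurable_itv].
  by move=> u Cu; split; [exists u|have [] := CB _ Cu].
have leD : (lebesgue_measure (B `\` C) <= e%:E)%E.
  apply: (@le_trans _ _ (\sum_(0 <= n <oo) lebesgue_measure (B `\` K n)))%E.
    have mBK n : measurable (B `\` K n) by exact: measurableD mB (mK n).
    have mBC : measurable (B `\` C) by exact: measurableD mB mC.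
    apply: (measure_sigma_subadditive (@lebesgue_measure R) mBK mBC).
    + move=> u [Bu nC]; apply: contrapT => h; apply: nC => n _.
      by apply: contrapT => nK; apply: h; exists n.
  have := @epsilon_trick R (fun=> 0%E) e xpredT (fun=> lexx _) (ltW e0).
  rewrite [X in (_ <= X + _)%E -> _]eseries0// add0e; apply: le_trans; apply: lee_nneseries => [n _ _|n _]; first by [].
  by rewrite add0e ltW//; have [] := hK n.
have -> : push U mf A = lebesgue_measure B by rewrite /push /= unifE.
apply: le_trans (leeD leC leD).
rewrite -{1}(setDUK CB); apply: measureU2 => //; exact: measurableD.
Qed.

End radon_image.

(** * Absence of atoms *)

Lemma measurable_set_eq d (T : measurableType d) (R : realType) (f : T -> R) c :
  measurable_fun setT f -> measurable [set t | f t = c].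
Proof.
move=> mf.
rewrite [X in measurable X](_ : _ = [set t | f t <= c] `&` [set t | c <= f t]).
  by apply: measurableI; apply: measurable_set_le => //; exact: measurable_cst.
apply/seteqP; split=> t /=; first by move=> ->; rewrite lexx.
by move=> [h1 h2]; apply/eqP; rewrite eq_le h1 h2.
Qed.

(** If the sets [A `&` [set t | X t <= c]] all had mass [0] or that of [A], the
    mass of [A] would sit on the level set of [X] at the supremum of the [c] of
    the first kind. *)
Lemma nonatomic_of_diffuse d (T : measurableType d) (R : realType)
    (P : probability T R) (X : T -> R) : measurable_fun setT X ->
  (forall t, 0 < X t) -> (forall c, pr P [set t | X t = c] = 0) -> nonatomic P.
Proof.
move=> mX X0 Xc A mA PA0.
have mle c : measurable [set t | X t <= c].
  by apply: measurable_set_le; [exact: mX|exact: measurable_cst].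
have mAle c : measurable (A `&` [set t | X t <= c]) by exact: measurableI.
pose h c := pr P (A `&` [set t | X t <= c]).
have A0 : 0 < pr P A by rewrite -lte_fin -(prE P mA).
apply: contrapT => noB.
have h01 c : h c = 0 \/ h c = pr P A.
  apply: contrapT => /not_orP[/eqP h0 /eqP h1]; apply: noB.
  exists (A `&` [set t | X t <= c]).
  rewrite (prE P (mAle c)) (prE P mA) !lte_fin; split=> //.
    by rewrite lt_neqAle eq_sym h0 pr_ge0.
  by rewrite lt_neqAle h1 pr_le.
have hmono c c' : c <= c' -> h c <= h c'.
  move=> cc; apply: pr_le => // t [At /= Xt]; split=> //=; exact: le_trans cc.
pose S := [set c | h c = 0].
have S0 : S 0.
  rewrite /S /= /h (_ : _ `&` _ = set0) ?pr_set0//.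
  by apply/seteqP; split=> // t [_ /=]; rewrite leNgt X0.
have lim0 (F : (set T)^nat) : (forall n, measurable (F n)) ->
    {homo F : m n / (m <= n)%N >-> m `<=` n} -> (forall n, pr P (F n) = 0) ->
    pr P (\bigcup_n F n) = 0.
  move=> mF ndF F0; have := @pr_cvg_bigcup _ _ _ P F mF ndF.
  rewrite (_ : (fun n => pr P (F n)) = cst 0); last exact: funext.
  by move=> k; apply: (cvg_unique _ k (cvg_cst _)).
have inv_le m n : (m <= n)%N -> (n.+1%:R)^-1 <= (m.+1%:R)^-1 :> R.
  by move=> mn; rewrite lef_pV2 ?posrE// ler_nat.
have inv_lt (a b : R) : a < b -> exists n, a + (n.+1%:R)^-1 <= b.
  rewrite -subr_gt0 => ab; exists (Num.truncn (b - a)^-1).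
  rewrite -lerBrDl ltW// invf_plt ?posrE//; exact: truncnS_gt.
have Sub : has_ubound S.
  apply: contrapT => nS.
  have hz c : h c = 0.
    apply: contrapT => hc; apply: nS; exists c => c' Sc'; rewrite leNgt; apply/negP => cc.
    have := hmono _ _ (ltW cc); rewrite Sc' => h0; apply: hc.
    by apply/eqP; rewrite eq_le h0 pr_ge0.
  have := lim0 (fun n => A `&` [set t | X t <= n%:R]) (fun n => mAle _).
  rewrite (_ : \bigcup_n _ = A).
    move=> k; move: A0; rewrite k ?ltxx//.
    - by move=> m n mn t [At /= Xt]; split=> //=; apply: le_trans Xt _; rewrite ler_nat.
    - by move=> n; exact: hz.
  apply/seteqP; split=> t; first by move=> [n _ []].
  move=> At; exists (Num.truncn (X t)).+1 => //; split=> //=.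
  by apply: ltW; exact: truncnS_gt.
pose s := sup S.
have low : pr P (A `&` [set t | X t < s]) = 0.
  have := lim0 (fun n => A `&` [set t | X t <= s - (n.+1%:R)^-1]) (fun n => mAle _).
  rewrite (_ : \bigcup_n _ = A `&` [set t | X t < s]).
    apply.
    - move=> m n mn t [At /= Xt]; split=> //=; apply: le_trans Xt _.
      by rewrite lerD2l lerN2; exact: inv_le.
    - move=> n; have n0 : 0 < (n.+1%:R)^-1 :> R by rewrite invr_gt0 ltr0n.
      have [c Sc sc] := sup_adherent n0 (conj (ex_intro _ 0 S0) Sub).
      have := hmono _ _ (ltW sc); rewrite -/s Sc => h0.
      by apply/eqP; rewrite eq_le h0 pr_ge0.
  apply/seteqP; split=> t.
    move=> [n _ [At /= Xt]]; split=> //=; apply: le_lt_trans Xt _.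
    by rewrite gtrBl invr_gt0 ltr0n.
  move=> [At /= /inv_lt[n hn]]; exists n => //; split=> //=.
  by rewrite lerBrDr.
have high : pr P (A `&` [set t | s < X t]) = 0.
  pose F n := A `&` ~` [set t | X t <= s + (n.+1%:R)^-1].
  have mF n : measurable (F n) by apply: measurableI => //; exact: measurableC.
  have -> : A `&` [set t | s < X t] = \bigcup_n F n.
    apply/seteqP; split=> t.
      move=> [At /= sX]; have [n hn] := inv_lt s ((s + X t) / 2) (midf_lt sX).1.
      exists n => //; split=> //=; apply/negP; rewrite -ltNge.
      by apply: le_lt_trans hn _; exact: (midf_lt sX).2.
    move=> [n _ [At /negP]]; rewrite -ltNge => Xt; split=> //=.
    by apply: lt_trans Xt; rewrite ltrDl invr_gt0 ltr0n.
  apply: lim0 => //.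
    move=> m n mn t [At /= Xt]; split=> //= k; apply: Xt; apply: le_trans k _.
    by rewrite lerD2l; exact: inv_le.
  move=> n; have hE : h (s + (n.+1%:R)^-1) = pr P A.
    case: (h01 (s + (n.+1%:R)^-1)) => // k; exfalso.
    have : s + (n.+1%:R)^-1 <= s by apply: ub_le_sup.
    by rewrite gerDl leNgt invr_gt0 ltr0n.
  have := pr_setU_disj P (mAle (s + (n.+1%:R)^-1)) (mF n).
  rewrite /F -setIUr setUv setIT -/(h _) hE => k.
  have : pr P A = pr P A + pr P (F n).
    by apply: k; rewrite setIACA setICr setI0.
  by move: (pr P A) (pr P (F n)) => a b; lra.
have mlt : measurable (A `&` [set t | X t < s]).
  by apply: measurableI => //; apply: measurable_set_lt; [exact: mX|exact: measurable_cst].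
have mgt : measurable (A `&` [set t | s < X t]).
  by apply: measurableI => //; apply: measurable_set_lt; [exact: measurable_cst|exact: mX].
have meq : measurable [set t | X t = s] by exact: measurable_set_eq.
have m1 := measurableU _ _ mlt mgt; have m2 := measurableU _ _ m1 meq.
have : pr P A <= pr P (A `&` [set t | X t < s] `|` A `&` [set t | s < X t] `|` [set t | X t = s]).
  by apply: pr_le => // t At /=; case: (ltgtP (X t) s) => k; [left; left|left; right|right].
move=> /le_trans/(_ (pr_setU P m1 meq)); rewrite Xc addr0.
move=> /le_trans/(_ (pr_setU P mlt mgt)); rewrite low high addr0.
by rewrite leNgt A0.
Qed.

Section main.
Context {R : realType}.
Local Notation M := (borel (Mspace R)).
Local Notation S := (borel (Rpos R)).
Variable m : probability S R.
Hypothesis m_nonatomic : nonatomic m.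
Local Notation zeta := (fun z : S => \val z : R).

Lemma measurable_val_eq (c : R) : measurable [set z : S | zeta z = c].
Proof. exact: (measurable_set_eq c (@measurable_val R)). Qed.

Lemma m_val_eq (c : R) : m [set z : S | zeta z = c] = 0%E.
Proof.
apply/eqP; rewrite eq_le measure_ge0 andbT leNgt; apply/negP => h.
have [B [mB BA B0 BltA]] := m_nonatomic (measurable_val_eq c) h.
have [[b Bb]|nB] := pselect (exists b, B b); last first.
  by move: B0; rewrite (_ : B = set0) ?measure0 ?ltxx//; apply/seteqP; split=> // b Bb; apply: nB; exists b.
move: BltA; rewrite (_ : B = [set z | zeta z = c]) ?ltxx//.
apply/seteqP; split=> // z /= zc.
have -> : z = b by apply: val_inj; exact: etrans zc (esym (BA _ Bb)).
exact: Bb.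
Qed.

(** Given the four metrics, the distance between the ends is a positive multiple
    of [xi]. *)
Lemma stationary_end_dist_diffuse lambda (P : probability M R) :
  stationary m lambda P -> forall c, pr P [set d | end_dist d = c] = 0.
Proof.
move=> Pst c.
have mc := measurable_set_eq c (@measurable_end_dist R).
have mA := measurable_preim (@measurable_Rglue R lambda) mc.
rewrite /pr -(Pst _ mc).
set A := Rglue lambda @^-1` _ in mA.
transitivity (fine (\int[(P \x P \x P \x P)%E]_z m (xsection A z)))%E; first by [].
rewrite integral0_eq// => z _.
set L := \val lambda * chain_dist (cells z) glue_point VIn VOut.
have L0 : 0 < L.
  rewrite mulr_gt0 ?Rpos_gt0// (chain_dist_ends (cells_metric z)).
  have pos e : 0 < cells z e VIn VOut.
    rewrite lt_neqAle (is_metric_ge0 (cells_metric z e)) andbT eq_sym.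
    by apply/eqP => h; have [_ /(_ _ _ h)] := cells_metric z e.
  by rewrite addr_gt0// lt_min !pos.
rewrite (_ : xsection A z = [set x : S | zeta x = c / L]); first exact: m_val_eq.
apply/seteqP; split=> x; rewrite /xsection /= inE /A /preimage /=.
  have -> : end_dist (Rglue lambda (z, x)) = zeta x * L.
    rewrite /L mulrCA mulrA; exact: erefl.
  by move=> <-; rewrite mulfK// gt_eqF.
move=> xE; have -> : end_dist (Rglue lambda (z, x)) = zeta x * L.
  rewrite /L mulrCA mulrA; exact: erefl.
have LN0 : L != 0 by rewrite gt_eqF.
exact: etrans (congr1 (fun t => t * L) xE) (divfK LN0 c).
Qed.

Hypothesis m_full : fully_supported m.

Lemma m_open_gt0 (V : set R) : open V -> (exists2 x, 0 < x & V x) ->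
  0 < pr m [set z : S | V (zeta z)].
Proof.
move=> oV [x x0 Vx].
have oW : open [set z : Rpos R | V (\val z)] by exists V.
have mW : measurable ([set z : S | V (zeta z)]) by exact: open_borel.
rewrite -lte_fin -(prE m mW); apply: m_full => //.
have xP : x \in (`]0, +oo[%classic : set R) by apply/mem_set; rewrite /= in_itv /= x0.
by exists (SigSub xP).
Qed.

End main.

Theorem theorem1 (R : realType) (m : probability (borel (Rpos R)) R)
    (m_nonatomic : nonatomic m) (m_full : fully_supported m) :
  exists (lambda_cr : Rpos R) (mbar : probability (borel (Mspace R)) R),
    [/\ radon mbar, nonatomic mbar & stationary m lambda_cr mbar].
Proof.
have z0 (z : borel (Rpos R)) : 0 < (\val z : R) by exact: Rpos_gt0.
have small e : 0 < e -> 0 < pr m [set z : borel (Rpos R) | (\val z : R) < e].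
  move=> e0; apply: (@m_open_gt0 R m m_full [set x | x < e]).
    by rewrite (_ : [set x | x < e] = `]-oo, e[%classic); [exact: interval_open|apply/seteqP; split=> y /=; rewrite in_itv].
  by exists (e / 2) => /=; [rewrite divr_gt0|rewrite ltr_pdivrMr// ltr_pMr// ltr1n].
have large e : 0 < pr m [set z : borel (Rpos R) | e < (\val z : R)].
  apply: (@m_open_gt0 R m m_full [set x | e < x]).
    by rewrite (_ : [set x | e < x] = `]e, +oo[%classic); [exact: interval_open|apply/seteqP; split=> y /=; rewrite in_itv/= andbT].
  exists (Order.max 0 e + 1); first by rewrite ltr_wpDl// le_max lexx.
  by rewrite /= ltr_pwDr// le_max lexx orbT.
have [l [G Gst]] := stationary_law_exists (@measurable_val R) z0 small large.
have l0 : 0 < l by have [[]] := Gst.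
have lP : l \in (`]0, +oo[%classic : set R) by apply/mem_set; rewrite /= in_itv /= l0.
pose lambda : Rpos R := SigSub lP.
have Gst' : proper_stationary m (fun z : borel (Rpos R) => \val z : R) (\val lambda) G by [].
exists lambda, (limit_law Gst').
have st := limit_law_stationary Gst'.
split=> //; first exact: radon_push.
apply: (@nonatomic_of_diffuse _ _ _ _ (@end_dist R)).
- exact: measurable_end_dist.
- move=> d; rewrite lt_neqAle (is_metric_ge0 (Mdist_metric d)) andbT eq_sym.
  by apply/eqP => h; have [_ /(_ _ _ h)] := Mdist_metric d.
- exact: (stationary_end_dist_diffuse m_nonatomic st).
Qed.
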